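(* Let $V$ be any of the 12 configurations $D_5,L_5,Q_5,R_5,E_6,C6\text{-}72b,C6\text{-}72c,C6\text{-}72d,E_7,C7\text{-}126b,C7\text{-}126c,C7\text{-}126d$. Then $V$ carries a unit-edge polytope $P^{*}$ with vertex set $V$ (equal to $\operatorname{conv}V$ for $D_5,L_5,E_6,E_7$, and non-convex and different from $\operatorname{conv}V$ for the other eight) such that: (1) $P^{*}$ is creased: all its folds are shallow, and every facet on an external hyperplane contains every point of $V$ on that hyperplane; (2) the facets of $P^{*}$ lying on external hyperplanes are exactly the unit-edge facets of $\operatorname{conv}V$, and the folds of $P^{*}$ are exactly the facets of $P^{*}$ that are not facets of $\operatorname{conv}V$.
   Context: **Kissing configurations.** A kissing configuration is a finite set $V\subset\mathbb{S}^{n-1}$ with $\langle u,v\rangle\le\frac12$ for all distinct $u,v\in V$. The center is the origin $o$. **The 12 configurations.** Each is a finite set of vectors of squared norm $2$ listed below, scaled by $1/\sqrt2$ (and considered up to isometry). Let $e_i$ be the standard basis. For a finite set $X$ and $a\neq0$, let $R_a$ be the orthogonal reflection in $a^\perp$ and put $X^{a}=\{x\in X:\langle x,a\rangle\ge0\}\cup R_a(\{x\in X:\langle x,a\rangle>0\})$. Write $\Phi(D_m)=\{\pm e_i\pm e_j: 1\le i<j\le m\}$. In $\mathbb{R}^4$ let $A=\{\pm e_1,\dots,\pm e_4\}$, and let $B$ (resp. $C$) be the set of vectors $(\pm\frac12,\pm\frac12,\pm\frac12,\pm\frac12)$ with an even (resp. odd) number of minus signs. - Dimension 5 (40 points each).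 $D_5$: $\Phi(D_5)$. $L_5$: $\{(x,0):x\in\Phi(D_4)\}\cup\{(x,1):x\in A\}\cup\{(x,-1):x\in C\}$. With $a=(1,1,1,1,1)$: $Q_5=(D_5)^a$ and $R_5=(L_5)^a$. - Dimension 6 (72 points each). For colors $c_0,\dots,c_5\in\{A,B,C\}$ let $X(c_0\dots c_5)=\{(x,0,0):x\in\Phi(D_4)\}\cup\bigcup_{k=0}^{5}\{(x,\cos\frac{k\pi}3,\sin\frac{k\pi}3):x\in c_k\}$. $E_6=X(ABCABC)$, $C6\text{-}72b=X(ABCACB)$, $C6\text{-}72c=X(ABABAB)$, $C6\text{-}72d=X(ABABAC)$. - Dimension 7 (126 points each). Let $S_+$ (resp. $S_-$) be the vectors $(\pm\frac12)^6\in\mathbb{R}^6$ with an even (resp. odd) number of minus signs. $E_7=\{(x,0):x\in\Phi(D_6)\}\cup\{\pm\sqrt2\,e_7\}\cup\{(s,\pm\frac1{\sqrt2}):s\in S_+\}$. $C7\text{-}126b=\{(x,0):x\in\Phi(D_6)\}\cup\{\pm\sqrt2\,e_7\}\cup\{(s,\frac1{\sqrt2}):s\in S_+\}\cup\{(s,-\frac1{\sqrt2}):s\in S_-\}$. With $a=(1,0,0,0,0,0,\frac1{\sqrt2})$: $C7\text{-}126c=(E_7)^a$ and $C7\text{-}126d=(C7\text{-}126b)^a$. **Polytope.** A polytope in $\mathbb{R}^n$ (not necessarily convex) is a finite set of $(n-1)$-dimensional convex polytopes, its facets. Its faces are the faces of its facets; its $(n-2)$-faces are ridges, $(n-3)$-faces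 are peaks, $1$-faces are edges, $0$-faces are vertices. It is required that: (a) every ridge belongs to exactly two facets; (b) the facets containing any given peak form a single cycle (consecutive ones sharing a ridge through the peak) whose spherical angles sum to $2\pi$; (c) the set of facets is connected through ridges; (d) the affine hull of every facet is a hyperplane not containing the center $o$; (e) the cycle at a peak goes round exactly once: projected to the $2$-plane orthogonal to the linear span of the peak, the facets of the cycle become wedges which tile the circle with winding number one; (f) two facets sharing a ridge do not lie in the same hyperplane. A polytope (or a facet) is unit-edge when every one of its edges has length $1$. A polytope is convex when its facets are exactly the facets of the convex hull of its vertices; $\operatorname{conv}V$ is identified with its set of facets. **Creased.** Let a polytope have vertex set $V$. A hyperplane $H$ is external when all of $V$ lies weakly on one side of it, and internal otherwise. A facet on an internal hyperplane $H$ is a fold; it is a shallow fold when its vertices are exactly the points of $V$ lying in one closed half of $H$, the half being bounded by an $(n-2)$-flat of $H$ spanned by the circumcenter of $V\cap H$ and $n-2$ points of $V\cap H$. The polytope is creased when every facet on an external hyperplane $H$ contains every point of $V\cap H$ and every fold is shallow. *)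

(* Defs.v *)
From HB Require Import structures.
From mathcomp Require Import all_boot all_order all_algebra.
From mathcomp Require Import all_classical all_reals all_analysis.
From Stdlib Require Import Relation_Operators.

Set Implicit Arguments.
Unset Strict Implicit.
Unset Printing Implicit Defensive.

Import Order.TTheory GRing.Theory Num.Theory.
Local Open Scope classical_set_scope.
Local Open Scope ring_scope.

(* Points of R^n are row vectors.  The library norm
   `|_| on 'rV[R]_n is the sup norm, so Euclidean notions go through [dot]. *)

Section Euclidean.
Context {R : realType} {n : nat}.
Implicit Types (u v x : 'rV[R]_n) (S F K H L : set 'rV[R]_n).

Definition dot u v : R := (u *m v^T) 0 0.

Definition enorm v : R := Num.sqrt (dot v v).

Definition level (c : 'rV[R]_n) (b : R) : set 'rV[R]_n :=
  [set x | dot c x = b].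

Definition halfspace (c : 'rV[R]_n) (b : R) : set 'rV[R]_n :=
  [set x | dot c x <= b].

Definition hyperplane H : Prop := exists c b, c != 0 /\ H = level c b.

Definition hull S : set 'rV[R]_n := smallest (@convex_set R 'rV[R]_n) S.

Definition aff S : set 'rV[R]_n :=
  [set y | exists (m : nat) (a : 'I_m -> R) (x : 'I_m -> 'rV[R]_n),
      [/\ forall i, S (x i), \sum_i a i = 1 & y = \sum_i a i *: x i]].

Definition flat (d : nat) L : Prop :=
  exists (p : 'rV[R]_n) (M : 'M[R]_(d, n)),
    \rank M = d /\ L = [set p + w *m M | w in [set: 'rV[R]_d]].

(* No [d] satisfies this for the empty set. *)
Definition has_dim (d : nat) S : Prop := flat d (aff S).

Definition convex_polytope K : Prop :=
  exists S : set 'rV[R]_n, finite_set S /\ K = hull S.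

(* [K] itself (take c = 0, b = 0) and possibly the empty set are faces. *)
Definition face K F : Prop :=
  exists c b, K `<=` halfspace c b /\ F = K `&` level c b.

Definition facets K : set (set 'rV[R]_n) :=
  [set F | face K F /\ has_dim (n - 1) F].

Definition vertices K : set 'rV[R]_n := [set v | face K [set v]].

Definition unit_segment (E : set 'rV[R]_n) : Prop :=
  exists x y, E = hull [set x; y] /\ enorm (x - y) = 1.

Definition unit_edge_facet K : Prop :=
  forall E, face K E -> has_dim 1 E -> unit_segment E.

(* The cone over the orthogonal projection of [F] to the plane with
   orthonormal basis (a, b). *)
Definition wedge (a b : 'rV[R]_n) F : set 'rV[R]_n :=
  [set t *: (dot x a *: a + dot x b *: b) | t in [set t : R | 0 <= t] & x in F].

Definition sector (a b : 'rV[R]_n) (alpha beta : R) : set 'rV[R]_n :=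
  [set t *: (cos phi *: a + sin phi *: b)
    | t in [set t : R | 0 <= t] & phi in [set phi | alpha <= phi <= beta]].

(* When [G] is an (n-3)-dimensional polytope whose affine hull misses 0, its
   linear span has dimension n-2, so (a, b) is then an orthonormal basis of the
   whole orthogonal complement of that span. *)
Definition normal_frame (G : set 'rV[R]_n) (a b : 'rV[R]_n) : Prop :=
  [/\ dot a a = 1, dot b b = 1, dot a b = 0
    & forall g, G g -> dot g a = 0 /\ dot g b = 0].

(* The angle at [G] of the radial projection of [F] to the sphere, i.e. the
   dihedral angle at the cone over [G] of the cone over [F]. *)
Definition spherical_angle (F G : set 'rV[R]_n) (theta : R) : Prop :=
  exists a b, [/\ normal_frame G a b, 0 < theta < 2 * pi
    & wedge a b F = sector a b 0 theta].

End Euclidean.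

(* The dimensions n - 1, n - 2, n - 3 below are natural number subtractions;
   the notions are meant for n >= 3. *)
Section Polytope.
Context {R : realType} {n : nat}.
Implicit Types (P : set (set 'rV[R]_n)) (V F G H : set 'rV[R]_n).

(* The [d]-dimensional faces of a polytope given by its set of facets. *)
Definition dface P (d : nat) : set (set 'rV[R]_n) :=
  [set G | has_dim d G /\ exists2 F, P F & face F G].

Definition ridge P := dface P (n - 2).
Definition peak P := dface P (n - 3).
Definition edge P := dface P 1.

Definition vertex_set P : set 'rV[R]_n := [set v | dface P 0 [set v]].

Definition share_ridge P F F' : Prop :=
  exists G, [/\ ridge P G, face F G & face F' G].

(* [F] is a cyclic enumeration of the facets of P at the peak G; the facet
   [F i] lies between the ridges [Rd i] and [Rd (ordS i)], where ordS is the
   cyclic successor. *)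
Definition peak_cycle P G (k : nat) (F Rd : 'I_k -> set 'rV[R]_n) : Prop :=
  [/\ injective F /\ range F = [set F' | P F' /\ face F' G],
      injective Rd,
      forall i, ridge P (Rd i) /\ face (Rd i) G
    & forall i, face (F i) (Rd i) /\ face (F i) (Rd (ordS i))].

Definition angles_sum_2pi G (k : nat) (F : 'I_k -> set 'rV[R]_n) : Prop :=
  exists alpha : 'I_k -> R,
    (forall i, spherical_angle (F i) G (alpha i)) /\
    \sum_i alpha i = 2 * pi.

Definition winds_once G (k : nat) (F : 'I_k -> set 'rV[R]_n) : Prop :=
  exists (a b : 'rV[R]_n) (theta : nat -> R),
    [/\ normal_frame G a b,
        forall i : 'I_k, theta i < theta i.+1,
        theta k = theta 0%N + 2 * pi
      & forall i : 'I_k, wedge a b (F i) = sector a b (theta i) (theta i.+1)].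

Record polytope P : Prop := Polytope {
  polytope_finite : finite_set P;
  polytope_facet : forall F, P F -> convex_polytope F /\ has_dim (n - 1) F;
  polytope_ridge : forall G, ridge P G ->
    exists F F', F <> F' /\ [set F0 | P F0 /\ face F0 G] = [set F; F'];
  polytope_peak : forall G, peak P G ->
    exists (k : nat) (F Rd : 'I_k -> set 'rV[R]_n),
      [/\ peak_cycle P G F Rd, angles_sum_2pi G F & winds_once G F];
  polytope_connected : forall F F', P F -> P F' ->
    clos_refl_trans _
      (fun F1 F2 => [/\ P F1, P F2 & share_ridge P F1 F2]) F F';
  polytope_center : forall F, P F -> hyperplane (aff F) /\ ~ aff F 0;
  polytope_crease : forall F F', P F -> P F' -> F <> F' ->
    share_ridge P F F' ->
    ~ exists H, [/\ hyperplane H, F `<=` H & F' `<=` H] }.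

Definition unit_edge P : Prop :=
  forall E, edge P E -> unit_segment E.

Definition convex P : Prop := P = facets (hull (vertex_set P)).

Definition external V H : Prop :=
  exists c b, [/\ c != 0, H = level c b & V `<=` halfspace c b].

Definition internal V H : Prop := hyperplane H /\ ~ external V H.

Definition fold P F : Prop :=
  P F /\ exists H, internal (vertex_set P) H /\ F `<=` H.

Definition circumcenter (S : set 'rV[R]_n) (o : 'rV[R]_n) : Prop :=
  aff S o /\ exists r : R, forall x, S x -> enorm (x - o) = r.

(* [K] is one of the two closed halves of H bounded by L. *)
Definition closed_half H (L K : set 'rV[R]_n) : Prop :=
  exists c b, L = H `&` level c b /\ K = H `&` halfspace c b.

Definition shallow V H F : Prop :=
  exists (o : 'rV[R]_n) (p : 'I_(n - 2) -> 'rV[R]_n) (L K : set 'rV[R]_n),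
    [/\ circumcenter (V `&` H) o,
        forall i, (V `&` H) (p i),
        L = aff (o |` range p) /\ has_dim (n - 2) L,
        closed_half H L K
      & vertices F = V `&` K].

Definition creased P : Prop :=
  (forall F H, P F -> external (vertex_set P) H -> F `<=` H ->
     vertex_set P `&` H `<=` F) /\
  (forall F H, P F -> internal (vertex_set P) H -> F `<=` H ->
     shallow (vertex_set P) H F).

End Polytope.

Section Configurations.
Variable R : realType.

Definition sgn (s : bool) : R := (-1) ^+ s.

Definition e_ {n} (i : 'I_n) : 'rV[R]_n := delta_mx 0 i.

Definition reflect_in {n} (a x : 'rV[R]_n) : 'rV[R]_n :=
  x - (2 * dot x a / dot a a) *: a.

(* X^a: keep the side of a^\perp containing a, mirror its open part. *)
Definition mirror {n} (X : set 'rV[R]_n) (a : 'rV[R]_n) : set 'rV[R]_n :=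
  [set x | X x /\ 0 <= dot x a] `|`
  reflect_in a @` [set x | X x /\ 0 < dot x a].

Definition Phi_D (m : nat) : set 'rV[R]_m :=
  [set x | exists (i j : 'I_m) (s t : bool),
      (i < j)%N /\ x = sgn s *: e_ i + sgn t *: e_ j].

Arguments Phi_D : clear implicits.

(* Vectors (+-1/2, ..., +-1/2) with an even (odd_signs = false) or odd
   (odd_signs = true) number of minus signs. *)
Definition half_vectors (m : nat) (odd_signs : bool) : set 'rV[R]_m :=
  [set x | exists s : {set 'I_m},
      odd #|s| = odd_signs /\ x = \row_i (sgn (i \in s) / 2)].

Arguments half_vectors : clear implicits.

Inductive color := A | B | C.

Definition color_set (c : color) : set 'rV[R]_4 :=
  match c with
  | A => [set x | exists (i : 'I_4) (s : bool), x = sgn s *: e_ i]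
  | B => half_vectors 4 false
  | C => half_vectors 4 true
  end.

Definition ext1 {n} (x : 'rV[R]_n) (t : R) : 'rV[R]_(n + 1) :=
  row_mx x (const_mx t).

Definition D5_vectors : set 'rV[R]_5 := Phi_D 5.

Definition L5_vectors : set 'rV[R]_5 :=
  [set ext1 x 0 | x in Phi_D 4] `|`
  [set ext1 x 1 | x in color_set A] `|`
  [set ext1 x (-1) | x in color_set C].

Definition X_vectors (c : 6.-tuple color) : set 'rV[R]_6 :=
  [set ext1 (ext1 x 0) 0 | x in Phi_D 4] `|`
  \bigcup_(k in [set: 'I_6])
    [set ext1 (ext1 x (cos (k%:R * pi / 3))) (sin (k%:R * pi / 3))
      | x in color_set (tnth c k)].

Definition E7_like (lower : bool) : set 'rV[R]_7 :=
  [set ext1 x 0 | x in Phi_D 6] `|`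
  [set ext1 0 (Num.sqrt 2); ext1 0 (- Num.sqrt 2)] `|`
  [set ext1 x (1 / Num.sqrt 2) | x in half_vectors 6 false] `|`
  [set ext1 x (- (1 / Num.sqrt 2)) | x in half_vectors 6 lower].

Definition axis5 : 'rV[R]_5 := const_mx 1.

Definition axis7 : 'rV[R]_7 := ext1 (e_ (0 : 'I_6)) (1 / Num.sqrt 2).

End Configurations.

Arguments D5_vectors : clear implicits.
Arguments L5_vectors : clear implicits.
Arguments X_vectors : clear implicits.
Arguments E7_like : clear implicits.
Arguments axis5 : clear implicits.
Arguments axis7 : clear implicits.

Inductive config :=
  | D5 | L5 | Q5 | R5
  | E6 | C6_72b | C6_72c | C6_72d
  | E7 | C7_126b | C7_126c | C7_126d.

Definition cdim (c : config) : nat :=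
  match c with
  | D5 | L5 | Q5 | R5 => 5
  | E6 | C6_72b | C6_72c | C6_72d => 6
  | E7 | C7_126b | C7_126c | C7_126d => 7
  end.

(* Before rescaling: all vectors have squared norm 2. *)
Definition vectors (R : realType) (c : config) : set 'rV[R]_(cdim c) :=
  match c return set 'rV[R]_(cdim c) with
  | D5 => D5_vectors R
  | L5 => L5_vectors R
  | Q5 => mirror (D5_vectors R) (axis5 R)
  | R5 => mirror (L5_vectors R) (axis5 R)
  | E6 => X_vectors R [tuple A; B; C; A; B; C]
  | C6_72b => X_vectors R [tuple A; B; C; A; C; B]
  | C6_72c => X_vectors R [tuple A; B; A; B; A; B]
  | C6_72d => X_vectors R [tuple A; B; A; B; A; C]
  | E7 => E7_like R false
  | C7_126b => E7_like R true
  | C7_126c => mirror (E7_like R false) (axis7 R)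
  | C7_126d => mirror (E7_like R true) (axis7 R)
  end.

Arguments vectors : clear implicits.

Definition points (R : realType) (c : config) : set 'rV[R]_(cdim c) :=
  [set (Num.sqrt 2)^-1 *: x | x in vectors R c].

Arguments points : clear implicits.

(* Congruent by an isometry of R^n fixing the center 0. *)
Definition isometric {R : realType} {n : nat} (X Y : set 'rV[R]_n) : Prop :=
  exists Q : 'M[R]_n, Q *m Q^T = 1%:M /\ Y = [set x *m Q | x in X].

Definition is_convex_case (c : config) : bool :=
  match c with D5 | L5 | E6 | E7 => true | _ => false end.

(* Main.v *)
(* Each polytope P* is given in integer coordinates by keys (r, K, s): the facet is the hull of the
   points z of V with <r, z> = K and <s, z> <= 0.  The keys form the orbits, under two isometries of
   V, of a few representatives.  A generator g need not be handled as an isometry: precomposing the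
   embedding Phi of the integer points with g yields another embedding with the same point set and
   the same polytope, so a property proved for the representative facets and all embeddings holds
   for all facets.

   For one facet everything reduces to finite checks by the closure rule: if x and y lie on a face
   and x + y = z + z' with z, z' in the point set, then z and z' lie on that face.  A search through
   closed subsets shows that every proper face is contained in one of the listed ridges, and every
   proper face of a ridge in one of the listed peaks.  Around a peak the facets project to planar
   sectors whose boundary rays match up and pass a reference ray only once.

   Conversely, let F be a unit-edge facet of conv V with vertex v.  The edges of F at v span F, so
   v and its neighbours at unit distance on F span the hyperplane of F; a search through the subsets
   of the unit neighbours of v, discarding those which would force a non-unit edge or violate a
   supporting inequality, leaves only subsets of listed facets. *)
From Stdlib Require Import ZArith.
From HB Require Import structures.
Require Import Defs.
From mathcomp Require Import all_boot all_order all_algebra.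
From mathcomp Require Import all_classical all_reals all_analysis.
From mathcomp Require Import ring lra ssrZ zify.
From Stdlib Require Import Relation_Operators.
Delimit Scope nat_scope with N.
Delimit Scope Z_scope with Z.
Set Implicit Arguments.
Unset Strict Implicit.
Unset Printing Implicit Defensive.
Import Order.TTheory GRing.Theory Num.Theory.

(** * Certificates *)

(** The irrational coordinates enter only through one factor per axis. Removing these factors makes
    all points integral, and scalar products become integers for a diagonal form with weights. The
    points have a common norm N and sum 0. The first makes each of them a vertex, so that lists of
    points can stand for their hulls; the second forces every nonconstant supporting functional to
    have a positive maximum. Since facet hyperplanes avoid the origin, dimension d means linear rank
    d + 1, and dimensions become integer elimination. The closure rule bounds the faces from above
    only: that the listed ridges are faces is shown by the hyperplanes of the neighbouring facets,
    which cut them out. Angles are never computed: successive rays at a peak turn by less than pi,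
    and signs of determinants against the first ray exclude a second turn. In the non-convex cases
    conv V has further facets, with non-unit edges, which are never enumerated. They are ruled out
    locally: by a non-unit edge of conv V, or by a positive combination that breaks a supporting
    inequality. *)

Definition vec := seq Z.

Fixpoint zdot (x y : vec) : Z :=
  match x, y with a :: x', b :: y' => (a * b + zdot x' y')%Z | _, _ => 0%Z end.

Fixpoint hmul (x y : vec) : vec :=
  match x, y with a :: x', b :: y' => (a * b)%Z :: hmul x' y' | _, _ => [::] end.

Fixpoint vadd (x y : vec) : vec :=
  match x, y with
  | a :: x', b :: y' => (a + b)%Z :: vadd x' y'
  | [::], _ => y
  | _, [::] => x
  end.

Definition vscale (a : Z) (x : vec) : vec := [seq (a * b)%Z | b <- x].

Fixpoint vmul (x : vec) (M : seq vec) : vec :=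
  match x, M with a :: x', r :: M' => vadd (vscale a r) (vmul x' M') | _, _ => [::] end.

(** Here and below a nested [if] replaces [&&], whose second argument would be computed in any case
    by call-by-value evaluation. *)
Fixpoint veq (x y : vec) : bool :=
  match x, y with
  | a :: x', b :: y' => if (a =? b)%Z then veq x' y' else false
  | [::], [::] => true
  | _, _ => false
  end.

Fixpoint vmem (x : vec) (s : seq vec) : bool :=
  if s is y :: s' then if veq x y then true else vmem x s' else false.

Fixpoint vuniq (s : seq vec) : bool :=
  if s is x :: s' then if vmem x s' then false else vuniq s' else true.

Fixpoint lseq (s t : seq vec) : bool :=
  match s, t with
  | x :: s', y :: t' => if veq x y then lseq s' t' else false
  | [::], [::] => true
  | _, _ => false
  end.

(* The points z of V with <r, z> = K and <s, z> <= 0; s = [::] except for a fold smaller than the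
   whole section V `&` H. *)
Record key := Key { kr : vec; kK : Z; ks : vec }.

Definition keq (k l : key) : bool :=
  if veq (kr k) (kr l) then if (kK k =? kK l)%Z then veq (ks k) (ks l) else false else false.

Fixpoint kmem (x : key) (s : seq key) : bool :=
  if s is y :: s' then if keq x y then true else kmem x s' else false.

(* A common denominator and a matrix, acting on row vectors. *)
Definition gen := (Z * seq vec)%type.

(** A generator is a rational matrix. The division rounds down, so this is the linear action only
    where [gexact] holds, which is checked on all of V and on all listed keys. *)
Definition gact (g : gen) (x : vec) : vec := [seq (a / g.1)%Z | a <- vmul x g.2].
Definition gexact (g : gen) (x : vec) : bool := veq (vscale g.1 (gact g x)) (vmul x g.2).
Definition kact (g : gen) (k : key) : key := Key (gact g (kr k)) (kK k) (gact g (ks k)).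
Definition kexact (g : gen) (k : key) : bool := gexact g (kr k) && gexact g (ks k).

Section Orbit.
Variables (T G : Type) (mem : T -> seq T -> bool) (act : G -> T -> T) (gs : seq G).
Fixpoint addnew (xs seen new : seq T) : seq T :=
  if xs is x :: xs' then
    if mem x seen then addnew xs' seen new
    else if mem x new then addnew xs' seen new else addnew xs' seen (x :: new)
  else new.
(** Completeness of the orbit is never proved. That the listed keys are closed under the generators
    and that the listed vectors exhaust V is checked on the lists themselves, so too little fuel
    could only make a check fail. *)
Fixpoint orbit_list (fuel : nat) (seen todo : seq T) : seq T :=
  if fuel is f.+1 then
    if todo is [::] then seen
    else let new := addnew [seq act g x | x <- todo, g <- gs] seen [::] in
         orbit_list f (new ++ seen) new
  else seen.
End Orbit.

Fixpoint zhead (s : seq vec) : option vec :=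
  if s is x :: s' then
    if x is a :: _ then if (a =? 0)%Z then zhead s' else Some x else zhead s'
  else None.

(** Fraction-free elimination of the first coordinate. The pivot is not taken out of the list: it
    turns into a zero row, which leaves the rank unchanged. *)
Definition zelim (a : Z) (r x : vec) : vec :=
  if x is b :: x' then
    if (b =? 0)%Z then x' else vadd (vscale a x') (vscale (- b) r)
  else [::].

Fixpoint zrank (m : nat) (s : seq vec) : nat :=
  if m is m'.+1 then
    match zhead s with
    | Some (a :: r) => (zrank m' [seq zelim a r x | x <- s]).+1
    | _ => zrank m' [seq behead x | x <- s]
    end
  else 0.

Fixpoint bsub (a b : bitseq) : bool :=
  match a, b with
  | x :: a', y :: b' => if x then if y then bsub a' b' else false else bsub a' b'
  | _, _ => true
  end.
Fixpoint bmeet (a b : bitseq) : bool :=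
  match a, b with
  | x :: a', y :: b' => if x then if y then true else bmeet a' b' else bmeet a' b'
  | _, _ => false
  end.
Fixpoint bor (a b : bitseq) : bitseq :=
  match a, b with x :: a', y :: b' => (if x then true else y) :: bor a' b' | _, _ => a end.
Fixpoint band (a b : bitseq) : bitseq :=
  match a, b with x :: a', y :: b' => (if x then y else false) :: band a' b' | _, _ => a end.
Definition bnot (a : bitseq) : bitseq := [seq ~~ x | x <- a].
Fixpoint bset (i : nat) (a : bitseq) : bitseq :=
  match a, i with
  | _ :: a', 0 => true :: a'
  | x :: a', i'.+1 => x :: bset i' a'
  | [::], _ => [::]
  end.
Fixpoint bget (a : bitseq) (i : nat) : bool :=
  match a, i with x :: _, 0 => x | _ :: a', i'.+1 => bget a' i' | [::], _ => false end.
Fixpoint bcount (a : bitseq) : nat :=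
  if a is x :: a' then if x then (bcount a').+1 else bcount a' else 0.
Fixpoint beq (a b : bitseq) : bool :=
  match a, b with
  | x :: a', y :: b' => if x then if y then beq a' b' else false
                        else if y then false else beq a' b'
  | [::], [::] => true
  | _, _ => false
  end.
Fixpoint bmem (x : bitseq) (s : seq bitseq) : bool :=
  if s is y :: s' then if beq x y then true else bmem x s' else false.
Fixpoint bundup (s acc : seq bitseq) : seq bitseq :=
  if s is x :: s' then if bmem x acc then bundup s' acc else bundup s' (x :: acc) else acc.

(* The entry at (x, y) marks the z in W with x + y - z in W: a face of the hull of W containing x
   and y contains these z.  Rows are left empty at unit distance, where nothing is implied. *)
Definition relrow (w : vec) (N : Z) (W : seq vec) (x : vec) : seq bitseq :=
  let c := hmul w x in
  [seq if ((2 * zdot c y =? N) || (zdot c y =? N))%Z then [::] else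
       let s := vadd x y in [seq vmem (vadd s (vscale (-1) z)) W | z <- W] | y <- W].
Definition reltab w N W := [seq relrow w N W x | x <- W].

Fixpoint relor (row : seq bitseq) (S acc : bitseq) : bitseq :=
  match row, S with
  | R :: row', b :: S' => relor row' S' (if b then if R is [::] then acc else bor R acc else acc)
  | _, _ => acc
  end.

(* Stopping early would only weaken the closure. *)
Definition close_fuel : nat := 1000.

Section Search.
Variable tab : seq (seq bitseq).

Fixpoint bnew (U S : bitseq) (j : nat) (acc : seq nat) : seq nat :=
  match U, S with
  | u :: U', s :: S' => bnew U' S' j.+1 (if u then if s then acc else j :: acc else acc)
  | _, _ => acc
  end.

(* [None] when an index excluded by [X] is implied. *)
Fixpoint close (fuel : nat) (todo : seq nat) (S X : bitseq) : option bitseq :=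
  if todo is i :: todo' then
    if fuel is f.+1 then
      if bget S i then close f todo' S X
      else if bget X i then None
      else
        let S1 := bset i S in
        let U := relor (nth [::] tab i) S [seq false | _ <- S] in
        if bmeet U X then None else close f (bnew U S1 0 todo') S1 X
    else Some S
  else Some S.

Variables (kills : seq bitseq) (full : bitseq).

(** An unknown closed set T contains [S] and avoids [X]; the search shows that T lies in a member of
    [Ts] or cannot exist. Let t be the first candidate containing [S]. If T is not inside t, it has
    a first index j outside t: each such j is added to [S] and closed up, and then joins [X], since
    the later branches may assume that T avoids it. No admissible T contains [full] or a member of
    [kills]. *)
Fixpoint search (fuel : nat) (Ts : seq bitseq) (S X : bitseq) : bool :=
  if has (fun k => bsub k S) kills then true
  else if bsub full S then true
  else
    let Ts' := [seq t <- Ts | bsub S t] in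
    match fuel, Ts' with
    | f.+1, t :: _ =>
      (fix loop (V X0 : bitseq) (j : nat) (X : bitseq) :=
         match V, X0 with
         | b :: V', x :: X0' =>
           if b then loop V' X0' j.+1 X
           else if x then loop V' X0' j.+1 X
           else if (if close close_fuel [:: j] S X is Some S' then search f Ts' S' X else true)
                then loop V' X0' j.+1 (bset j X) else false
         | _, _ => true
         end) t X 0 X
    | _, _ => false
    end.
End Search.

(** Large candidates come first because the search branches over the indices outside a candidate. *)
Definition bsort (ts : seq bitseq) : seq bitseq :=
  sort (fun a b => bcount b <= bcount a) ts.

Section Check.
Variables (n : nat) (w : vec) (N : Z) (V : seq vec).

Definition in_key (k : key) : vec -> bool :=
  let c := hmul w (kr k) in let d := hmul w (ks k) in let K := kK k in
  fun z => if (zdot c z =? K)%Z then (zdot d z <=? 0)%Z else false.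
Definition verts (k : key) : seq vec := let p := in_key k in [seq z <- V | p z].

Definition supports (k : key) (W G : seq vec) : bool :=
  let c := hmul w (kr k) in
  let vs := [seq (z, (zdot c z - kK k)%Z) | z <- W] in
  (all (fun p => (p.2 <=? 0)%Z) vs || all (fun p => (0 <=? p.2)%Z) vs) &&
  lseq [seq p.1 | p <- vs & (p.2 =? 0)%Z] G.

(** The hyperplane of each facet cuts the common ridge out of the other. The rank n - 1 is linear,
    so the ridge has dimension n - 2. *)
Definition adj (k k' : key) (W W' : seq vec) : bool :=
  let p := in_key k' in
  let G := [seq z <- W | p z] in
  [&& supports k' W G, supports k W' G & zrank n G == n.-1].

Fixpoint path_ok (L : seq key) (k : key) (ks : seq key) : bool :=
  kmem k L && if ks is k' :: ks' then adj k k' (verts k) (verts k') && path_ok L k' ks' else true.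

(* Points are paired with their coordinates in the plane of the functionals u, v. *)
Definition pt2 := (vec * (Z * Z))%type.
Definition cr (p q : pt2) : Z := (p.2.1 * q.2.2 - p.2.2 * q.2.1)%Z.
Definition is0 (p : pt2) : bool := if (p.2.1 =? 0)%Z then (p.2.2 =? 0)%Z else false.
Definition proj2d (cu cv : vec) (W : seq vec) : seq pt2 :=
  [seq (z, (zdot cu z, zdot cv z)) | z <- W].

Definition sec := (seq pt2 * pt2)%type.

Definition first_ray (Q : seq pt2) : pt2 :=
  let Q' := [seq p <- Q | ~~ is0 p] in
  if Q' is q :: Q'' then foldl (fun s t => if (cr s t <? 0)%Z then t else s) q Q''
  else ([::], (0, 0)%Z).

(* The sectors, with their first rays, in cyclic order after the sector [s]: the next sector is the
   one whose first ray is a last ray of the current one. *)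
Fixpoint chain (fuel : nat) (s : sec) (rest : seq sec) : seq sec :=
  if fuel is f.+1 then
    let nxt := [seq t <- rest | all (fun p => (0 <=? cr p t.2)%Z) s.1 && (0 <? cr s.2 t.2)%Z
                 && has (fun p => lseq [:: p.1] [:: t.2.1]) s.1] in
    if nxt is t :: _ then s :: chain f t rest else [:: s]
  else [::].

(** The sector [s] runs from its own first ray to that of its successor [t], over an angle below pi.
    The points over the origin of the plane are exactly the peak [G], and the points over the ray of
    [t] are the same for [s] and [t]: they form the common ridge. *)
Definition sector_ok (G : seq vec) (s t : sec) : bool :=
  [&& (0 <? cr s.2 t.2)%Z,
      all (fun p => (0 <=? cr s.2 p)%Z && (0 <=? cr p t.2)%Z) s.1,
      lseq [seq p.1 | p <- s.1 & is0 p] G,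
      vmem s.2.1 [seq p.1 | p <- s.1] &
      lseq [seq p.1 | p <- s.1 & (cr p t.2 =? 0)%Z] [seq p.1 | p <- t.1 & (cr t.2 p =? 0)%Z]].

(** Once a ray has passed the opposite of the ray of [s0], its successors must stay in that half
    plane until the cycle closes. With steps below pi this excludes a second turn. *)
Fixpoint cyc_ok (G : seq vec) (s0 s : sec) (l : seq sec) : bool :=
  if l is t :: l' then
    [&& sector_ok G s t, ((cr s0.2 s.2 <? 0) ==> (cr s0.2 t.2 <? 0))%Z & cyc_ok G s0 t l']
  else sector_ok G s s0.

Fixpoint all_diff (l : seq (seq vec)) : bool :=
  if l is x :: l' then ~~ has (lseq x) l' && all_diff l' else true.

(** Each [comb] vanishes on the common points of two facet hyperplanes, hence on the peak. Two of
    them serve as coordinates of the plane of projection; their independence follows from the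
    positive determinants in [sector_ok]. *)
Definition peak_ok (fs : seq (key * seq vec)) (G : seq vec) : bool :=
  if fs is f0 :: f1 :: f2 :: _ then
    let comb f := vadd (vscale (kK f.1) (kr f0.1)) (vscale (- kK f0.1) (kr f.1)) in
    let cu := hmul w (comb f1) in
    let cv := hmul w (comb f2) in
    let ss := [seq let Q := proj2d cu cv f.2 in (Q, first_ray Q) | f <- fs] in
    if ss is s0 :: _ then
      let l := chain (size fs) s0 ss in
      [&& size l == size fs,
          (if l is s :: l' then cyc_ok G s s l' else false),
          all_diff [seq [seq p.1 | p <- s.1] | s <- l] &
          all_diff [seq [seq p.1 | p <- s.1 & (cr s.2 p =? 0)%Z] | s <- l]]
    else false
  else false.

(** Two distinct points at non-unit distance must have a relation with a third point. A face
    containing only these two is then impossible, so every edge is a unit edge. *)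
Fixpoint pairs_ok (tab : seq (seq bitseq)) (i : nat) (W : seq vec) (W0 : seq vec) : bool :=
  if W is x :: W' then
    (let c := hmul w x in
     let row := nth [::] tab i in
     (fix loop (j : nat) (ys : seq vec) (row : seq bitseq) : bool :=
       match ys, row with
       | y :: ys', r :: row' =>
         (if (2 * zdot c y =? N)%Z then true
          else if (zdot c y =? N)%Z then true
          else has (fun k => ~~ ((k == i) || (k == j)) && bget r k) (iota 0 (size r)))
         && loop j.+1 ys' row'
       | [::], _ => true
       | _, _ => false
       end) 0 W0 row) && pairs_ok tab i.+1 W' W0
  else true.

(** A facet meeting [W] in fewer than n - 2 points contains no peak of it, hence the count in [NB].
    Candidates for peaks are intersections of two ridges; the search below a ridge excludes the
    complement of that ridge from the start. Ridge neighbours come first in [NBs], so that [peak_ok]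
    builds its two functionals from them. *)
Definition rep_ok (L : seq key) (k : key) : bool :=
  let W := verts k in
  let M := [seq (k', [seq in_key k' z | z <- W]) | k' <- L] in
  let one := nseq (size W) true in
  let zero := nseq (size W) false in
  let NB := [seq (p, verts p.1) | p <- M & (n - 2 <= bcount p.2) && ~~ bsub one p.2] in
  let NBa := [seq (p, (n.-1 <= bcount p.1.2) && adj k p.1.1 W p.2) | p <- NB] in
  let RD := [seq p.1 | p <- NBa & p.2] in
  let NBs := RD ++ [seq p.1 | p <- NBa & ~~ p.2] in
  let ridges := bsort [seq p.1.2 | p <- RD] in
  let tab := reltab w N W in
  let peaks_of m :=
    bsort (bundup [seq t <- [seq band m m' | m' <- ridges] | (n - 2 <= bcount t) && ~~ bsub m t] [::]) in
  let pk := [seq (m, peaks_of m) | m <- ridges] in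
  [&& zrank n W == n, (0 <? kK k)%Z,
      all (fun p => bsub one p.2 ==> keq p.1 k) M,
      all (fun p => size [seq q <- NB | bsub p.1.2 q.1.2] == 1) RD,
      pairs_ok tab 0 W W,
      search tab [::] one (size W).+1 ridges zero zero,
      all (fun p => search tab [::] p.1 (size W).+1 p.2 zero (bnot p.1)) pk &
      all (fun g => (zrank n (mask g W) == n - 2) ==>
             peak_ok ((k, W) :: [seq (q.1.1, q.2) | q <- NBs & bsub g q.1.2]) (mask g W))
        (bundup (flatten [seq p.2 | p <- pk]) [::])].

End Check.

(* [Kill a m b] certifies that the points of index in [a] (in the vertex figure) lie on no common
   unit-edge facet: m times their sum is a combination [b] of points of V with positive coefficients
   of sum at most m |a|, so that the points in [b] would violate a supporting inequality or, in case
   of equality, be on the facet too. *)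
Record kill := Kill { ka : seq nat; km : Z; kb : seq (Z * nat) }.

(* [c_reps]: representative facets, a fold together with the normal of its half space and points of
   V spanning, with the circumcenter, the boundary of that half; [c_paths]: paths of adjacent facets
   to the first representative, from all representatives and from its images under the generators;
   [c_vreps]: representative vertices. *)
Record cfg := Cfg {
  c_n : nat; c_w : vec; c_N : Z; c_V : seq vec; c_gs : seq gen;
  c_reps : seq (key * option (vec * seq vec));
  c_paths : seq (seq key);
  c_vreps : seq (vec * seq kill) }.

Section VertexFigure.
Variables (n : nat) (w : vec) (N : Z) (V : seq vec).

Definition unitb (c y : vec) : bool := (2 * zdot c y =? N)%Z.

(** The functional x + y takes its maximum N + <x, y> on V at x and y alone, so these span an edge
    of conv V. Its length is not 1, so no unit-edge facet contains both points. *)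
Definition exposed (x y : vec) : bool :=
  let c := hmul w x in
  let m := (N + zdot c y)%Z in
  let h := hmul w (vadd x y) in
  if unitb c y then false else if (zdot c y =? N)%Z then false else
  all (fun z => if (zdot h z <? m)%Z then true else if veq z x then true else veq z y) V.

Fixpoint epairs (W : seq vec) : seq bitseq :=
  if W is x :: W' then
    [seq true :: r | r <- (fix loop (ys : seq vec) : seq bitseq :=
        if ys is y :: ys' then
          let rs := [seq false :: r | r <- loop ys'] in
          if exposed x y then (true :: [seq false | _ <- ys']) :: rs else rs
        else [::]) W'] ++ [seq false :: r | r <- epairs W']
  else [::].

Definition vsum (s : seq vec) : vec := foldr vadd [::] s.

Definition kill_ok (W : seq vec) (k : kill) : bool :=
  let A := [seq nth [::] W i | i <- ka k] in
  let B := [seq (p.1, nth [::] V p.2) | p <- kb k] in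
  let t := foldr Z.add 0%Z [seq p.1 | p <- B] in
  let u := (km k * Z.of_nat (size A))%Z in
  [&& all (fun i => i < size W) (ka k), all (fun p => p.2 < size V) (kb k),
      (0 <? km k)%Z, all (fun p => 0 <? p.1)%Z B,
      veq (vscale (km k) (vsum A)) (vsum [seq vscale p.1 p.2 | p <- B]) &
      if (t <? u)%Z then true else
      (t =? u)%Z && has (fun p => has (fun q => exposed p.2 q.2) B) B].

Definition kmask (W : seq vec) (k : kill) : bitseq :=
  foldr bset [seq false | _ <- W] (ka k).

(** The search starts from v alone, which has index 0. The rank test with an added coordinate 1 says
    that v and its unit neighbours lie on no common hyperplane, which makes [one] an impossible
    set. *)
Definition vf_ok (L : seq key) (p : vec * seq kill) : bool :=
  let v := p.1 in
  let c := hmul w v in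
  let W := v :: [seq z <- V | unitb c z] in
  let one := [seq true | _ <- W] in
  let zero := [seq false | _ <- W] in
  let M := [seq [seq in_key w k z | z <- W] | k <- L] in
  let Ts := bsort [seq m <- M | n <= bcount m] in
  let kills := epairs W ++ [seq kmask W k | k <- p.2] in
  [&& vmem v V, has (fun k => in_key w k v) L,
      zrank n.+1 [seq 1%Z :: z | z <- W] == n.+1,
      all (kill_ok W) p.2 &
      search (reltab w N W) kills one (size W).+1 Ts (bset 0 zero) zero].

(** Two reasons why v and y span no edge: v + y = z + z' with z different from both, or 2 (v + y) is
    a sum of three points of V. In the second case a functional with positive maximum b attained at
    v and y would take the value 4 b on a sum where it is at most 3 b. *)
Definition convex_at (v : vec) : bool :=
  let c := hmul w v in
  all (fun y =>
    if unitb c y then true else if (zdot c y =? N)%Z then true else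
    let s := vadd v y in
    if has (fun z => if veq z v then false else if veq z y then false else
                     vmem (vadd s (vscale (-1) z)) V) V then true else
    let s2 := vscale 2 s in
    has (fun z1 => let s1 := vadd s2 (vscale (-1) z1) in
      has (fun z2 => vmem (vadd s1 (vscale (-1) z2)) V) V) V) V.

Definition ext_ok (k : key) : bool :=
  let c := hmul w (kr k) in
  (if ks k is [::] then true else false) && all (fun z => zdot c z <=? kK k)%Z V.

(** The normal [sh.1] is orthogonal to [kr k], so the boundary flat passes through the circumcenter,
    a multiple of [kr k]. It may differ from [ks k] as long as both cut the section alike: [ks k]
    must be fixed by the symmetries that fix the facet, because [rep_ok] allows one key per facet,
    whereas [sh.1] must vanish on the chosen spanning points. *)
Definition fold_ok (k : key) (sh : vec * seq vec) : bool :=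
  let c := hmul w (kr k) in
  let d := hmul w sh.1 in
  let h := hmul w (ks k) in
  let WH := [seq z <- V | (zdot c z =? kK k)%Z] in
  [&& has (fun z => zdot c z <? kK k)%Z V, has (fun z => kK k <? zdot c z)%Z V,
      has (fun a => ~~ (a =? 0)%Z) d, size sh.1 == n, (zdot d (kr k) =? 0)%Z,
      all (fun z => if (zdot d z <=? 0)%Z then (zdot h z <=? 0)%Z else ~~ (zdot h z <=? 0)%Z) WH &
      [&& size sh.2 == n - 2, all (fun p => vmem p WH) sh.2,
         all (fun p => zdot d p =? 0)%Z sh.2 & zrank n (kr k :: sh.2) == n.-1]].
End VertexFigure.

(** For the matrix M with denominator D the condition reads M diag(w) M^T = D^2 diag(w): M / D is an
    isometry of the weighted form. *)
Definition gen_ok (n : nat) (w : vec) (g : gen) : bool :=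
  [&& (0 <? g.1)%Z, size g.2 == n, all (fun r => size r == n) g.2 &
   all (fun i => all (fun j =>
     zdot (hmul w (nth [::] g.2 i)) (nth [::] g.2 j) =?
       (if i == j then g.1 * g.1 * nth 0 w i else 0))%Z (iota 0 n)) (iota 0 n)].

Definition cfg_ok (convex : bool) (C : cfg) : bool :=
  let: Cfg n w N V gs reps paths vreps := C in
  let rk := [seq p.1 | p <- reps] in
  let L := orbit_list kmem kact gs 100 rk rk in
  let vr := [seq p.1 | p <- vreps] in
  let O := orbit_list vmem gact gs 100 vr vr in
  let k0 := head (Key [::] 0%Z [::]) rk in
  [&& [&& size w == n, all (fun a => 0 <? a)%Z w, (0 <? N)%Z,
          all (fun z => (size z == n) && (zdot (hmul w z) z =? N)%Z) V,
          vuniq V & veq (vsum V) [seq 0%Z | _ <- w]],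
      [&& all (gen_ok n w) gs,
          all (fun g => all (fun z => gexact g z && vmem (gact g z) V) V) gs,
          all (fun g => all (fun k => kexact g k && kmem (kact g k) L) L) gs &
          all (fun z => vmem z O) V],
      (0 < size rk) && (size paths == size rk + size gs) &&
      all (fun p => if p.2 is k :: s then [&& keq k p.1, path_ok n w V L k s & keq (last k s) k0] else false)
        (zip (rk ++ [seq kact g k0 | g <- gs]) paths),
      all (fun p => if p.2 is Some sh then fold_ok n w V p.1 sh else ext_ok w V p.1) reps,
      all (fun p => rep_ok n w N V L p.1) reps,
      all (vf_ok n w N V L) vreps &
      if convex then all (convex_at w N V) vr && all (fun p => if p.2 is Some _ then false else true) reps
      else has (fun p => if p.2 is Some _ then true else false) reps].

(** * Soundness of the search *)

Section Bits.
Implicit Types (a b S X : bitseq) (T : pred nat).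

Definition inb a T := forall i, nth false a i -> T i.
Definition outb a T := forall i, nth false a i -> ~~ T i.

Lemma bgetE a i : bget a i = nth false a i.
Proof. by elim: a i => [|x a IH] [|i] /=. Qed.

Lemma bsubP a b : size a = size b -> reflect (inb a (nth false b)) (bsub a b).
Proof.
elim: a b => [|x a IH] [|y b] //= => [_|[/IH{}IH]].
  by constructor=> i; rewrite nth_nil.
apply: (iffP idP) => [H [|i] //= xi|H].
- by move: H; rewrite xi; case: y.
- by apply: (IH _) xi; move: H; case: (x); case: (y).
have Hab : bsub a b by apply/IH => i ai; exact: (H i.+1).
by have := H 0; case: x {H} => //= ->.
Qed.

Lemma bmeetP a b T : bmeet a b -> inb a T -> outb b T -> False.
Proof.
elim: a b T => [|x a IH] [|y b] T //= H Ha Hb.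
have {}IH := IH b (fun i => T i.+1) _ (fun i => Ha i.+1) (fun i => Hb i.+1).
have := Ha 0; have := Hb 0; rewrite /=.
case: x H Ha => [|H _ _ _]; last exact: IH.
case: y {Hb} => [_ _ /(_ isT) T0 /(_ isT)|H _ _ _]; first by rewrite (negPf T0).
exact: IH.
Qed.

Lemma size_bset i a : size (bset i a) = size a.
Proof. by elim: a i => [|x a IH] [|i] //=; rewrite IH. Qed.

Lemma nth_bset i a k : nth false (bset i a) k -> k = i \/ nth false a k.
Proof.
elim: a i k => [|x a IH] [|i] [|k] //=; rewrite ?nth_nil; auto.
by move/IH => [->|]; auto.
Qed.

Lemma bset_in i a T : inb a T -> T i -> inb (bset i a) T.
Proof. by move=> Ha Ti k /nth_bset[->|/Ha]. Qed.

Lemma nth_bor a b i : nth false (bor a b) i -> nth false a i \/ nth false b i.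
Proof.
elim: a b i => [|x a IH] [|y b] [|i] //=; try by left.
  by case: x; [left | right].
exact: IH.
Qed.

Lemma nth_band a b i : size a = size b -> nth false (band a b) i = nth false a i && nth false b i.
Proof.
elim: a b i => [|x a IH] [|y b] i //=; first by rewrite nth_nil.
by case=> sab; case: i => [|i] /=; [case: x | apply: IH].
Qed.

Lemma size_band a b : size (band a b) = size a.
Proof. by elim: a b => [|x a IH] [|y b] //=; rewrite IH. Qed.

Lemma nth_bnot a i : nth false (bnot a) i = (i < size a) && ~~ nth false a i.
Proof. by elim: a i => [|x a IH] [|i] //=; rewrite IH. Qed.

Lemma beqP a b : reflect (a = b) (beq a b).
Proof.
elim: a b => [|[] a IH] [|[] b] /=; try by constructor.
  by apply: (iffP (IH b)) => [->|[]].
by apply: (iffP (IH b)) => [->|[]].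
Qed.

Lemma bmemE a (s : seq bitseq) : bmem a s = (a \in s).
Proof.
elim: s => //= y s IH; rewrite inE.
by case: beqP => [->|/eqP/negPf ->]; rewrite ?eqxx.
Qed.

Lemma mem_bundup a (s acc : seq bitseq) : (a \in bundup s acc) = (a \in s) || (a \in acc).
Proof.
elim: s acc => //= x s IH acc; rewrite bmemE inE; case: ifP => xacc; rewrite IH.
  by case: eqVneq => //= ->; rewrite xacc orbT.
by rewrite inE orbA [_ || (a == x)]orbC.
Qed.

Lemma mem_bsort a (s : seq bitseq) : (a \in bsort s) = (a \in s).
Proof. by rewrite mem_sort. Qed.

End Bits.

Section SearchSound.
Variables (tab : seq (seq bitseq)) (T : pred nat) (m : nat).
Hypothesis tabT : forall i j k, T i -> T j ->
  nth false (nth [::] (nth [::] tab i) j) k -> T k.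

Lemma relorP row S acc (Q : pred nat) :
  (forall j k, nth false S j -> nth false (nth [::] row j) k -> Q k) ->
  inb acc Q -> inb (relor row S acc) Q.
Proof.
elim: row S acc => [|R row IH] [|b S] acc //= H Hacc.
apply: IH => [j k|]; first exact: (H j.+1).
case: b H => // H; case: R H => // x R H k /nth_bor[|/Hacc//].
exact: (H 0 k isT).
Qed.

Lemma bnewP U S j acc (Q : pred nat) : (forall i, nth false U i -> Q (j + i)) ->
  {in acc, forall i, Q i} -> {in bnew U S j acc, forall i, Q i}.
Proof.
elim: U S j acc => [|u U IH] [|s S] j acc //= HU Hacc.
apply: IH => [i Ui|i]; first by rewrite addSnnS; exact: (HU i.+1).
have := HU 0; rewrite /= addn0 => Hj.
case: u {HU} Hj => [/(_ isT) Hj|_]; last exact: Hacc.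
by case: s; [exact: Hacc | rewrite inE => /predU1P[->|/Hacc]].
Qed.

Lemma closeP fuel todo S X : inb S T -> outb X T -> {in todo, forall i, T i} ->
  if close tab fuel todo S X is Some S' then inb S' T /\ size S' = size S else False.
Proof.
elim: fuel todo S => [|f IH] [|i todo] S //= HS HX Ht.
have Ti : T i by apply: Ht; rewrite mem_head.
have Ht' : {in todo, forall i, T i} by move=> k kt; apply: Ht; rewrite inE kt orbT.
rewrite !bgetE; case: ifP => _; first exact: IH.
case: ifP => [/HX|Xi]; first by rewrite Ti.
set U := relor _ _ _.
have HU : inb U T.
  apply: relorP => [j k /HS Tj|k]; first exact: tabT.
  by have [kS|Sk] := ltnP k (size S); [rewrite (nth_map false)|rewrite nth_default ?size_map].
case: ifP => [UX|_]; first exact: (bmeetP UX HU HX).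
have := IH (bnew U (bset i S) 0 todo) (bset i S) (bset_in HS Ti) HX.
case: close => [S'|]; last by apply; apply: bnewP.
by rewrite size_bset; apply; apply: bnewP.
Qed.

Local Opaque close_fuel.
Variables (kills : seq bitseq) (full : bitseq).
Hypothesis killT : {in kills, forall k, size k = m /\ ~ inb k T}.
Hypothesis fullT : size full = m /\ ~ inb full T.
Hypothesis Tm : forall i, T i -> i < m.

Lemma searchP fuel Ts S X : search tab kills full fuel Ts S X ->
  {in Ts, forall t, size t = m} -> size S = m -> size X = m -> inb S T -> outb X T ->
  exists2 t, t \in Ts & forall i, T i -> nth false t i.
Proof.
elim: fuel Ts S X => [|f IH] Ts S X sr Hts sS sX HS HX.
  move: sr => /=; case: hasP => [[k kk /bsubP ks] _|_].
    have [sk nk] := killT kk; case: nk => i ki; apply: HS.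
    by apply: ks; rewrite // sk.
  case: ifP => // /bsubP fs _; have [sf nf] := fullT.
  by case: nf => i fi; apply: HS; apply: fs; rewrite ?sf.
move: sr => /=; case: hasP => [[k kk /bsubP ks] _|_].
  have [sk nk] := killT kk; case: nk => i ki; apply: HS.
  by apply: ks; rewrite // sk.
case: ifP => [/bsubP fs _|_].
  have [sf nf] := fullT.
  by case: nf => i fi; apply: HS; apply: fs; rewrite ?sf.
set Ts' := [seq t <- Ts | bsub S t].
case E : Ts' => [//|t Tr]; rewrite -E.
have tTs : t \in Ts by have := mem_head t Tr; rewrite -E mem_filter => /andP[].
have st : size t = m by exact: Hts.
have Hts' : {in Ts', forall t, size t = m} by move=> u; rewrite mem_filter => /andP[_ /Hts].
have sub : {subset Ts' <= Ts} by move=> u; rewrite mem_filter => /andP[].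
set loop := (fix loop (V X0 : bitseq) (j : nat) (X : bitseq) : bool := _).
(* Invariant of the loop at position j: the elements of T below j lie in t, [V] and [X0] are tails
   of t and of the original [X], and [X1] gathers all indices excluded so far. *)
suff H V X0 j X1 : loop V X0 j X1 -> size V + j = m -> size X0 + j = m -> size X1 = m ->
    outb X1 T -> (forall i, nth false X0 i -> ~~ T (j + i)) ->
    (forall i, nth false V i = nth false t (j + i)) ->
    (forall i, i < j -> T i -> nth false t i) ->
    exists2 t0, t0 \in Ts & forall i, T i -> nth false t0 i.
  by move=> Hl; apply: (H t X 0 X Hl) => //; rewrite ?addn0.
elim: V X0 j X1 => [|b V IHV] X0 j X1 /=.
  move=> _ sj _ _ _ _ _ Ht; exists t => // i Ti; apply: Ht => //.
  by rewrite -(add0n j) sj; exact: Tm.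
case: X0 => [|x X0] Hl sV sX0 sX1 HX1 HX0 HV Ht.
  by move: sX0 sV => /= <-; rewrite addSn => /eqP; rewrite gtn_eqF // ltnS leq_addl.
have b0 : b = nth false t j by have := HV 0; rewrite /= addn0.
have next X2 : loop V X0 j.+1 X2 -> size X2 = m -> outb X2 T ->
    (T j -> b) -> exists2 t0, t0 \in Ts & forall i, T i -> nth false t0 i.
  move=> Hl2 sX2 HX2 Tb; apply: (IHV X0 j.+1 X2) => //.
  - by rewrite -sV addSnnS.
  - by rewrite -sX0 addSnnS.
  - by move=> i Xi; rewrite addSnnS; exact: (HX0 i.+1).
  - by move=> i; rewrite addSnnS -(HV i.+1).
  - by move=> i; rewrite ltnS leq_eqVlt => /predU1P[->|/Ht//]; rewrite -b0.
case: b b0 Hl sV HV next => b0 Hl sV HV next; first exact: (next X1).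
case: x HX0 sX0 Hl IHV next => HX0 sX0 Hl IHV next.
  by apply: (next X1) => // Tj; have := HX0 0 isT; rewrite addn0 Tj.
move: Hl; case: ifP => // Hs Hl.
have [Tj|Tj] := boolP (T j); last first.
  apply: (next (bset j X1)) => //; [by rewrite size_bset| |by rewrite (negPf Tj)].
  by move=> i /nth_bset[->|/HX1].
have := @closeP close_fuel [:: j] S X1 HS HX1; move: Hs.
case: close => [S'|_]; last by case=> // i; rewrite inE => /eqP ->.
move=> sr [] => [i|HS' sS']; first by rewrite inE => /eqP ->.
have [t0 t0T Ht0] := IH _ _ _ sr Hts' (etrans sS' sS) sX1 HS' HX1.
by exists t0 => //; apply: sub.
Qed.

End SearchSound.

Local Open Scope classical_set_scope.
Local Open Scope ring_scope.

(** * Hulls, ranks and faces *)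

Section Dot.
Context {R : realType} {n : nat}.
Implicit Types (u v w x y z : 'rV[R]_n) (s t : seq 'rV[R]_n).

Lemma dotE u v : dot u v = \sum_i u 0 i * v 0 i.
Proof. by rewrite /dot mxE; apply: eq_bigr => i _; rewrite mxE. Qed.

Lemma dotC u v : dot u v = dot v u.
Proof. by rewrite !dotE; apply: eq_bigr => i _; rewrite mulrC. Qed.

Lemma dotDr u v w : dot u (v + w) = dot u v + dot u w.
Proof. by rewrite /dot linearD mulmxDr mxE. Qed.

Lemma dotZr a u v : dot u (a *: v) = a * dot u v.
Proof. by rewrite /dot linearZ /= -scalemxAr mxE. Qed.

Lemma dotDl u v w : dot (u + v) w = dot u w + dot v w.
Proof. by rewrite !(dotC _ w) dotDr. Qed.

Lemma dotZl a u v : dot (a *: u) v = a * dot u v.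
Proof. by rewrite !(dotC _ v) dotZr. Qed.

Lemma dotNr u v : dot u (- v) = - dot u v.
Proof. by rewrite -scaleN1r dotZr mulN1r. Qed.

Lemma dotNl u v : dot (- u) v = - dot u v.
Proof. by rewrite !(dotC _ v) dotNr. Qed.

Lemma dotBr u v w : dot u (v - w) = dot u v - dot u w.
Proof. by rewrite dotDr dotNr. Qed.

Lemma dotBl u v w : dot (u - v) w = dot u w - dot v w.
Proof. by rewrite dotDl dotNl. Qed.

Lemma dot0r u : dot u 0 = 0.
Proof. by rewrite -(scale0r 0) dotZr mul0r. Qed.

Lemma dot0l u : dot 0 u = 0.
Proof. by rewrite dotC dot0r. Qed.

Lemma dot_sumr (I : Type) (r : seq I) (P : pred I) (F : I -> 'rV[R]_n) u :
  dot u (\sum_(i <- r | P i) F i) = \sum_(i <- r | P i) dot u (F i).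
Proof.
apply: (big_morph (dot u)) => [v w|]; [exact: dotDr | exact: dot0r].
Qed.

Lemma dot_ge0 u : 0 <= dot u u.
Proof. by rewrite dotE sumr_ge0 // => i _; rewrite -expr2 sqr_ge0. Qed.

Lemma dot_eq0 u : (dot u u == 0) = (u == 0).
Proof.
apply/eqP/eqP => [|->]; last exact: dot0r.
rewrite dotE => /eqP; rewrite psumr_eq0 => [/allP u0|i _]; last by rewrite -expr2 sqr_ge0.
apply/rowP => i; rewrite mxE; apply/eqP.
by have := u0 i (mem_index_enum i); rewrite /= mulf_eq0 orbb.
Qed.

Lemma dot_gt0 u : u != 0 -> 0 < dot u u.
Proof. by move=> u0; rewrite lt0r dot_eq0 u0 dot_ge0. Qed.

Lemma dot_unit_lt1 u v : dot u u = 1 -> dot v v = 1 -> u != v -> dot u v < 1.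
Proof.
move=> uu vv uv; have : 0 < dot (u - v) (u - v) by rewrite dot_gt0 // subr_eq0.
rewrite dotBl !dotBr uu vv (dotC v u); lra.
Qed.

End Dot.

Section Hull.
Context {R : realType} {n : nat}.
Implicit Types (u v w x y z c : 'rV[R]_n) (s t : seq 'rV[R]_n) (M : set 'rV[R]_n).

Definition cv s : set 'rV[R]_n := hull [set` s].

Lemma convex_setP M : @convex_set R 'rV[R]_n M <->
  (forall x y (a : R), 0 <= a <= 1 -> M x -> M y -> M (a *: x + (1 - a) *: y)).
Proof.
split=> [cM x y a a01 Mx My|cM x y l xM yM].
  have [a0 a1] := andP a01.
  have := cM x y (Itv01 a0 a1) (mem_set Mx) (mem_set My).
  by move/set_mem.
apply/mem_set; have := cM x y l%:num _ (set_mem xM) (set_mem yM).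
by apply; apply/andP; split.
Qed.

(** Weights that need not sum to 1 let the induction pass to the tail, whose total weight may even
    be 0. *)
Lemma convex_comb M s (a : 'rV[R]_n -> R) :
  @convex_set R 'rV[R]_n M -> {in s, forall z, M z} -> {in s, forall z, 0 <= a z} ->
  0 < \sum_(z <- s) a z -> M ((\sum_(z <- s) a z)^-1 *: \sum_(z <- s) a z *: z).
Proof.
move=> cM; elim: s => [|z s IH] Ms a0; first by rewrite big_nil ltxx.
rewrite !big_cons; set A := \sum_(z <- s) a z; set B := \sum_(z <- s) _ *: _ => AA.
have az0 : 0 <= a z by apply: a0; rewrite mem_head.
have Mz : M z by apply: Ms; rewrite mem_head.
have A0 : 0 <= A by rewrite /A big_seq sumr_ge0 // => y ys; rewrite a0 // inE ys orbT.
have [A00|A00] := eqVneq A 0.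
  have B0 : B = 0.
    rewrite /B big_seq big1 // => y ys; move: A00; rewrite /A big_seq => /eqP.
    rewrite psumr_eq0 => [/allP /(_ y ys)|w ws]; last by rewrite a0 // inE ws orbT.
    by rewrite ys => /eqP ->; rewrite scale0r.
  by move: AA; rewrite A00 B0 !addr0 => az; rewrite scalerA mulVf ?scale1r // gt_eqF.
have Ap : 0 < A by rewrite lt0r A00.
have MB : M (A^-1 *: B).
  by apply: IH => // y ys; [apply: Ms | apply: a0]; rewrite inE ys orbT.
have l01 : 0 <= a z / (a z + A) <= 1.
  by rewrite divr_ge0 ?(ltW AA) //= ler_pdivrMr // mul1r lerDl.
have := (convex_setP M).1 cM z _ _ l01 Mz MB; congr (M _).
rewrite scalerDr !scalerA; congr (_ *: _ + _ *: _); first by rewrite mulrC.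
by field; rewrite A00 /= gt_eqF.
Qed.

Lemma cvP s x : cv s x <->
  exists a : 'rV[R]_n -> R, [/\ {in s, forall z, 0 <= a z}, \sum_(z <- s) a z = 1
    & x = \sum_(z <- s) a z *: z].
Proof.
split=> [|[a [a0 a1 ->]] M [cM sM]]; last first.
  have := convex_comb cM _ a0; rewrite a1 invr1 scale1r; apply => //.
apply: (smallest_sub (X := [set x | exists a : 'rV[R]_n -> R, _])) => /=.
  apply/convex_setP => {}x y t /andP[t0 t1] [a [a0 a1 ->]] [b [b0 b1 ->]].
  exists (fun z => t * a z + (1 - t) * b z); split.
  - by move=> z zs; rewrite addr_ge0 // mulr_ge0 ?a0 ?b0 // subr_ge0.
  - by rewrite big_split /= -!mulr_sumr a1 b1 !mulr1 addrC subrK.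
  - rewrite !scaler_sumr -big_split /=; apply: eq_bigr => z _.
    by rewrite [in RHS]scalerDl !scalerA.
(* [s] may repeat z, so the indicator weight is divided by the multiplicity. *)
move=> z /= zs; have cz : (0 < count_mem z s)%N by rewrite -has_count has_pred1.
have c0 : (count_mem z s)%:R != 0 :> R by rewrite pnatr_eq0 -lt0n.
have cE : \sum_(y <- s) ((y == z)%:R : R) = (count_mem z s)%:R.
  rewrite -sum1_count natr_sum [RHS]big_mkcond; apply: eq_bigr => y _.
  by rewrite /=; case: eqP.
exists (fun y => (y == z)%:R / (count_mem z s)%:R); split.
- by move=> y _; rewrite divr_ge0.
- by rewrite -mulr_suml cE divff.
- rewrite (eq_bigr (fun y => ((y == z)%:R / (count_mem z s)%:R) *: z)).
    by rewrite -scaler_suml -mulr_suml cE divff ?scale1r.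
  by move=> y _; have [->|] := eqVneq y z; rewrite // !mul0r !scale0r.
Qed.

Lemma mem_cv s x : x \in s -> cv s x.
Proof. by move=> xs; apply: sub_gen_smallest. Qed.

Lemma convex_cv s : @convex_set R 'rV[R]_n (cv s).
Proof.
apply/convex_setP => x y a a01 sx sy M [cM sM].
by apply: ((convex_setP M).1 cM) => //; [apply: sx | apply: sy].
Qed.

Lemma cv_sub s M : @convex_set R 'rV[R]_n M -> {in s, forall z, M z} -> cv s `<=` M.
Proof. by move=> cM sM; apply: smallest_sub. Qed.

Lemma eq_cv s t : s =i t -> cv s = cv t.
Proof.
by move=> st; congr hull; apply/seteqP; split=> x /=; rewrite st.
Qed.

Lemma convex_halfspace c b : @convex_set R 'rV[R]_n (halfspace c b).
Proof.
apply/convex_setP => x y a /andP[a0 a1] /= cx cy.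
rewrite /halfspace /= dotDr !dotZr.
have -> : b = a * b + (1 - a) * b by ring.
by apply: lerD; apply: ler_wpM2l => //; rewrite subr_ge0.
Qed.

Lemma cv_halfspace s c b : {in s, forall z, dot c z <= b} -> cv s `<=` halfspace c b.
Proof. by apply: cv_sub; apply: convex_halfspace. Qed.

Lemma cv_level s c b : {in s, forall z, dot c z = b} -> cv s `<=` level c b.
Proof.
move=> H x sx; apply/eqP; rewrite eq_le.
have -> : dot c x <= b by apply: (cv_halfspace (s := s)) sx => z zs; rewrite H.
have : dot (- c) x <= - b by apply: (cv_halfspace (s := s)) sx => z zs; rewrite dotNl H.
by rewrite dotNl lerN2.
Qed.

Definition tight c b s := [seq x <- s | dot c x == b].

(** On the supporting hyperplane the weighted sum of the nonnegative slacks b - <c, z> is 0, so only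
    tight points carry weight. Every face is thereby given by a sublist of the points. *)
Lemma cv_tight s c b : {in s, forall z, dot c z <= b} ->
  cv s `&` level c b = cv (tight c b s).
Proof.
move=> H; apply/seteqP; split=> [x [/cvP[a [a0 a1 xE]] cx]|x tx].
  have az z : z \in s -> dot c z != b -> a z = 0.
    move=> zs czb; have : \sum_(z <- s) a z * (b - dot c z) == 0.
      have cxE : \sum_(z <- s) a z * dot c z = b.
        by rewrite -cx xE dot_sumr; apply: eq_bigr => y _; rewrite dotZr.
      rewrite (eq_bigr (fun z => a z * b - a z * dot c z)); last by move=> ? _; rewrite mulrBr.
      by rewrite sumrB -mulr_suml a1 mul1r cxE subrr.
    rewrite big_seq psumr_eq0 => [/allP /(_ z zs)|y ys]; last first.
      by rewrite mulr_ge0 ?a0 // subr_ge0 H.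
    by rewrite zs /= mulf_eq0 subr_eq0 [b == _]eq_sym (negPf czb) orbF => /eqP.
  apply/cvP; exists a; split.
  - by move=> z; rewrite mem_filter => /andP[_ /a0].
  - rewrite big_filter big_mkcond -[RHS]a1; apply: eq_big_seq => z zs.
    by case: ifPn => // /az ->.
  - rewrite xE big_filter [RHS]big_mkcond; apply: eq_big_seq => z zs.
    by case: ifPn => // /az ->; rewrite ?scale0r.
split; last by apply: cv_level tx => z; rewrite mem_filter => /andP[/eqP].
have sub : [set` tight c b s] `<=` [set` s].
  by move=> z /=; rewrite mem_filter => /andP[].
move=> M [cM sM]; apply: tx; split => // z /sub; exact: sM.
Qed.

Lemma cv_halfspaceP s c b : cv s `<=` halfspace c b <-> {in s, forall z, dot c z <= b}.
Proof.
by split=> [H z zs|]; [apply: H; apply: mem_cv | apply: cv_halfspace].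
Qed.

Lemma face_cv s F : face (cv s) F <->
  exists c b, {in s, forall z, dot c z <= b} /\ F = cv (tight c b s).
Proof.
split=> -[c [b [H ->]]]; exists c, b.
  by move/cv_halfspaceP: H => H; split => //; rewrite cv_tight.
by split; [apply/cv_halfspaceP | rewrite cv_tight].
Qed.

Definition on_sphere s := {in s, forall z, dot z z = 1}.

(** For unit vectors <x, z> <= 1 with equality only at z = x, so x as a functional exposes x alone.
    This lets hulls be compared through their lists of points. *)
Lemma cv_sphere s x : on_sphere s -> dot x x = 1 -> cv s x -> x \in s.
Proof.
move=> sph xx sx.
have H : {in s, forall z, dot x z <= 1}.
  move=> z zs; have [->|xz] := eqVneq x z; first by rewrite sph.
  by rewrite ltW // dot_unit_lt1 // sph.
have : (cv s `&` level x 1) x by split.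
rewrite cv_tight // => /cvP[a [_ a1 _]].
have : tight x 1 s != [::].
  by apply/eqP => t0; move: a1; rewrite t0 big_nil => /esym/eqP; rewrite oner_eq0.
case tE : (tight x 1 s) => [//|z t] _.
have : z \in tight x 1 s by rewrite tE mem_head.
rewrite mem_filter => /andP[/eqP xz zs].
have [->//|nxz] := eqVneq x z.
by have := dot_unit_lt1 xx (sph z zs) nxz; rewrite xz ltxx.
Qed.

Lemma cv_sub_sphere s t : on_sphere s -> on_sphere t -> cv s `<=` cv t -> {subset s <= t}.
Proof.
by move=> ss st H z zs; apply: cv_sphere => //; [apply: ss | apply: H; apply: mem_cv].
Qed.

Lemma cv1 v : cv [:: v] = [set v].
Proof.
apply/seteqP; split=> [x /cvP[a [_]]|x ->]; last by apply: mem_cv; rewrite mem_head.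
by rewrite !big_seq1 => -> ->; rewrite scale1r.
Qed.

End Hull.

Section Span.
Context {R : realType} {n : nat}.
Implicit Types (u v w x y z c : 'rV[R]_n) (s t : seq 'rV[R]_n).

Definition spn s : 'M[R]_n := (\sum_(z <- s) genmx z)%MS.
Definition rk s := \rank (spn s).

Lemma spn_subP m s (A : 'M[R]_(m, n)) :
  reflect {in s, forall z, (z <= A)%MS} (spn s <= A)%MS.
Proof.
rewrite /spn; elim: s => [|z s IH]; first by rewrite big_nil sub0mx; constructor.
rewrite big_cons addsmx_sub genmxE; apply: (iffP andP) => [[zA /IH sA] y|H].
  by rewrite inE => /predU1P[->|/sA].
split; first by apply: H; rewrite mem_head.
by apply/IH => y ys; apply: H; rewrite inE ys orbT.
Qed.

Lemma mem_spn s z : z \in s -> (z <= spn s)%MS.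
Proof. by move: z; apply/spn_subP. Qed.

Lemma spnS s t : {subset s <= t} -> (spn s <= spn t)%MS.
Proof. by move=> st; apply/spn_subP => z /st /mem_spn. Qed.

Lemma rkS s t : {subset s <= t} -> (rk s <= rk t)%N.
Proof. by move=> st; apply/mxrankS/spnS. Qed.

Lemma eq_rk s t : s =i t -> rk s = rk t.
Proof. by move=> st; apply/eqP; rewrite eqn_leq !rkS // => x; rewrite st. Qed.

Lemma spn_comb s y : (y <= spn s)%MS ->
  exists a : nat -> R, y = \sum_(i < size s) a i *: s`_i.
Proof.
elim: s y => [|z s IH] y; rewrite /spn ?big_nil ?big_cons.
  by rewrite submx0 => /eqP ->; exists (fun=> 0); rewrite big_ord0.
move=> /sub_addsmxP[[u v] /= ->].
have /sub_rVP[k ->] : (u *m (genmx z) <= z)%MS by rewrite -(genmxE z) submxMl.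
have [a ->] := IH _ (submxMl v (spn s)).
exists (fun i => if i is j.+1 then a j else k).
by rewrite big_ord_recl /=; congr (_ + _); apply: eq_bigr.
Qed.

Lemma dot_spn0 s c y : {in s, forall z, dot c z = 0} -> (y <= spn s)%MS -> dot c y = 0.
Proof.
move=> H /spn_comb[a ->]; rewrite dot_sumr big1 // => i _.
by rewrite dotZr H ?mulr0 // mem_nth.
Qed.

Lemma rk_full_dot0 s c : rk s = n -> {in s, forall z, dot c z = 0} -> c = 0.
Proof.
move=> rs H; apply/eqP; rewrite -dot_eq0; apply/eqP.
by apply: (dot_spn0 H); rewrite submx_full //; apply/eqP.
Qed.

Lemma rk_lt_dot0 s : (rk s < n)%N -> exists2 c, c != 0 & {in s, forall z, dot c z = 0}.
Proof.
move=> rs; have : kermx (spn s)^T != 0.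
  by rewrite -mxrank_eq0 mxrank_ker mxrank_tr -lt0n subn_gt0.
case/rowV0Pn => c /sub_kermxP cs c0; exists c => // z /mem_spn /submxP[D ->].
by rewrite /dot trmx_mul mulmxA cs mul0mx mxE.
Qed.

Lemma rk_le_level s c : c != 0 -> {in s, forall z, dot c z = 0} -> (rk s < n)%N.
Proof.
move=> c0 H; rewrite ltn_neqAle rank_leq_col andbT; apply/negP => /eqP rs.
by rewrite (rk_full_dot0 rs H) eqxx in c0.
Qed.

(** As K is nonzero, a linear combination of points at level K has level K exactly when its
    coefficients sum to 1. A set between list and hull covers both uses: the hull of a facet, and
    the bare points spanning the boundary of a fold. *)
Lemma aff_between s c K (S : set 'rV[R]_n) : K != 0 -> {in s, forall z, dot c z = K} ->
  [set` s] `<=` S -> S `<=` cv s -> aff S = [set y | (y <= spn s)%MS /\ dot c y = K].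
Proof.
move=> K0 H sS Ss; apply/seteqP; split=> y.
  move=> [m [a [x [sx a1 ->]]]]; split.
    apply: summx_sub => i _; apply: scalemx_sub.
    have /Ss/cvP[b [_ _ ->]] := sx i.
    by rewrite big_seq summx_sub // => z zs; rewrite scalemx_sub // mem_spn.
  rewrite dot_sumr -[RHS]mul1r -a1 mulr_suml; apply: eq_bigr => i _.
  by rewrite dotZr (cv_level H (Ss _ (sx i))).
move=> [/spn_comb[a ->] cK]; exists (size s), (fun i => a i), (fun i => s`_i); split => //.
  by move=> i; apply: sS; apply: mem_nth.
apply: (mulIf K0); rewrite mul1r -{}[RHS]cK dot_sumr mulr_suml; apply: eq_bigr => i _.
by rewrite dotZr H // mem_nth.
Qed.

Lemma aff_cv s c K : K != 0 -> {in s, forall z, dot c z = K} ->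
  aff (cv s) = [set y | (y <= spn s)%MS /\ dot c y = K].
Proof. by move=> K0 H; apply: aff_between => // z; apply: mem_cv. Qed.

Lemma aff_slice (A : 'M[R]_n) c K :
  aff [set y | (y <= A)%MS /\ dot c y = K] = [set y | (y <= A)%MS /\ dot c y = K].
Proof.
apply/seteqP; split=> y.
  move=> [m [a [x [sx a1 ->]]]]; split.
    by apply: summx_sub => i _; apply: scalemx_sub; have [] := sx i.
  rewrite dot_sumr -[RHS]mul1r -a1 mulr_suml; apply: eq_bigr => i _.
  by rewrite dotZr; have [_ ->] := sx i.
by move=> yA; exists 1%N, (fun=> 1), (fun=> y); rewrite !big_ord1 scale1r.
Qed.

Section Slice.
Variables (A : 'M[R]_n) (c y0 : 'rV[R]_n) (K : R).
Hypotheses (K0 : K != 0) (y0A : (y0 <= A)%MS) (cy0 : dot c y0 = K).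
Let B := (A :&: kermx c^T)%MS.

Let in_B x : (x <= B)%MS = (x <= A)%MS && (dot c x == 0).
Proof.
rewrite sub_capmx; congr (_ && _); rewrite dotC; apply/sub_kermxP/eqP => [xc|xc].
  by rewrite /dot xc mxE.
by apply/matrixP => i j; rewrite !ord1 [RHS]mxE; exact: xc.
Qed.

(** [A] is the direct sum of the line through [y0] and of its part where c vanishes: the source of
    the shift by one between dimension and rank. *)
Lemma rank_slice : \rank A = (\rank B).+1.
Proof.
have AE : (A :=: y0 + B)%MS.
  apply/eqmxP/andP; split; last by rewrite addsmx_sub y0A capmxSl.
  apply/row_subP => i; set x := row i A.
  have -> : x = (dot c x / K) *: y0 + (x - (dot c x / K) *: y0) by rewrite addrC subrK.
  apply: addmx_sub_adds; rewrite ?scalemx_sub // in_B.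
  rewrite dotBr dotZr cy0 mulfVK // subrr eqxx andbT.
  by rewrite addmx_sub ?row_sub // eqmx_opp scalemx_sub.
rewrite AE mxrank_disjoint_sum.
  by rewrite rank_rV (_ : y0 != 0) // -dot_eq0; apply/eqP => y00; move: K0;
     rewrite -cy0 (eqP (_ : y0 == 0)) ?dot0r ?eqxx // -dot_eq0 y00.
apply/eqP; rewrite -submx0; apply/rV_subP => x; rewrite sub_capmx => /andP[/sub_rVP[a ->]].
rewrite in_B dotZr cy0 mulf_eq0 (negPf K0) orbF => /andP[_ /eqP ->].
by rewrite scale0r sub0mx.
Qed.

Lemma flat_slice d : flat d [set y | (y <= A)%MS /\ dot c y = K] <-> \rank A = d.+1.
Proof.
rewrite rank_slice.
have sliceE : [set y | (y <= A)%MS /\ dot c y = K] = [set y0 + x | x in [set x | (x <= B)%MS]].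
  apply/seteqP; split=> [y [yA yK]|_ [x /= xB <-]].
    exists (y - y0); last by rewrite addrC subrK.
    by rewrite /= in_B dotBr yK cy0 subrr eqxx addmx_sub // eqmx_opp.
  move: xB; rewrite in_B => /andP[xA /eqP x0].
  by rewrite /= addmx_sub // dotDr cy0 x0 addr0.
split.
  move=> [p [M [rM LE]]]; congr S; rewrite -rM; apply/eqP.
  have inL (w : 'rV[R]_d) : (p + w *m M - y0 <= B)%MS.
    have : [set p + w *m M | w in [set: 'rV[R]_d]] (p + w *m M) by exists w.
    by rewrite -LE sliceE => -[x xB <-]; rewrite addrC addKr.
  have pB : (p - y0 <= B)%MS by have := inL 0; rewrite mul0mx addr0.
  rewrite eqn_leq; apply/andP; split; apply: mxrankS.
    apply/rV_subP => x xB.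
    have : [set y0 + x | x in [set x | (x <= B)%MS]] (y0 + x) by exists x.
    have : [set y0 + x | x in [set x | (x <= B)%MS]] (y0 + 0) by exists 0 => //=; exact: sub0mx.
    rewrite -sliceE LE => -[w _ w0] [w' _ w'x].
    have -> : x = (w' - w) *m M.
      rewrite mulmxBl -(addrK y0 x) [x + y0]addrC -w'x -[X in _ - X](addr0 y0) -w0.
      by rewrite opprD addrA [p + _]addrC addrK.
    exact: submxMl.
  apply/row_subP => i; rewrite rowE.
  have -> : delta_mx 0 i *m M = (p + delta_mx 0 i *m M - y0) - (p - y0).
    by rewrite opprB addrA subrK [p + _]addrC addrK.
  by rewrite addmx_sub // eqmx_opp.
case=> rB; move: sliceE; rewrite -{d}rB => ->.
exists y0, (row_base B); split; first by rewrite eq_row_base.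
apply/seteqP; split=> _ [x /= xB <-].
  move: xB; rewrite -(eq_row_base B) => /submxP[w ->]; by exists w.
by exists (x *m row_base B) => //=; rewrite -(eq_row_base B) submxMl.
Qed.

End Slice.

Lemma has_dim_cv s c K d : K != 0 -> {in s, forall z, dot c z = K} ->
  has_dim d (cv s) <-> rk s = d.+1.
Proof.
move=> K0 H; rewrite /has_dim (aff_cv K0 H); case: s H => [|y0 s] H.
  split; last by rewrite /rk /spn big_nil mxrank0.
  move=> [p [M [_ LE]]].
  have : [set p + w *m M | w in [set: 'rV[R]_d]] (p + 0 *m M) by exists 0.
  rewrite -LE /= /spn big_nil submx0 => -[/eqP ->]; rewrite dot0r => /esym/eqP.
  by rewrite (negPf K0).
by apply: (flat_slice K0 (mem_spn (mem_head y0 s)) (H y0 (mem_head y0 s))).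
Qed.

Lemma aff_cv_full s c K : K != 0 -> {in s, forall z, dot c z = K} -> rk s = n ->
  aff (cv s) = level c K.
Proof.
move=> K0 H rs; rewrite (aff_cv K0 H); apply/seteqP; split=> y /=; first by case.
by split => //; rewrite submx_full //; apply/eqP.
Qed.

(** K c' - K' c vanishes on a set of full rank, so it is 0: a facet determines its hyperplane. *)
Lemma level_unique s c K c' K' : K != 0 -> c' != 0 -> rk s = n ->
  {in s, forall z, dot c z = K} -> {in s, forall z, dot c' z = K'} ->
  K' != 0 /\ level c' K' = level c K.
Proof.
move=> K0 c0 rs H H'.
have E : K *: c' = K' *: c.
  apply/eqP; rewrite -subr_eq0; apply/eqP/(rk_full_dot0 rs) => z zs.
  by rewrite dotBl !dotZl H // H' // mulrC subrr.
have K'0 : K' != 0.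
  apply: contra c0 => /eqP K'0; move: E; rewrite K'0 scale0r => /eqP.
  by rewrite scaler_eq0 (negPf K0).
split => //; apply/seteqP; split=> x /= xc.
  apply: (mulfI K'0); rewrite -dotZl -E dotZl xc; exact: mulrC.
by apply: (mulfI K0); rewrite -dotZl E dotZl xc mulrC.
Qed.

End Span.

(** * Polar angles, planar sectors and the single turn around a peak *)

Section Angles.
Context {R : realType}.
Implicit Types (X Y alpha beta phi : R).

Lemma acos_polar X Y : (X != 0) || (Y != 0) -> exists rho theta,
  [/\ 0 < rho, 0 <= theta <= pi, X = rho * cos theta & `|Y| = rho * sin theta].
Proof.
move=> XY; set q := X ^+ 2 + Y ^+ 2.
have q0 : 0 < q.
  rewrite lt0r addr_ge0 ?sqr_ge0 // andbT paddr_eq0 ?sqr_ge0 // !sqrf_eq0.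
  by rewrite negb_and.
set rho := Num.sqrt q; have r0 : 0 < rho by rewrite sqrtr_gt0.
have r2 : rho ^+ 2 = q by rewrite sqr_sqrtr // ltW.
have Xr : -1 <= X / rho <= 1.
  rewrite -ler_norml normrM normfV (gtr0_norm r0) ler_pdivrMr // mul1r.
  rewrite -(ler_pXn2r (n := 2)) ?nnegrE ?normr_ge0 ?(ltW r0) // r2 -normrX ger0_norm ?sqr_ge0 //.
  by rewrite lerDl sqr_ge0.
exists rho, (acos (X / rho)); split => //.
- by rewrite acos_ge0 ?acos_lepi.
- by rewrite acosK // mulrC divfK // gt_eqF.
have r00 : rho != 0 by rewrite gt_eqF.
have YE : 1 - (X / rho) ^+ 2 = (Y / rho) ^+ 2.
  by rewrite !expr_div_n r2 /q; field; rewrite -/q gt_eqF.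
by rewrite sin_acos // YE sqrtr_sqr normrM normfV (gtr0_norm r0) mulrC divfK.
Qed.

Lemma polar X Y : (X != 0) || (Y != 0) -> exists rho theta,
  [/\ 0 < rho, 0 <= theta < 2 * pi, X = rho * cos theta, Y = rho * sin theta
    & if Y < 0 then pi < theta else theta <= pi].
Proof.
move=> XY; have [rho [theta [r0 /andP[t0 tp] XE YE]]] := acos_polar XY.
have p0 : 0 < pi :> R := pi_gt0 R.
have [Yn|Yp] := ltP Y 0; last first.
  exists rho, theta; split => //; last by rewrite -YE ger0_norm.
  by rewrite t0 /=; lra.
rewrite ltr0_norm // in YE.
have st : 0 < rho * sin theta by rewrite -YE oppr_gt0.
have t1 : 0 < theta.
  by rewrite lt0r t0 andbT; apply/eqP => t00; move: st; rewrite t00 sin0 mulr0 ltxx.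
have t2 : theta < pi.
  rewrite lt_neqAle tp andbT; apply/eqP => t00; move: st.
  by rewrite t00 sinpi mulr0 ltxx.
exists rho, (2 * pi - theta); split => //.
- by apply/andP; split; lra.
- by rewrite (mulr_natl pi 2) cosB cos2pi sin2pi mul1r mul0r addr0.
- by rewrite (mulr_natl pi 2) sinB cos2pi sin2pi mul0r mul1r sub0r mulrN -YE opprK.
- lra.
Qed.

Lemma sin_gt0_lt (x y : R) : 0 <= x <= pi -> 0 <= y <= pi -> 0 < sin (y - x) -> x < y.
Proof.
move=> /andP[x0 x1] /andP[y0 y1] s0; rewrite ltNge; apply/negP => yx.
have : 0 <= sin (x - y) by rewrite sin_ge0_pi //; apply/andP; split; lra.
by rewrite -(opprB y x) sinN oppr_ge0 leNgt s0.
Qed.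

End Angles.

Section Wedge.
Context {R : realType} {n : nat}.
Implicit Types (u v x y z a b : 'rV[R]_n) (s t : seq 'rV[R]_n) (alpha beta phi : R).

(** The last two hypotheses place every point between the two rays and pass to the hull by
    linearity; conversely, every direction between the rays is a nonnegative combination of p and
    q. *)
Lemma wedge_sector a b s p q rp rq alpha beta :
  p \in s -> q \in s -> 0 < rp -> 0 < rq ->
  dot p a = rp * cos alpha -> dot p b = rp * sin alpha ->
  dot q a = rq * cos beta -> dot q b = rq * sin beta ->
  alpha < beta < alpha + pi ->
  {in s, forall z, 0 <= dot p a * dot z b - dot p b * dot z a} ->
  {in s, forall z, 0 <= dot z a * dot q b - dot z b * dot q a} ->
  wedge a b (cv s) = sector a b alpha beta.
Proof.
move=> ps qs rp0 rq0 pa pb qa qb /andP[ab ba] Hp Hq.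
have sd : 0 < sin (beta - alpha) by rewrite sin_gt0_pi //; apply/andP; split; lra.
apply/seteqP; split=> [_ [t /= t0] [x sx <-]|_ [t /= t0] [phi /= /andP[p1 p2] <-]].
  have Px : 0 <= cos alpha * dot x b - sin alpha * dot x a.
    have H : {in s, forall z, dot (dot p b *: a - dot p a *: b) z <= 0}.
      move=> z zs; rewrite dotBl !dotZl !(dotC _ z); have := Hp z zs; lra.
    have /(_ x sx) := cv_halfspace H.
    rewrite /halfspace /= dotBl !dotZl !(dotC _ x) pa pb => H'.
    by rewrite -(pmulr_rge0 _ rp0); move: H'; nra.
  have Qx : 0 <= sin beta * dot x a - cos beta * dot x b.
    have H : {in s, forall z, dot (dot q a *: b - dot q b *: a) z <= 0}.
      move=> z zs; rewrite dotBl !dotZl !(dotC _ z); have := Hq z zs; lra.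
    have /(_ x sx) := cv_halfspace H.
    rewrite /halfspace /= dotBl !dotZl !(dotC _ x) qa qb => H'.
    by rewrite -(pmulr_rge0 _ rq0); move: H'; nra.
  set X := dot x a in Px Qx *; set Y := dot x b in Px Qx *.
  have [/andP[/eqP X0 /eqP Y0]|XY] := boolP ((X == 0) && (Y == 0)).
    exists 0 => //=; exists alpha; first by rewrite /= lexx ltW.
    by rewrite X0 Y0 [0 *: a]scale0r [0 *: b]scale0r addr0 scaler0; exact: scale0r.
  (* Rotation by -alpha takes the first ray to the positive axis. There Y' >= 0, so the polar angle
     eta is an arccosine in [0, pi]. *)
  pose X' := cos alpha * X + sin alpha * Y; pose Y' := cos alpha * Y - sin alpha * X.
  have c2 := cos2Dsin2 alpha.
  have XE : X = cos alpha * X' - sin alpha * Y'.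
    rewrite /X' /Y' -{1}[X]mul1r -c2; ring.
  have YE : Y = sin alpha * X' + cos alpha * Y'.
    rewrite /X' /Y' -{1}[Y]mul1r -c2; ring.
  have XY' : (X' != 0) || (Y' != 0).
    rewrite -negb_and; apply: contra XY => /andP[/eqP X0 /eqP Y0].
    by rewrite XE YE X0 Y0 !mulr0 subrr addr0 eqxx.
  have [rho [eta [r0 /andP[e0 e1] XE' YE']]] := acos_polar XY'.
  rewrite ger0_norm // in YE'.
  have sde : 0 <= sin (beta - alpha - eta).
    rewrite sinB sinB cosB -(pmulr_rge0 _ r0).
    have -> : rho * ((sin beta * cos alpha - cos beta * sin alpha) * cos eta -
       (cos beta * cos alpha + sin beta * sin alpha) * sin eta) =
       (sin beta * cos alpha - cos beta * sin alpha) * X' -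
       (cos beta * cos alpha + sin beta * sin alpha) * Y' by rewrite XE' YE'; ring.
    suff <- : sin beta * X - cos beta * Y = (sin beta * cos alpha - cos beta * sin alpha) * X' -
       (cos beta * cos alpha + sin beta * sin alpha) * Y' by [].
    by rewrite XE YE; ring.
  have eb : eta <= beta - alpha.
    rewrite leNgt; apply/negP => lt; move: sde; rewrite -opprB sinN oppr_ge0 leNgt.
    by rewrite sin_gt0_pi //; apply/andP; split; lra.
  exists (t * rho) => /=; first by rewrite mulr_ge0 // ltW.
  exists (alpha + eta) => /=; first by apply/andP; split; lra.
  rewrite -scalerA scalerDr !scalerA; congr (_ *: (_ *: _ + _ *: _)).
    by rewrite cosD XE XE' YE'; ring.
  by rewrite sinD YE XE' YE'; ring.
(* By the law of sines A p + B q projects to the unit vector of angle phi; division by A + B gives a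
   point of the hull. *)
set A := sin (beta - phi) / (sin (beta - alpha) * rp).
set B := sin (phi - alpha) / (sin (beta - alpha) * rq).
have A0 : 0 <= A.
  by rewrite divr_ge0 ?mulr_ge0 ?(ltW sd) ?(ltW rp0) // sin_ge0_pi //; apply/andP; split; lra.
have B0 : 0 <= B.
  by rewrite divr_ge0 ?mulr_ge0 ?(ltW sd) ?(ltW rq0) // sin_ge0_pi //; apply/andP; split; lra.
have AB : 0 < A + B.
  have [pe|pne] := eqVneq alpha phi.
    by apply: ltr_pwDl => //; rewrite /A -pe divr_gt0 // mulr_gt0.
  have p1' : alpha < phi by rewrite lt_neqAle pne.
  apply: ltr_wpDl => //; rewrite divr_gt0 ?mulr_gt0 // sin_gt0_pi //.
  by apply/andP; split; lra.
exists (t * (A + B)) => /=; first by rewrite mulr_ge0 // ltW.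
have inS : cv s ((A / (A + B)) *: p + (1 - A / (A + B)) *: q).
  have lam : 0 <= A / (A + B) <= 1.
    by rewrite divr_ge0 ?(ltW AB) //= ler_pdivrMr // mul1r lerDl.
  exact: (proj1 (convex_setP (cv s)) (@convex_cv _ _ s) p q _ lam (mem_cv ps) (mem_cv qs)).
exists ((A / (A + B)) *: p + (1 - A / (A + B)) *: q) => //.
rewrite -scalerA; congr (_ *: _); rewrite scalerDr !scalerA.
have E c : (A + B) * dot ((A / (A + B)) *: p + (1 - A / (A + B)) *: q) c = A * dot p c + B * dot q c.
  by rewrite dotDl !dotZl; field; rewrite gt_eqF.
have sd0 : sin (beta - alpha) != 0 by rewrite gt_eqF.
rewrite !E pa pb qa qb /A /B; congr (_ *: _ + _ *: _).
  transitivity ((sin (beta - phi) * cos alpha + sin (phi - alpha) * cos beta) / sin (beta - alpha)).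
    by field; rewrite sd0 !gt_eqF.
  apply: (mulIf sd0); by rewrite divfK // !sinB; ring.
transitivity ((sin (beta - phi) * sin alpha + sin (phi - alpha) * sin beta) / sin (beta - alpha)).
  by field; rewrite sd0 !gt_eqF.
by apply: (mulIf sd0); rewrite divfK // !sinB; ring.
Qed.

End Wedge.

Section Winding.
Context {R : realType} {n : nat}.
Implicit Types (u v x y z a b U W : 'rV[R]_n) (s t : seq 'rV[R]_n) (alpha beta phi : R).

Definition cross U W x y : R := dot U x * dot W y - dot W x * dot U y.

(** Gram-Schmidt on two combinations of U and W, one of which is chosen to vanish at x0. So x0 gets
    polar angle 0, and determinants in the frame are those of U and W up to a positive factor: sign
    tests on integers carry over to an orthonormal frame. *)
Lemma frame_exists U W x0 x1 : 0 < cross U W x0 x1 ->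
  exists a b (l : R), [/\ [/\ dot a a = 1, dot b b = 1 & dot a b = 0],
    forall g, dot U g = 0 -> dot W g = 0 -> dot g a = 0 /\ dot g b = 0,
    dot x0 b = 0, 0 < dot x0 a & 0 < l /\
    forall x y, dot x a * dot y b - dot x b * dot y a = l * cross U W x y].
Proof.
move=> c01; set al := dot U x0; set be := dot W x0.
set U' := al *: U + be *: W; set W' := al *: W - be *: U.
have cE x y : dot U' x * dot W' y - dot W' x * dot U' y = (al ^+ 2 + be ^+ 2) * cross U W x y.
  rewrite /U' /W' /cross dotDl !dotDl !dotZl !dotNl !dotZl; ring.
have W'x0 : dot W' x0 = 0 by rewrite /W' dotBl !dotZl -/al -/be; ring.
have U'x0 : dot U' x0 = al ^+ 2 + be ^+ 2 by rewrite /U' dotDl !dotZl -/al -/be; ring.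
have q0 : 0 < al ^+ 2 + be ^+ 2.
  rewrite lt0r addr_ge0 ?sqr_ge0 // andbT paddr_eq0 ?sqr_ge0 // !sqrf_eq0.
  apply/negP => /andP[/eqP a0 /eqP b0]; move: c01.
  by rewrite /cross -/al -/be a0 b0 !mul0r subrr ltxx.
have W'0 : W' != 0.
  apply/eqP => W0; have := cE x0 x1; rewrite W0 !dot0l mulr0 mul0r subrr => /esym/eqP.
  by rewrite mulf_eq0 !gt_eqF.
set r := Num.sqrt (dot W' W').
have r0 : 0 < r by rewrite sqrtr_gt0 dot_gt0.
have r2 : r ^+ 2 = dot W' W' by rewrite sqr_sqrtr // dot_ge0.
set b := r^-1 *: W'.
have bb : dot b b = 1.
  by rewrite /b dotZl dotZr -r2 mulrA -expr2 -exprMn mulVf ?expr1n // gt_eqF.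
set T := U' - dot U' b *: b.
have Tb : dot T b = 0 by rewrite /T dotBl dotZl bb mulr1 subrr.
have x0b : dot x0 b = 0 by rewrite dotC /b dotZl W'x0 mulr0.
have Tx0 : dot T x0 = al ^+ 2 + be ^+ 2.
  by rewrite /T dotBl dotZl U'x0 [dot b x0]dotC x0b mulr0 subr0.
have T0 : T != 0.
  by apply/eqP => T0; move: q0; rewrite -Tx0 T0 dot0l ltxx.
set p := Num.sqrt (dot T T).
have p0 : 0 < p by rewrite sqrtr_gt0 dot_gt0.
have p2 : p ^+ 2 = dot T T by rewrite sqr_sqrtr // dot_ge0.
set a := p^-1 *: T.
have p00 : p != 0 by rewrite gt_eqF.
have r00 : r != 0 by rewrite gt_eqF.
exists a, b, ((al ^+ 2 + be ^+ 2) / (p * r)); split => //.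
- split=> //; first by rewrite /a dotZl dotZr -p2 mulrA -expr2 -exprMn mulVf ?expr1n.
  by rewrite /a dotZl Tb mulr0.
- move=> g Ug Wg; have W'g : dot W' g = 0 by rewrite /W' dotBl !dotZl Ug Wg; ring.
  have bg : dot b g = 0 by rewrite /b dotZl W'g mulr0.
  split; last by rewrite dotC.
  rewrite dotC /a dotZl /T dotBl dotZl bg mulr0 subr0 /U' dotDl !dotZl Ug Wg; ring.
- by rewrite dotC /a dotZl Tx0 mulr_gt0 // invr_gt0.
split; first by rewrite divr_gt0 // mulr_gt0.
move=> x y; rewrite ![dot _ a]dotC ![dot _ b]dotC.
have E z : dot a z = p^-1 * (dot U' z - dot U' b * dot b z) by rewrite /a dotZl /T dotBl dotZl.
have bE z : dot b z = r^-1 * dot W' z by rewrite /b dotZl.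
transitivity ((al ^+ 2 + be ^+ 2) * cross U W x y / (p * r)); last by ring.
by rewrite -cE !E !bE; field; rewrite p00 r00.
Qed.

(** [spherical_angle] measures each sector from 0 in a frame of its own, while a cycle is described
    in one fixed frame; rotations of the frame connect the two. *)
Lemma sector_rot a b alpha beta :
  sector (cos alpha *: a + sin alpha *: b) (cos alpha *: b - sin alpha *: a) 0 (beta - alpha)
  = sector a b alpha beta.
Proof.
have E phi : cos (phi - alpha) *: (cos alpha *: a + sin alpha *: b) +
    sin (phi - alpha) *: (cos alpha *: b - sin alpha *: a) = cos phi *: a + sin phi *: b.
  apply/rowP => i; rewrite !mxE cosB sinB; have := cos2Dsin2 alpha.
  set C := cos alpha; set S := sin alpha => c2.
  transitivity ((C ^+ 2 + S ^+ 2) * (cos phi * a 0 i + sin phi * b 0 i)); first by ring.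
  by rewrite c2 mul1r.
apply/seteqP; split=> _ [t t0 [phi /= /andP[p1 p2] <-]].
  exists t => //; exists (phi + alpha) => /=; first by apply/andP; split; lra.
  by rewrite -E addrK.
exists t => //; exists (phi - alpha) => /=; first by apply/andP; split; lra.
by rewrite E.
Qed.

Lemma wedge_rot a b alpha (s : set 'rV[R]_n) :
  wedge (cos alpha *: a + sin alpha *: b) (cos alpha *: b - sin alpha *: a) s = wedge a b s.
Proof.
have E x : dot x (cos alpha *: a + sin alpha *: b) *: (cos alpha *: a + sin alpha *: b) +
   dot x (cos alpha *: b - sin alpha *: a) *: (cos alpha *: b - sin alpha *: a) =
   dot x a *: a + dot x b *: b.
  rewrite dotDr dotBr !dotZr; apply/rowP => i; rewrite !mxE.
  have := cos2Dsin2 alpha; set C := cos _; set S := sin _ => c2.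
  set A := dot x a; set B := dot x b.
  transitivity ((C ^+ 2 + S ^+ 2) * (A * a 0 i + B * b 0 i)); first by ring.
  by rewrite c2 mul1r.
by apply/seteqP; split=> _ [t t0 [x sx <-]]; exists t => //; exists x => //; rewrite E.
Qed.

Lemma frame_rot G a b alpha : normal_frame G a b ->
  normal_frame G (cos alpha *: a + sin alpha *: b) (cos alpha *: b - sin alpha *: a).
Proof.
move=> [aa bb ab H]; have ba : dot b a = 0 by rewrite dotC.
have c2 := cos2Dsin2 alpha.
split.
- by rewrite dotDl !dotDr !dotZl !dotZr aa bb ab ba -[RHS]c2; ring.
- by rewrite dotBl !dotBr !dotZl !dotZr aa bb ab ba -[RHS]c2; ring.
- rewrite dotDl !dotBr !dotZl !dotZr aa bb ab ba; ring.
- by move=> g /H[ga gb]; rewrite dotDr dotBr !dotZr ga gb !mulr0 subrr addr0.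
Qed.

Section Cycle.
Variables (U W : 'rV[R]_n) (g : seq 'rV[R]_n) (k : nat).
Variables (x : nat -> 'rV[R]_n) (F : nat -> seq 'rV[R]_n).
Hypotheses (k0 : (0 < k)%N) (xk : x k = x 0%N).
Hypothesis gU : {in g, forall z, dot U z = 0}.
Hypothesis gW : {in g, forall z, dot W z = 0}.
Hypothesis xF : forall i, (i < k)%N -> x i \in F i /\ x i.+1 \in F i.
Hypothesis xx : forall i, (i < k)%N -> 0 < cross U W (x i) (x i.+1).
Hypothesis xz : forall i, (i < k)%N -> {in F i, forall z, 0 <= cross U W (x i) z}.
Hypothesis zx : forall i, (i < k)%N -> {in F i, forall z, 0 <= cross U W z (x i.+1)}.
Hypothesis low : forall i, (i.+1 < k)%N ->
  cross U W (x 0%N) (x i) < 0 -> cross U W (x 0%N) (x i.+1) < 0.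

(** Positive determinants of consecutive rays say that each step turns by less than pi, modulo 2 pi.
    By [low] the upper half plane of the first ray is left only once, so the angles taken in [0, 2
    pi) increase along the cycle. *)
Lemma cycle_sectors : exists a b (th : nat -> R),
  [/\ normal_frame (cv g) a b,
      forall i, (i < k)%N -> th i < th i.+1 < th i + pi,
      th 0%N = 0, th k = 2 * pi
    & forall i, (i < k)%N -> wedge a b (cv (F i)) = sector a b (th i) (th i.+1)].
Proof.
have [a [b [l [[aa bb ab] gab x0b x0a [l0 cE]]]]] := frame_exists (xx k0).
have pos := @pi_gt0 R.
have nz i : (i < k)%N -> (dot (x i) a != 0) || (dot (x i) b != 0).
  move=> ik; rewrite -negb_and; apply/negP => /andP[/eqP a0 /eqP b0].
  have := cE (x i) (x i.+1); rewrite a0 b0 !mul0r subrr => /esym/eqP.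
  by rewrite mulf_eq0 !gt_eqF // xx.
have cE' i z : l * cross U W (x i) z = dot (x i) a * dot z b - dot (x i) b * dot z a by rewrite cE.
have Yi i : dot (x i) b < 0 <-> cross U W (x 0%N) (x i) < 0.
  have := cE' 0%N (x i); rewrite x0b mul0r subr0 => E.
  by rewrite -(pmulr_rlt0 _ x0a) -E (pmulr_rlt0 _ l0).
have /choice[th0 Hth] : forall i, exists th, (i < k)%N ->
    exists2 rho, 0 < rho & [/\ 0 <= th < 2 * pi, dot (x i) a = rho * cos th,
      dot (x i) b = rho * sin th & if dot (x i) b < 0 then pi < th else th <= pi].
  move=> i; case: (ltnP i k) => [ik|_]; last by exists 0.
  by have [rho [th [? ? ? ? ?]]] := polar (nz i ik); exists th => _; exists rho.
have th00 : th0 0%N = 0.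
  have [rho r0 [/andP[t0 t2] A B]] := Hth 0%N k0; rewrite x0b ltxx => tp.
  move: B; rewrite x0b => /esym/eqP; rewrite mulf_eq0 gt_eqF //= => /eqP s0.
  move: t0; rewrite le_eqVlt => /predU1P[//|t0].
  move: tp; rewrite le_eqVlt => /predU1P[tp|tp]; last first.
    by have := sin_gt0_pi (x := th0 0%N); rewrite s0 ltxx t0 tp => /(_ isT).
  by move: x0a; rewrite A tp cospi mulrN1 oppr_gt0 ltNge ltW.
(* The last ray equals the first, but its angle is set to 2 pi to close the turn. *)
pose th i := if (i < k)%N then th0 i else 2 * pi.
have thk : th k = 2 * pi by rewrite /th ltnn.
have pol i : (i <= k)%N -> exists2 rho, 0 < rho &
    dot (x i) a = rho * cos (th i) /\ dot (x i) b = rho * sin (th i).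
  rewrite leq_eqVlt => /predU1P[->|ik].
    have [rho r0 [_ A B _]] := Hth 0%N k0; exists rho => //.
    by rewrite xk A B thk th00 (mulr_natl pi 2) cos2pi sin2pi cos0 sin0.
  by have [rho r0 [_ A B _]] := Hth i ik; exists rho => //; rewrite /th ik.
have sd i : (i < k)%N -> 0 < sin (th i.+1 - th i).
  move=> ik; have [r r0 [A B]] := pol i (ltnW ik); have [r' r0' [A' B']] := pol i.+1 ik.
  have := xx ik; rewrite -(pmulr_rgt0 _ l0) cE' A B A' B' sinB.
  rewrite (_ : _ - _ = (r * r') * (sin (th i.+1) * cos (th i) - cos (th i.+1) * sin (th i))).
    by rewrite pmulr_rgt0 // mulr_gt0.
  ring.
have step i : (i < k)%N -> th i < th i.+1 < th i + pi.
  move=> ik; have := sd i ik.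
  have [r r0 [A B]] := pol i (ltnW ik).
  have ti : th i = th0 i by rewrite /th ik.
  have [_ _ [/andP[t0 t2] _ _ tl]] := Hth i ik; rewrite -ti in t0 t2 tl.
  (* In the closing step the determinant with the first ray shows that the last ray is strictly in
     the lower half plane, so its angle exceeds pi. *)
  have [ik1|] := ltnP i.+1 k; last first.
    move=> ki; have E : i.+1 = k by apply/eqP; rewrite eqn_leq ik.
    rewrite E thk => _; have /Yi Yn : cross U W (x 0%N) (x i) < 0.
      have := xx ik; rewrite E xk /cross; lra.
    by rewrite Yn in tl; apply/andP; split; lra.
  have [_ _ [/andP[t0' t2'] _ _ tl']] := Hth i.+1 ik1.
  have ti' : th i.+1 = th0 i.+1 by rewrite /th ik1.
  rewrite -ti' in t0' t2' tl'.
  have Lw := low ik1; rewrite -!Yi in Lw.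
  case: ifPn tl => [Yn tl|]; [rewrite (Lw Yn) in tl'|rewrite -leNgt => Yp tl].
    rewrite (_ : th i.+1 - th i = (th i.+1 - pi) - (th i - pi)); last by ring.
    move=> /sin_gt0_lt H; have : th i - pi < th i.+1 - pi by apply: H; apply/andP; split; lra.
    by move=> H'; apply/andP; split; lra.
  case: ifPn tl' => [Yn' tl'|]; last first.
    rewrite -leNgt => Yp' tl' /sin_gt0_lt H.
    have lt : th i < th i.+1 by apply: H; apply/andP; split.
    rewrite lt /= lt_neqAle; apply/andP; split; last by lra.
    apply/eqP => E; have := sd i ik; rewrite E addrC addKr sinpi ltxx //.
  move=> s0; have lt : th i < th i.+1 by lra.
  rewrite lt ltNge /=; apply/negP => ge.
  have : 0 <= sin (th i.+1 - th i - pi) by rewrite sin_ge0_pi //; apply/andP; split; lra.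
  by rewrite sinB cospi sinpi mulr0 subr0 mulrN1 oppr_ge0 leNgt s0.
exists a, b, th; split => //.
- split=> // z gz.
  have Uz : dot U z = 0 by apply: (cv_level gU gz).
  have Wz : dot W z = 0 by apply: (cv_level gW gz).
  exact: gab.
- by rewrite /th k0.
move=> i ik; have [r r0 [A B]] := pol i (ltnW ik); have [r' r0' [A' B']] := pol i.+1 ik.
have [p1 p2] := xF ik.
apply: (wedge_sector p1 p2 r0 r0' A B A' B' (step i ik)) => z zF.
  by rewrite cE mulr_ge0 ?xz // ltW.
by rewrite cE mulr_ge0 ?zx // ltW.
Qed.

Lemma cycle_angles : angles_sum_2pi (cv g) (fun i : 'I_k => cv (F i)).
Proof.
have [a [b [th [fr st t0 tk wE]]]] := cycle_sectors.
have pos := @pi_gt0 R.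
exists (fun i => th i.+1 - th i); split.
  move=> i; exists (cos (th i) *: a + sin (th i) *: b), (cos (th i) *: b - sin (th i) *: a).
  have /andP[s1 s2] := st i (ltn_ord i).
  split; [exact: frame_rot|apply/andP; split; lra|].
  by rewrite wedge_rot sector_rot wE.
by rewrite -(big_mkord xpredT (fun i => th i.+1 - th i)) telescope_sumr // tk t0 subr0.
Qed.

Lemma cycle_winds : winds_once (cv g) (fun i : 'I_k => cv (F i)).
Proof.
have [a [b [th [fr st t0 tk wE]]]] := cycle_sectors.
exists a, b, th; split => //; first by move=> i; have /andP[] := st i (ltn_ord i).
  by rewrite tk t0 add0r.
by move=> i; apply: wE.
Qed.

End Cycle.
End Winding.

(** * Faces and edges of hulls of points on a sphere *)

Section Faces.
Context {R : realType} {n : nat}.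
Implicit Types (u v x y z c h : 'rV[R]_n) (s t : seq 'rV[R]_n).

Lemma seq_argmax (T : eqType) (f : T -> R) (s : seq T) : s != [::] ->
  exists2 x : T, x \in s & {in s, forall y : T, f y <= f x}.
Proof.
elim: s => // x s IH _; have [->|/IH[y ys yM]] := eqVneq s [::].
  by exists x; rewrite ?mem_head // => y; rewrite inE => /eqP ->.
have [xy|yx] := leP (f x) (f y).
  by exists y => [|z]; rewrite inE ?ys ?orbT // => /predU1P[->//|/yM].
exists x => [|z]; rewrite inE ?eqxx // => /predU1P[->//|/yM zy].
exact: le_trans zy (ltW yx).
Qed.

(** The functional is M c1 + c2, with M so large that points not tight for c1 cannot compete,
    whatever c2 does there. *)
Lemma tight_trans s c1 b1 c2 b2 : {in s, forall z, dot c1 z <= b1} ->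
  {in tight c1 b1 s, forall z, dot c2 z <= b2} ->
  exists c b, {in s, forall z, dot c z <= b} /\ tight c b s = tight c2 b2 (tight c1 b1 s).
Proof.
move=> H1 H2.
have [M HM] : exists M, {in s, forall z, dot c1 z < b1 -> dot c2 z - b2 < M * (b1 - dot c1 z)}.
  elim: s {H1 H2} => [|z s [M IH]]; first by exists 0.
  exists (Num.max M ((dot c2 z - b2) / (b1 - dot c1 z) + 1)) => y.
  move=> ys yb; have y0 : 0 < b1 - dot c1 y by rewrite subr_gt0.
  move: ys; rewrite inE => /predU1P[ye|ys].
    by rewrite -ye -ltr_pdivrMr // lt_max ltrDl ltr01 orbT.
  by apply: (lt_le_trans (IH y ys yb)); rewrite ler_pM2r // le_max lexx.
exists (M *: c1 + c2), (M * b1 + b2).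
have E z : z \in s -> (dot (M *: c1 + c2) z <= M * b1 + b2) /\
    (dot (M *: c1 + c2) z == M * b1 + b2) = (dot c1 z == b1) && (dot c2 z == b2).
  move=> zs; rewrite dotDl dotZl; have := H1 z zs; rewrite le_eqVlt => /predU1P[zb|zb].
    rewrite zb eqxx lerD2l (inj_eq (addrI _)); split => //.
    by apply: H2; rewrite mem_filter zb eqxx.
  have := HM z zs zb; rewrite [dot c1 z == b1]lt_eqF //= => lt.
  have lt' : M * dot c1 z + dot c2 z < M * b1 + b2 by lra.
  by rewrite ltW // lt_eqF.
split=> [z /E[]//|].
by rewrite /tight -filter_predI; apply: eq_in_filter => z /E[_ ->] /=; rewrite andbC.
Qed.

Lemma face_trans s c b F : {in s, forall z, dot c z <= b} ->
  face (cv (tight c b s)) F -> face (cv s) F.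
Proof.
move=> H /face_cv[c' [b' [H' ->]]]; have [c2 [b2 [H2 E]]] := tight_trans H H'.
by apply/face_cv; exists c2, b2; rewrite E.
Qed.

(** Combining h with v gives a face through v on which h is positive off v; the point of this face
    nearest to v is joined to v by an edge. *)
Lemma edge_at s v x0 h : on_sphere s -> v \in s -> x0 \in s ->
  dot h v = 0 -> dot h x0 != 0 ->
  exists2 x, x \in s & [/\ x != v, dot h x != 0 & face (cv s) (cv [:: v; x])].
Proof.
move=> sph vs; have vv := sph v vs.
wlog hx0 : h / 0 < dot h x0 => [W|] x0s hv hx.
  have [hp|hn|h0] := ltrgtP (dot h x0) 0; last by rewrite h0 eqxx in hx.
    have [|||| x xs [xv hx' f]] := W (- h) => //; rewrite ?dotNl ?oppr_gt0 ?hv ?oppr0 ?oppr_eq0 //.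
    by exists x => //; rewrite dotNl oppr_eq0 in hx'; split.
  by apply: W.
have lt1 z : z \in s -> z != v -> 0 < 1 - dot v z.
  by move=> zs zv; rewrite subr_gt0 dot_unit_lt1 ?sph // eq_sym.
have x0v : x0 != v by apply: contra hx => /eqP ->; rewrite hv.
pose f z := dot h z / (1 - dot v z).
have nz : [seq z <- s | z != v] != [::].
  by apply/eqP => E; have := mem_filter (predC1 v) x0 s; rewrite /= x0v x0s E.
have [y] := seq_argmax f nz; rewrite mem_filter => /andP[yv ys] ymax.
(* rho is the least factor for which h + rho v is bounded on [s] by its value at v; the maximiser y
   is tight as well. *)
set rho := f y in ymax.
have rho0 : 0 < rho.
  apply: (lt_le_trans (y := f x0)); first by rewrite divr_gt0 // lt1.
  by apply: ymax; rewrite mem_filter x0v.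
have H1 : {in s, forall z, dot (h + rho *: v) z <= rho}.
  move=> z zs; rewrite dotDl dotZl; have [->|zv] := eqVneq z v; first by rewrite hv vv; lra.
  have := ymax z; rewrite mem_filter zv zs => /(_ isT); rewrite /f ler_pdivrMr ?lt1 //; lra.
set t := tight (h + rho *: v) rho s.
have hpos z : z \in t -> z != v -> 0 < dot h z.
  rewrite mem_filter => /andP[/eqP]; rewrite dotDl dotZl => E zs zv.
  have -> : dot h z = rho * (1 - dot v z) by lra.
  by rewrite mulr_gt0 ?lt1.
have vt : v \in t by rewrite mem_filter dotDl dotZl hv vv add0r mulr1 eqxx.
have yt : y \in t.
  rewrite mem_filter ys andbT dotDl dotZl; apply/eqP.
  have : rho * (1 - dot v y) = dot h y by rewrite divfK // gt_eqF // lt1.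
  lra.
have nz' : [seq z <- t | z != v] != [::].
  by apply/eqP => E; have := mem_filter (predC1 v) y t; rewrite /= yv yt E.
have [x] := seq_argmax (dot v) nz'; rewrite mem_filter => /andP[xv xt] xmax.
have ts z : z \in t -> z \in s by rewrite mem_filter => /andP[].
have xx : dot x x = 1 by rewrite sph // ts.
(* v + x is maximal on [t] at v and x alone: off v, <v, z> is at most <v, x> by the choice of x, and
   <x, z> < 1 for z other than x. *)
have E z : z \in t -> dot (v + x) z <= 1 + dot v x /\
    (dot (v + x) z == 1 + dot v x) = (z \in [:: v; x]).
  move=> zt; have zs := ts z zt; have zz := sph z zs.
  rewrite !inE dotDl; have [->|zv] /= := eqVneq z v.
    by rewrite vv [dot x v]dotC lexx eqxx.
  have [->|zx] := eqVneq z x; first by rewrite xx addrC lexx eqxx.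
  have : dot x z < 1 by rewrite dot_unit_lt1 // eq_sym.
  have := xmax z; rewrite mem_filter zv zt => /(_ isT) => A B.
  have lt : dot v z + dot x z < 1 + dot v x by lra.
  by rewrite ltW // lt_eqF.
exists x; first exact: ts.
split => //; first by rewrite gt_eqF // hpos.
apply: (face_trans H1); apply/face_cv; exists (v + x), (1 + dot v x); split.
  by move=> z /E[].
apply: eq_cv => z; rewrite mem_filter -/t; apply/idP/andP => [zvx|[tz zt]].
  have zt : z \in t by move: zvx; rewrite !inE => /orP[] /eqP ->.
  by rewrite (E z zt).2.
by rewrite -(E z zt).2.
Qed.

Lemma rk2 x y c K : K != 0 -> dot c x = K -> dot c y = K -> x != y -> rk [:: x; y] = 2%N.
Proof.
move=> K0 cx cy xy.
have nz z : dot c z = K -> z != 0.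
  by move=> cz; apply: contra K0 => /eqP z0; rewrite -cz z0 dot0r.
have E : (spn [:: x; y] :=: x + y)%MS.
  rewrite /spn !big_cons big_nil.
  by apply: adds_eqmx (genmxE x) (eqmx_trans (addsmx0 _ _) (genmxE y)).
rewrite /rk E.
rewrite mxrank_disjoint_sum ?rank_rV ?(nz x) ?(nz y) //.
apply/eqP; rewrite -submx0; apply/rV_subP => z; rewrite sub_capmx.
move=> /andP[/sub_rVP[a ->] /sub_rVP[b E']].
have ab : a = b by apply: (mulIf K0); rewrite -{1}cx -cy -!dotZr E'.
move/eqP: E'; rewrite ab -subr_eq0 -scalerBr scaler_eq0 subr_eq0 (negPf xy) orbF => /eqP ->.
by rewrite scale0r sub0mx.
Qed.

Lemma cv2_hull x y : cv [:: x; y] = hull [set x; y].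
Proof.
congr hull; apply/seteqP; split=> z /=; rewrite !inE.
  by move=> /orP[/eqP->|/eqP->]; [left|right].
by case=> ->; rewrite eqxx ?orbT.
Qed.

Lemma cv2P x y z : cv [:: x; y] z -> exists2 a : R, 0 <= a <= 1 & z = a *: x + (1 - a) *: y.
Proof.
move: z; apply: cv_sub.
  apply/convex_setP => z w t /andP[t0 t1] [a /andP[a0 a1] ->] [b /andP[b0 b1] ->].
  exists (t * a + (1 - t) * b).
    apply/andP; split; first by rewrite addr_ge0 // mulr_ge0 // subr_ge0.
    by nra.
  apply/rowP => i; rewrite !mxE; ring.
move=> z; rewrite !inE => zxy; have [->|zx] := eqVneq z x.
  by exists 1; rewrite ?lexx ?ler01 // subrr scale0r scale1r addr0.
rewrite (negPf zx) /= in zxy; rewrite (eqP zxy).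
by exists 0; rewrite ?lexx ?ler01 // subr0 scale0r scale1r add0r.
Qed.

Lemma enormZ (a : R) x : enorm (a *: x) = `|a| * enorm x.
Proof. by rewrite /enorm dotZl dotZr mulrA -expr2 sqrtrM ?sqr_ge0 // sqrtr_sqr. Qed.

(** Equality of two segments does not match their endpoints directly. Instead the difference vector
    of each pair is a multiple of the other by a factor of modulus at most 1, so the lengths
    agree. *)
Lemma unit_segment_dist x y : unit_segment (cv [:: x; y]) -> enorm (x - y) = 1.
Proof.
move=> [x' [y']]; rewrite -cv2_hull => -[E xy'].
have sub z w z' w' : cv [:: z; w] = cv [:: z'; w'] -> exists2 a : R, `|a| <= 1 & z - w = a *: (z' - w').
  move=> Ezw; have /cv2P[a /andP[a0 a1] zE] : cv [:: z'; w'] z by rewrite -Ezw; apply: mem_cv; rewrite mem_head.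
  have /cv2P[b /andP[b0 b1] wE] : cv [:: z'; w'] w by rewrite -Ezw; apply: mem_cv; rewrite !inE eqxx orbT.
  exists (a - b); first by rewrite ler_norml; apply/andP; split; lra.
  by rewrite zE wE; apply/rowP => i; rewrite !mxE; ring.
have [a a1 xyE] := sub _ _ _ _ E; have [b b1 xyE'] := sub _ _ _ _ (esym E).
have e1 : enorm (x - y) <= 1 by rewrite xyE enormZ xy' mulr1.
apply/eqP; rewrite eq_le e1 /= -xy' xyE' enormZ -[leRHS]mul1r.
by rewrite ler_wpM2r // sqrtr_ge0.
Qed.

Lemma dist_sphere x y : dot x x = 1 -> dot y y = 1 -> (enorm (x - y) == 1) = (dot x y == 2^-1).
Proof.
move=> xx yy; have E : dot (x - y) (x - y) = 2 - 2 * dot x y.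
  by rewrite dotBl !dotBr xx yy (dotC y x); ring.
rewrite /enorm E; apply/eqP/eqP => [|->]; last by rewrite (_ : 2 - 2 * 2^-1 = 1) ?sqrtr1 //; lra.
have := dot_ge0 (x - y); rewrite E => ge0 /(congr1 (fun r : R => r ^+ 2)).
rewrite sqr_sqrtr // expr1n; lra.
Qed.

Lemma unit_segment_cv x y : dot x x = 1 -> dot y y = 1 -> dot x y = 2^-1 -> unit_segment (cv [:: x; y]).
Proof.
move=> xx yy xy; exists x, y; rewrite cv2_hull; split => //.
by apply/eqP; rewrite dist_sphere // xy.
Qed.

(** Otherwise some nonzero h vanishes at v and at its unit neighbours, but not on all of [s]. The
    edge provided by [edge_at] leads to a point where h is not 0, yet it is a unit edge. *)
Lemma vertex_span s c K v : on_sphere s -> K != 0 -> {in s, forall z, dot c z = K} ->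
  rk s = n -> v \in s -> unit_edge_facet (cv s) ->
  rk (v :: [seq z <- s | dot v z == 2^-1]) = n.
Proof.
move=> sph K0 H rs vs ue; apply/eqP; rewrite eqn_leq rank_leq_col /= leqNgt; apply/negP.
move=> /rk_lt_dot0[h h0 Hh].
have hv : dot h v = 0 by apply: Hh; rewrite mem_head.
have [x0 x0s hx0] : exists2 x0, x0 \in s & dot h x0 != 0.
  apply/hasP; apply/negP => /negP; rewrite -all_predC => /allP H0.
  by move: h0; rewrite (rk_full_dot0 rs (c := h)) ?eqxx // => z /H0 /negPn /eqP.
have [x xs [xv hx fx]] := edge_at sph vs x0s hv hx0.
have d1 : has_dim 1 (cv [:: v; x]).
  apply/(has_dim_cv _ K0 (c := c)) => [z|].
    by rewrite !inE => /orP[]/eqP ->; apply: H.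
  by apply: (rk2 K0 (H v vs) (H x xs)); rewrite eq_sym.
have /unit_segment_dist/eqP := ue _ fx d1; rewrite dist_sphere ?sph // => vx.
by move: hx; rewrite Hh ?eqxx // inE mem_filter vx xs orbT.
Qed.

Lemma facet_hull s F : (0 < n)%N -> \sum_(z <- s) z = 0 -> rk s = n -> s != [::] ->
  facets (cv s) F -> exists c b, [/\ 0 < b, c != 0, {in s, forall z, dot c z <= b},
    F = cv (tight c b s) & rk (tight c b s) = n].
Proof.
move=> n0 s0 rs sn [/face_cv[c [b [H FE]]] dF].
(* The supporting inequality is summed over [s], whose sum is 0. *)
have b0 : 0 <= b.
  have : \sum_(z <- s) dot c z <= \sum_(z <- s) b.
    by rewrite !big_seq; apply: ler_sum.
  rewrite -dot_sumr s0 dot0r big_const_seq iter_addr_0 count_predT -mulr_natr => h.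
  by rewrite -(pmulr_lge0 (x := (size s)%:R)) // ltr0n lt0n size_eq0.
have tn : tight c b s != [::].
  apply/eqP => t0; move: dF; rewrite FE t0 => -[p [M [_ LE]]].
  have : [set p + w *m M | w in [set: 'rV[R]_(n - 1)]] (p + 0 *m M) by exists 0.
  rewrite -LE => -[m [a [x [sx a1 _]]]].
  case: m a x sx a1 => [|m] a x sx a1; first by move/eqP: a1; rewrite big_ord0 eq_sym oner_eq0.
  have /cvP[d [_ d1 _]] := sx ord0; by move/eqP: d1; rewrite big_nil eq_sym oner_eq0.
(* [face] admits c = 0, which would give the whole hull; its affine hull is the whole space, against
   the dimension n - 1. *)
have [c0|cn] := eqVneq c 0.
  have bE : b = 0.
    by case tE: (tight c b s) tn => [//|z t] _; have := mem_head z t;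
      rewrite -tE mem_filter c0 dot0l => /andP[/eqP].
  exfalso; have tE : tight c b s = s.
    by apply/all_filterP/allP => z _; rewrite c0 bE dot0l.
  have span y : exists a : nat -> R, y = \sum_(i < size s) a i *: s`_i.
    by apply: spn_comb; rewrite submx_full //; apply/eqP.
  have full : aff F = setT.
    apply/seteqP; split=> // y _; have [a ->] := span y.
    (* the centroid of [s] is 0, so the coefficients can be shifted to have sum 1 *)
    set k := (1 - \sum_(i < size s) a i) / (size s)%:R.
    have kE : k * (size s)%:R = 1 - \sum_(i < size s) a i.
      by rewrite /k mulfVK // pnatr_eq0 size_eq0.
    exists (size s), (fun i => a i + k), (fun i => s`_i); split.
    - by move=> i; rewrite FE tE; apply: mem_cv; apply: mem_nth.
    - by rewrite big_split /= sumr_const card_ord -[k *+ _]mulr_natr kE addrC subrK.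
    under [RHS]eq_bigr do rewrite scalerDl.
    rewrite big_split /= -scaler_sumr -[X in _ = _ + _ *: X](big_mkord xpredT (fun i => s`_i)).
    by rewrite -(big_nth 0 xpredT id) s0 scaler0 addr0.
  move: dF; rewrite /has_dim full => -[p [M [rM LE]]].
  have : (1%:M <= M)%MS.
    apply/row_subP => i.
    have : [set: 'rV[R]_n] (p + row i 1%:M) by [].
    have : [set: 'rV[R]_n] p by [].
    rewrite LE => -[w _ wE] [w' _ w'E].
    have -> : row i 1%:M = (w' - w) *m M.
      by rewrite mulmxBl -[w' *m M](addKr p) w'E -[w *m M](addKr p) wE addKr addNr subr0.
    exact: submxMl.
  move=> /mxrankS; rewrite mxrank1 rM; apply/negP; rewrite -ltnNge subn1 prednK //.
have bn : b != 0.
  apply: contra cn => /eqP b00; apply/eqP/(rk_full_dot0 rs).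
  have le0 z : z \in s -> 0 <= - dot c z by move=> zs; rewrite oppr_ge0 -b00 H.
  have : \sum_(z <- s) - dot c z == 0 by rewrite sumrN -dot_sumr s0 dot0r oppr0.
  rewrite big_seq psumr_eq0 // => /allP E z zs; have := E z zs; rewrite zs /=.
  by rewrite oppr_eq0 => /eqP.
exists c, b; split => //; first by rewrite lt0r bn.
have /(has_dim_cv _ bn (c := c)) : has_dim (n - 1) (cv (tight c b s)) by rewrite -FE.
rewrite subn1 prednK // => -> // z; by rewrite mem_filter => /andP[/eqP].
Qed.

End Faces.

(** * Embedding integer vectors *)

Lemma veqP (x y : vec) : reflect (x = y) (veq x y).
Proof.
elim: x y => [|a x IH] [|b y] /=; try by constructor.
case: Z.eqb_spec => [->|ab]; last by constructor=> -[].
by apply: (iffP (IH y)) => [->|[]].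
Qed.

Lemma vmemP (x : vec) (s : seq vec) : vmem x s = (x \in s).
Proof.
elim: s => //= y s IH; rewrite inE.
by case: veqP => [->|/eqP/negPf ->]; rewrite ?eqxx.
Qed.

Lemma lseqP (s t : seq vec) : reflect (s = t) (lseq s t).
Proof.
elim: s t => [|x s IH] [|y t] /=; try by constructor.
case: veqP => [->|ab]; last by constructor=> -[].
by apply: (iffP (IH t)) => [->|[]].
Qed.

Lemma keqP (k l : key) : reflect (k = l) (keq k l).
Proof.
case: k l => [r K s] [r' K' s']; rewrite /keq /=.
case: veqP => [->|ne]; last by constructor=> -[].
case: Z.eqb_spec => [->|ne]; last by constructor=> -[].
by apply: (iffP (veqP _ _)) => [->|[]].
Qed.

HB.instance Definition _ := hasDecEq.Build key keqP.

Lemma kmemP (k : key) (s : seq key) : kmem k s = (k \in s).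
Proof.
elim: s => //= y s IH; rewrite inE.
by case: keqP => [->|/eqP/negPf ->]; rewrite ?eqxx.
Qed.

Section Embed.
Context {R : realType}.
Implicit Types (a b : Z) (x y z : vec).

Definition zr a : R := (int_of_Z a)%:~R.

Lemma zr0 : zr 0 = 0. Proof. by []. Qed.
Lemma zr1 : zr 1 = 1. Proof. by []. Qed.
Lemma zrD a b : zr (a + b)%Z = zr a + zr b.
Proof. by rewrite /zr -[(a + b)%Z]/(a + b) rmorphD rmorphD. Qed.
Lemma zrM a b : zr (a * b)%Z = zr a * zr b.
Proof. by rewrite /zr -[(a * b)%Z]/(a * b) rmorphM rmorphM. Qed.
Lemma zrN a : zr (- a)%Z = - zr a.
Proof. by rewrite /zr -[(- a)%Z]/(- a) rmorphN rmorphN. Qed.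
Lemma zrB a b : zr (a - b)%Z = zr a - zr b.
Proof. by rewrite -zrN -zrD. Qed.
Lemma zr_le a b : (zr a <= zr b) = (a <=? b)%Z.
Proof. by rewrite /zr ler_int; lia. Qed.
Lemma zr_lt a b : (zr a < zr b) = (a <? b)%Z.
Proof. by rewrite /zr ltr_int; lia. Qed.
Lemma zr_eq a b : (zr a == zr b) = (a =? b)%Z.
Proof. by rewrite /zr eqr_int; lia. Qed.
Lemma zr_eq0 a : (zr a == 0) = (a =? 0)%Z.
Proof. by rewrite -zr0 zr_eq. Qed.
Lemma zr_inj : injective zr.
Proof. by move=> a b /eqP; rewrite zr_eq => /Z.eqb_eq. Qed.

Lemma nth_vadd x y i : nth 0%Z (vadd x y) i = (nth 0%Z x i + nth 0%Z y i)%Z.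
Proof.
elim: x y i => [|a x IH] [|b y] [|i] //=; rewrite ?nth_nil //; try lia.
Qed.

Lemma nth_vscale a x i : nth 0%Z (vscale a x) i = (a * nth 0%Z x i)%Z.
Proof. elim: x i => [|b x IH] [|i] //=; rewrite ?nth_nil; lia. Qed.

Lemma nth_hmul x y i : nth 0%Z (hmul x y) i = (nth 0%Z x i * nth 0%Z y i)%Z.
Proof. elim: x y i => [|a x IH] [|b y] [|i] //=; rewrite ?nth_nil; lia. Qed.

Lemma size_hmul x y : size (hmul x y) = minn (size x) (size y).
Proof. by elim: x y => [|a x IH] [|b y] //=; rewrite IH minnSS. Qed.

Lemma zdotE n x y : (size x <= n)%N ->
  zr (zdot x y) = \sum_(i < n) zr (nth 0%Z x i) * zr (nth 0%Z y i).
Proof.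
elim: x y n => [|a x IH] y n /= xn.
  by rewrite big1 ?zr0 // => i _; rewrite nth_nil zr0 mul0r.
case: n xn => // n xn; case: y => [|b y].
  by rewrite big1 ?zr0 // => i _; rewrite nth_nil zr0 mulr0.
by rewrite big_ord_recl /= zrD zrM (IH y n).
Qed.

Section Rows.
Variable n : nat.

Definition toRow x : 'rV[R]_n := \row_i zr (nth 0%Z x i).

Lemma toRowD x y : toRow (vadd x y) = toRow x + toRow y.
Proof. by apply/rowP => i; rewrite !mxE nth_vadd zrD. Qed.

Lemma toRowZ a x : toRow (vscale a x) = zr a *: toRow x.
Proof. by apply/rowP => i; rewrite !mxE nth_vscale zrM. Qed.

Lemma toRow_inj x y : size x = n -> size y = n -> toRow x = toRow y -> x = y.
Proof.
move=> sx sy /rowP E; apply: (@eq_from_nth _ 0%Z); first by rewrite sx.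
by move=> i; rewrite sx => ni; have := E (Ordinal ni); rewrite !mxE => /zr_inj.
Qed.

Lemma toRow0 : toRow [::] = 0.
Proof. by apply/rowP => i; rewrite !mxE nth_nil zr0. Qed.

Definition toMx (M : seq vec) : 'M[R]_n := \matrix_i toRow (nth [::] M i).

Lemma toRow_vmul x M : (size M <= n)%N -> toRow (vmul x M) = toRow x *m toMx M.
Proof.
move=> sM; rewrite mulmx_sum_row.
under eq_bigr do rewrite rowK mxE.
suff E m : (size M <= m)%N ->
    toRow (vmul x M) = \sum_(i < m) zr (nth 0%Z x i) *: toRow (nth [::] M i) by apply: E.
elim: M x m {sM} => [|r M IH] [|a x] m /= sM; rewrite ?toRow0.
- by rewrite big1 // => i _; rewrite !nth_nil scale0r.
- by rewrite big1 // => i _; rewrite nth_nil toRow0 scaler0.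
- by rewrite big1 // => i _; rewrite nth_nil scale0r.
case: m sM => // m sM.
by rewrite big_ord_recl toRowD toRowZ (IH x m).
Qed.

End Rows.

Section Rank.

Lemma spn_map n m (A : 'M[R]_(n, m)) (s : seq 'rV[R]_n) :
  (spn [seq u *m A | u <- s] :=: spn s *m A)%MS.
Proof.
apply/eqmxP/andP; split.
  by apply/spn_subP => v /mapP[u us ->]; rewrite submxMr // mem_spn.
rewrite /spn; elim: s => [|u s IH]; first by rewrite big_nil mul0mx sub0mx.
rewrite /= !big_cons addsmxMr; apply: addsmxS => //.
by rewrite (eqmxMr A (genmxE u)) genmxE.
Qed.

Lemma rk_map n m (A : 'M[R]_(n, m)) (s : seq 'rV[R]_n) : row_free A ->
  rk [seq u *m A | u <- s] = rk s.
Proof. by move=> fA; rewrite /rk spn_map mxrankMfree. Qed.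

Let emb m : 'M[R]_(m, 1 + m) := row_mx 0 1%:M.

Lemma emb_free m : row_free (emb m).
Proof.
apply/row_freeP; exists (col_mx 0 1%:M).
by rewrite mul_row_col mulmx0 add0r mulmx1.
Qed.

Lemma toRow_emb m x : nth 0%Z x 0 = 0%Z -> toRow (1 + m) x = toRow m (behead x) *m emb m.
Proof.
move=> x0; rewrite mul_mx_row mulmx0 mulmx1; apply/rowP => i; rewrite mxE.
case: (split_ordP i) => j ->.
  by rewrite row_mxEl !mxE ord1 /= x0.
by rewrite row_mxEr !mxE nth_behead.
Qed.

(** The span is the sum of the pivot and of the eliminated rows, put back with first coordinate 0 by
    [emb]; the nonzero first entry of the pivot makes the sum direct. *)
Lemma zrankE m (s : seq vec) : zrank m s = rk [seq toRow m x | x <- s].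
Proof.
elim: m s => [|m IH] s /=.
  by apply/esym/eqP; rewrite -leqn0 rank_leq_col.
have headP : match zhead s with
    | Some p => p \in s /\ nth 0%Z p 0 != 0%Z
    | None => {in s, forall x, nth 0%Z x 0 = 0%Z} end.
  elim: s => [|x s IHs] //=; case: x => [|a x] /=.
    case: (zhead s) IHs => [p [ps p0]|H]; first by rewrite inE ps orbT.
    by move=> x; rewrite inE => /predU1P[->//|/H].
  case: Z.eqb_spec => [->|a0]; last by rewrite mem_head; split => //; apply/eqP.
  case: (zhead s) IHs => [p [ps p0]|H]; first by rewrite inE ps orbT.
  by move=> y; rewrite inE => /predU1P[->//|/H].
case: (zhead s) headP => [[|a r] [ps p0]|H].
- by rewrite nth_nil in p0.
- rewrite IH /= in p0 *; set s' := [seq zelim a r x | x <- s].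
  set P := toRow (1 + m) (a :: r) in ps *.
  have a0 : zr a != 0 by rewrite zr_eq0; apply/Z.eqb_spec/eqP.
  have elimE x : exists q t : R, q != 0 /\
      q *: toRow (1 + m) x = toRow m (zelim a r x) *m emb m + t *: P.
    case: x => [|b x] /=.
      by exists 1, 0; rewrite oner_eq0 scale1r scale0r addr0 !toRow0 mul0mx.
    case: Z.eqb_spec => [->|b0].
      by exists 1, 0; rewrite oner_eq0 scale1r scale0r addr0 toRow_emb.
    exists (zr a), (zr b); split => //.
    rewrite -[toRow m _]/(toRow m (behead (0%Z :: vadd (vscale a x) (vscale (- b) r)))).
    rewrite -toRow_emb //; apply/rowP => i; rewrite !mxE.
    case: (nat_of_ord i) => [|j] /=; first by rewrite zr0 add0r mulrC.
    by rewrite nth_vadd !nth_vscale zrD !zrM zrN mulNr subrK.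
  set E := [seq toRow m x *m emb m | x <- s'].
  have EE x : x \in s -> toRow m (zelim a r x) *m emb m \in E.
    by move=> xs; apply/map_f/map_f.
  have spE : (spn [seq toRow (1 + m) x | x <- s] :=: P + spn E)%MS.
    apply/eqmxP/andP; split.
      apply/spn_subP => _ /mapP[x xs ->]; have [q [t [q0 qE]]] := elimE x.
      rewrite -[toRow _ x](scalerK q0) qE scalemx_sub // addrC addmx_sub_adds ?scalemx_sub //.
      by rewrite mem_spn // EE.
    rewrite addsmx_sub mem_spn ?map_f //=; apply/spn_subP => _ /mapP[_ /mapP[x xs ->] ->].
    have [q [t [q0 qE]]] := elimE x.
    rewrite -[X in (X <= _)%MS](addrK (t *: P)) -qE addmx_sub ?eqmx_opp ?scalemx_sub //;
      by rewrite mem_spn // map_f.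
  have P0 : P != 0.
    apply: contra a0 => /eqP/rowP/(_ ord0); rewrite !mxE /= => ->; exact: eqxx.
  have rkE : rk E = rk [seq toRow m x | x <- s'].
    by rewrite -(rk_map [seq toRow m x | x <- s'] (emb_free m)) -map_comp.
  rewrite /rk spE mxrank_disjoint_sum.
    by rewrite rank_rV P0; exact: (congr1 succn (esym rkE)).
  apply/eqP; rewrite -submx0; apply/rV_subP => z; rewrite sub_capmx => /andP[/sub_rVP[q ->]].
  have H : (spn E <= emb m)%MS.
    by apply/spn_subP => _ /mapP[x _ ->]; rewrite submxMl.
  move=> /submx_trans/(_ H)/submxP[D /rowP/(_ (lshift m ord0))].
  rewrite mul_mx_row mulmx0 mulmx1 row_mxEl !mxE /= => /eqP.
  by rewrite mulf_eq0 (negPf a0) orbF => /eqP ->; rewrite scale0r sub0mx.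
rewrite IH -(rk_map _ (emb_free m)) -map_comp -map_comp; congr rk.
by apply/eq_in_map => x xs /=; rewrite toRow_emb //; exact: H.
Qed.
End Rank.
End Embed.

Lemma in_keyE w k z :
  in_key w k z = (zdot (hmul w (kr k)) z =? kK k)%Z && (zdot (hmul w (ks k)) z <=? 0)%Z.
Proof. by rewrite /in_key; case: ifP. Qed.

Lemma mem_maskP (m : bitseq) (W : seq vec) z : size m = size W ->
  z \in mask m W <-> exists i, [/\ (i < size W)%N, nth false m i & z = nth [::] W i].
Proof.
elim: m W => [|b m IH] [|x W] //= => [_|[/IH{}IH]]; first by split=> // -[i []].
split.
  case: b => [|/IH[i [? ? ?]]]; last by exists i.+1.
  by rewrite inE => /predU1P[->|/IH[i [? ? ?]]]; [exists 0%N | exists i.+1].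
move=> [[|i] /= [iW mi zE]]; first by rewrite mi zE mem_head.
have : z \in mask m W by apply/IH; exists i.
by case: b => //; rewrite inE => ->; rewrite orbT.
Qed.

Lemma mask_inb (m m' : bitseq) (W : seq vec) : size m = size W -> size m' = size W ->
  inb m (nth false m') -> {subset mask m W <= mask m' W}.
Proof.
move=> sm sm' mm' z /(mem_maskP _ sm)[i [iW mi ->]].
by apply/(mem_maskP _ sm'); exists i; split => //; apply: mm'.
Qed.

Section Phi.
Context {R : realType}.
Variables (n : nat) (w : vec) (N : Z) (V : seq vec).
Hypothesis sw : size w = n.
Hypothesis w0 : all (fun a => 0 <? a)%Z w.
Hypothesis N0 : (0 <? N)%Z.
Hypothesis VN : all (fun z => (size z == n) && (zdot (hmul w z) z =? N)%Z) V.

Notation zr := (@zr R).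
Definition wdot x y : Z := zdot (hmul w x) y.

(* The rows of [Phi] are orthogonal, so [phi] maps the form with weights [w] to N times the scalar
   product and [V] to unit vectors. *)
Definition adm (Phi : 'M[R]_n) := Phi *m Phi^T = (zr N)^-1 *: diag_mx (toRow n w).

Lemma zN_gt0 : 0 < zr N.
Proof. by rewrite -zr0 zr_lt. Qed.

Lemma zN_neq0 : zr N != 0.
Proof. by rewrite gt_eqF // zN_gt0. Qed.

Lemma Vsize z : z \in V -> size z = n.
Proof. by move/(allP VN) => /andP[/eqP]. Qed.

Section OnePhi.
Variable Phi : 'M[R]_n.
Hypothesis aPhi : adm Phi.

Definition phi x : 'rV[R]_n := toRow n x *m Phi.

Lemma phiE x : phi x = toRow n x *m Phi. Proof. by []. Qed.

Lemma dot_phi x y : dot (phi x) (phi y) = zr (wdot x y) / zr N.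
Proof.
rewrite /dot /phi trmx_mul mulmxA -(mulmxA (toRow n x)) aPhi -scalemxAr -scalemxAl mxE mulrC.
congr (_ / _); rewrite /wdot (@zdotE _ n) ?size_hmul ?sw ?geq_minl // mxE.
apply: eq_bigr => i _; rewrite !mxE nth_hmul zrM (bigD1 i) //= !mxE eqxx mulr1n big1.
  by rewrite addr0 mulrAC mulrC mulrA [X in X * _]mulrC.
by move=> j ji; rewrite !mxE (negPf ji) mulr0n mulr0.
Qed.

Lemma Phi_free : row_free Phi.
Proof.
pose D : 'M[R]_n := diag_mx (\row_i (zr (nth 0%Z w i))^-1).
apply/row_freeP; exists (Phi^T *m (zr N *: D)).
rewrite mulmxA aPhi -scalemxAl -scalemxAr scalerA mulVf ?zN_neq0 // scale1r.
rewrite mulmx_diag; apply/matrixP => i j; rewrite !mxE.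
case: eqVneq => [->|//]; rewrite mulfV //.
rewrite gt_eqF // -zr0 zr_lt; apply: (allP w0).
by rewrite mem_nth // sw.
Qed.

Lemma rk_phi s : rk [seq phi x | x <- s] = zrank n s.
Proof. by rewrite (@zrankE R) -(rk_map [seq toRow n x | x <- s] Phi_free) -map_comp. Qed.

Lemma phi_inj x y : size x = n -> size y = n -> phi x = phi y -> x = y.
Proof. by move=> sx sy /(row_free_inj Phi_free) /toRow_inj; apply. Qed.

Lemma phiD x y : phi (vadd x y) = phi x + phi y.
Proof. by rewrite /phi toRowD mulmxDl. Qed.

Lemma phiZ a x : phi (vscale a x) = zr a *: phi x.
Proof. by rewrite /phi toRowZ scalemxAl. Qed.

Lemma phi_sphere W : {subset W <= V} -> on_sphere [seq phi z | z <- W].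
Proof.
move=> WV _ /mapP[z /WV zV ->]; rewrite dot_phi.
by have /andP[_ /Z.eqb_spec] := allP VN z zV; rewrite /wdot => ->; rewrite divff // zN_neq0.
Qed.

Lemma phi_mem z W : z \in V -> {subset W <= V} -> phi z \in [seq phi x | x <- W] -> z \in W.
Proof.
by move=> zV WV /mapP[x xW /phi_inj E]; rewrite E // ?Vsize // WV.
Qed.

Definition pcv (W : seq vec) := cv [seq phi z | z <- W].

Lemma pcvE W : pcv W = cv [seq phi z | z <- W]. Proof. by []. Qed.

Lemma eq_pcv W W' : W =i W' -> pcv W = pcv W'.
Proof. by move=> E; apply/eq_cv/eq_mem_map. Qed.

Lemma pcv_sub W W' : {subset W <= V} -> {subset W' <= V} -> pcv W `<=` pcv W' -> {subset W <= W'}.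
Proof.
move=> WV W'V H z zW; apply: phi_mem => //; first exact: WV.
apply: (cv_sub_sphere (phi_sphere WV) (phi_sphere W'V) H); exact: map_f.
Qed.

Lemma face_subset (F G : set 'rV[R]_n) : face F G -> G `<=` F.
Proof. by move=> [c [b [_ ->]]]; apply: subIsetl. Qed.

Lemma pface_sub W W' : {subset W <= V} -> {subset W' <= V} ->
  face (pcv W') (pcv W) -> {subset W <= W'}.
Proof. by move=> WV W'V /face_subset; apply: pcv_sub. Qed.

Definition valid (c : 'rV[R]_n) b (W : seq vec) := {in W, forall z, dot c (phi z) <= b}.
Definition tset (c : 'rV[R]_n) b (W : seq vec) := [seq z <- W | dot c (phi z) == b].

Lemma pface W F : face (pcv W) F <-> exists c b, valid c b W /\ F = pcv (tset c b W).
Proof.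
split=> [/face_cv[c [b [H ->]]]|[c [b [H ->]]]].
  exists c, b; split; first by move=> z zW; apply: H; apply: map_f.
  by rewrite /tight filter_map.
apply/face_cv; exists c, b; split; first by move=> _ /mapP[z zW ->]; apply: H.
by rewrite /tight filter_map.
Qed.

Lemma tset_sub c b W : {subset tset c b W <= W}.
Proof. by move=> z; rewrite mem_filter => /andP[]. Qed.

Lemma pface_by W G (h : 'rV[R]_n) (b : R) : valid h b W -> G =i tset h b W -> face (pcv W) (pcv G).
Proof. by move=> H /eq_pcv ->; apply/pface; exists h, b. Qed.

(** The ranks force equal spans; K0 c - b c0 vanishes on the tight points, hence on [M]. This turns
    the containments found by the searches into equalities. *)
Lemma tight_max (W M : seq vec) c b c0 K0 : K0 != 0 -> {in W, forall z, dot c0 (phi z) = K0} ->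
  {subset M <= W} -> {subset tset c b W <= M} ->
  (zrank n M <= zrank n (tset c b W))%N -> M =i tset c b W.
Proof.
move=> K00 H MW TM rM z; apply/idP/idP; last exact: TM.
move=> zM; rewrite mem_filter (MW z zM) andbT; apply/eqP.
set T := tset c b W in TM rM.
have sub : (spn [seq phi x | x <- T] <= spn [seq phi x | x <- M])%MS.
  by apply: spnS => _ /mapP[x xT ->]; apply/map_f/TM.
have eqs : (spn [seq phi x | x <- M] <= spn [seq phi x | x <- T])%MS.
  by rewrite -(geq_leqif (mxrank_leqif_sup sub)) -!/(rk _) !rk_phi.
have van : dot (K0 *: c - b *: c0) (phi z) = 0.
  apply: (dot_spn0 _ (submx_trans (mem_spn (map_f phi zM)) eqs)) => _ /mapP[x xT ->].
  have xW : x \in W by apply: tset_sub xT.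
  move: xT; rewrite mem_filter => /andP[/eqP cx _].
  by rewrite dotBl !dotZl cx H // mulrC subrr.
apply: (mulfI K00); move/eqP: van; rewrite dotBl !dotZl H ?MW // subr_eq0 => /eqP ->.
exact: mulrC.
Qed.

Lemma dot_phi_eq r z K : (dot (phi r) (phi z) == zr K / zr N) = (wdot r z =? K)%Z.
Proof. by rewrite dot_phi (inj_eq (divIf zN_neq0)) zr_eq. Qed.

Lemma dot_phi_le r z K : (dot (phi r) (phi z) <= zr K / zr N) = (wdot r z <=? K)%Z.
Proof. by rewrite dot_phi ler_pM2r ?invr_gt0 ?zN_gt0 // zr_le. Qed.

Lemma dot_phi_ge r z K : (zr K / zr N <= dot (phi r) (phi z)) = (K <=? wdot r z)%Z.
Proof. by rewrite dot_phi ler_pM2r ?invr_gt0 ?zN_gt0 // zr_le. Qed.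

Lemma dot_phi_half x y : (dot (phi x) (phi y) == 2^-1) = (2 * wdot x y =? N)%Z.
Proof.
rewrite dot_phi -(inj_eq (mulIf zN_neq0)) divfK ?zN_neq0 // -(@zr_eq R) zrM.
have -> : zr 2 = 2 by [].
by apply/eqP/eqP; lra.
Qed.

Lemma verts_level k : {in verts w V k, forall z, dot (phi (kr k)) (phi z) = zr (kK k) / zr N}.
Proof.
by move=> z; rewrite mem_filter in_keyE => /andP[/andP[H _] _]; apply/eqP; rewrite dot_phi_eq.
Qed.

Lemma verts_sub k : {subset verts w V k <= V}.
Proof. by move=> z; rewrite mem_filter => /andP[]. Qed.

Lemma supportsP k W G : supports w k W G ->
  G = [seq z <- W | (wdot (kr k) z =? kK k)%Z] /\ face (pcv W) (pcv G).
Proof.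
rewrite /supports => /andP[side /lseqP GE].
have {}GE : G = [seq z <- W | (wdot (kr k) z =? kK k)%Z].
  rewrite -GE filter_map -map_comp map_id_in //.
  by apply: eq_filter => z /=; rewrite /wdot; lia.
split => //; case/orP: side => /allP side.
  apply: (@pface_by _ _ (phi (kr k)) (zr (kK k) / zr N)) => [z zW|z].
    have /= := side _ (map_f (fun z => (z, (zdot (hmul w (kr k)) z - kK k)%Z)) zW).
    by rewrite dot_phi_le /wdot; lia.
  by rewrite GE !mem_filter dot_phi_eq.
apply: (@pface_by _ _ (- phi (kr k)) (- (zr (kK k) / zr N))) => [z zW|z].
  have /= := side _ (map_f (fun z => (z, (zdot (hmul w (kr k)) z - kK k)%Z)) zW).
  by rewrite dotNl lerN2 dot_phi_ge /wdot; lia.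
by rewrite GE !mem_filter dotNl eqr_opp dot_phi_eq.
Qed.

(** The closure rule: z and x + y - z have values at most b and the sum of these is 2 b. *)
Lemma relrow_tight W c b x y z : valid c b W -> x \in tset c b W -> y \in tset c b W ->
  z \in W -> vmem (vadd (vadd x y) (vscale (-1) z)) W -> z \in tset c b W.
Proof.
move=> H; rewrite !mem_filter => /andP[/eqP cx xW] /andP[/eqP cy yW] zW; rewrite vmemP => z'W.
rewrite zW andbT; apply/eqP.
have := H _ zW; have := H _ z'W; rewrite !phiD phiZ !dotDr dotZr cx cy -[zr (-1)]/(-1); lra.
Qed.

Lemma nth_reltab W i j k : nth false (nth [::] (nth [::] (reltab w N W) i) j) k ->
  [/\ (i < size W)%N, (j < size W)%N & (k < size W)%N] /\
  vmem (vadd (vadd (nth [::] W i) (nth [::] W j)) (vscale (-1) (nth [::] W k))) W.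
Proof.
have [iW|iW] := ltnP i (size W); last first.
  by rewrite [nth _ (reltab _ _ _) i]nth_default ?size_map // !nth_nil.
rewrite /reltab (nth_map [::]) // /relrow.
have [jW|jW] := ltnP j (size W); last first.
  by rewrite [nth [::] _ j]nth_default ?size_map // !nth_nil.
rewrite (nth_map [::]) //; case: ifP => _; first by rewrite nth_nil.
have [kW|kW] := ltnP k (size W); last by rewrite nth_default ?size_map.
by rewrite (nth_map [::]).
Qed.

Definition tbits c b W : bitseq := [seq dot c (phi z) == b | z <- W].

Lemma tbitsE c b W i : nth false (tbits c b W) i -> (i < size W)%N /\ nth [::] W i \in tset c b W.
Proof.
have [iW|iW] := ltnP i (size W); last by rewrite nth_default ?size_map.
by rewrite (nth_map [::]) // mem_filter mem_nth // andbT.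
Qed.

Lemma tab_closed W c b i j k : valid c b W -> nth false (tbits c b W) i ->
  nth false (tbits c b W) j ->
  nth false (nth [::] (nth [::] (reltab w N W) i) j) k -> nth false (tbits c b W) k.
Proof.
move=> H /tbitsE[iW Ti] /tbitsE[jW Tj] /nth_reltab[[_ _ kW] rel].
have := relrow_tight H Ti Tj (mem_nth [::] kW) rel.
by rewrite mem_filter => /andP[ck _]; rewrite (nth_map [::]).
Qed.

Lemma tset_mask c b W t : size t = size W ->
  (forall i, nth false (tbits c b W) i -> nth false t i) -> {subset tset c b W <= mask t W}.
Proof.
move=> st H z; rewrite mem_filter => /andP[cz /(nthP [::])[i iW zE]].
apply/(mem_maskP _ st); exists i; split => //; apply: H.
by rewrite (nth_map [::]) // zE.
Qed.

Lemma mask_tset c b W t : size t = size W -> inb t (nth false (tbits c b W)) ->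
  {subset mask t W <= tset c b W}.
Proof.
by move=> st H z /(mem_maskP _ st)[i [iW ti ->]]; have [_] := tbitsE (H i ti).
Qed.

End OnePhi.
End Phi.

(** * The cycle of facets around a peak *)

Lemma filter_inj (T : eqType) (V A B : seq T) (p q : pred T) :
  A = [seq z <- V | p z] -> B = [seq z <- V | q z] -> A =i B -> A = B.
Proof.
move=> -> -> E; apply: eq_in_filter => z zV.
by have := E z; rewrite !mem_filter zV !andbT.
Qed.

Lemma all_diffP (l : seq (seq vec)) : all_diff l -> uniq l.
Proof.
elim: l => //= x l IH /andP[nx /IH ->]; rewrite andbT.
by apply: contra nx => xl; apply/hasP; exists x => //; apply/lseqP.
Qed.

Lemma chain_sub fuel (s : sec) (rest : seq sec) : s \in rest -> {subset chain fuel s rest <= rest}.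
Proof.
elim: fuel s => [|f IH] s sr // t; rewrite [chain _ _ _]/=.
case E: [seq _ <- rest | _] => [|u nx]; first by rewrite inE => /eqP ->.
rewrite inE => /predU1P[->//|]; apply: IH.
by have := mem_head u nx; rewrite -E mem_filter => /andP[].
Qed.

Lemma cyc_okP G s0 s l d i : cyc_ok G s0 s l -> (i < size (s :: l))%N ->
  sector_ok G (nth d (s :: l) i) (nth d (rcons l s0) i) /\
  ((i < size l)%N -> (cr s0.2 (nth d (s :: l) i).2 <? 0)%Z -> (cr s0.2 (nth d l i).2 <? 0)%Z).
Proof.
elim: l s i => [|t l IH] s i /=; first by case: i => // -> .
move=> /and3P[ok /implyP low H]; case: i => [|i] il; first by split.
exact: (IH t i H il).
Qed.

Lemma first_ray_mem Q : first_ray Q = ([::], (0, 0)%Z) \/ first_ray Q \in Q.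
Proof.
rewrite /first_ray; case E : [seq _ <- Q | _] => [|q Q']; first by left.
right; have sub z : z \in q :: Q' -> z \in Q by rewrite -E mem_filter => /andP[].
apply: sub; elim: Q' q {E} => [|t Q' IH] q /=; first exact: mem_head.
by case: ifP => _; have := IH (if true then q else t); have := IH t;
   rewrite !inE => A B; [move: A | move: B] => /orP[/eqP->|->]; rewrite ?eqxx ?orbT.
Qed.

Lemma proj2d_fst cu cv' W : [seq p.1 | p <- proj2d cu cv' W] = W.
Proof. by rewrite /proj2d -map_comp map_id_in. Qed.

Lemma proj2d_filter cu cv' W (P : pred pt2) :
  [seq p.1 | p <- proj2d cu cv' W & P p] = [seq z <- W | P (z, (zdot cu z, zdot cv' z))].
Proof. by elim: W => //= z W IH; case: ifP => _ /=; rewrite IH. Qed.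

(** Cramer's rule: a plane vector whose determinants with two independent vectors vanish is 0. *)
Lemma det2_eq0 (a b c d e f : Z) : (0 <? a * d - b * c)%Z ->
  ((e =? 0) && (f =? 0))%Z = ((e * d - f * c =? 0) && (a * f - b * e =? 0))%Z.
Proof.
move=> H; apply/andP/andP => -[/Z.eqb_eq A /Z.eqb_eq B].
  by rewrite A B; split; apply/Z.eqb_eq; lia.
have He : (e * (a * d - b * c) = 0)%Z.
  have -> : (e * (a * d - b * c) = a * (e * d - f * c) + c * (a * f - b * e))%Z by lia.
  by rewrite A B; lia.
have Hf : (f * (a * d - b * c) = 0)%Z.
  have -> : (f * (a * d - b * c) = b * (e * d - f * c) + d * (a * f - b * e))%Z by lia.
  by rewrite A B; lia.
by split; apply/Z.eqb_eq; nia.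
Qed.

Section Peak.
Context {R : realType}.
Variables (n : nat) (w : vec) (N : Z) (V : seq vec).
Hypothesis sw : size w = n.
Hypothesis w0 : all (fun a => 0 <? a)%Z w.
Hypothesis N0 : (0 <? N)%Z.
Hypothesis VN : all (fun z => (size z == n) && (zdot (hmul w z) z =? N)%Z) V.
Hypothesis n3 : (2 < n)%N.
Variable L : seq key.
Hypothesis FR : {in L, forall k, zrank n (verts w V k) = n /\ (0 <? kK k)%Z}.
Variable Phi : 'M[R]_n.
Hypothesis aPhi : adm w N Phi.

Notation zr := (@zr R).
Notation phi := (phi Phi).
Notation pcv := (pcv Phi).

Definition PP : set (set 'rV[R]_n) := [set F | exists2 k, k \in L & F = pcv (verts w V k)].

Lemma kK_neq0 k : k \in L -> zr (kK k) / zr N != 0.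
Proof.
move=> /FR[_ K0]; rewrite mulf_neq0 ?invr_neq0 ?(zN_neq0 N0) // gt_eqF //.
by rewrite -zr0 zr_lt.
Qed.

Lemma has_dim_verts k W d : k \in L -> {subset W <= verts w V k} ->
  has_dim d (pcv W) <-> zrank n W = d.+1.
Proof.
move=> kL WV; rewrite -(rk_phi sw w0 N0 aPhi).
apply: (has_dim_cv _ (kK_neq0 kL)) => _ /mapP[z /WV zV ->]; exact: (verts_level sw N0 aPhi zV).
Qed.

Section Data.
Variables (fs : seq (key * seq vec)) (G : seq vec).
Hypothesis fsL : {in fs, forall f, f.1 \in L /\ f.2 = verts w V f.1}.
Hypothesis fsG : {in L, forall k, {subset G <= verts w V k} -> (k, verts w V k) \in fs}.
Hypothesis rG : zrank n G = (n - 2)%N.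

Section Cyc.
Variables (u v : vec).
Let cu := hmul w u.
Let cv' := hmul w v.
Let ss : seq sec := [seq let Q := proj2d cu cv' f.2 in (Q, first_ray Q) | f <- fs].
Variables (s0 : sec) (l : seq sec).
Hypothesis lss : {subset s0 :: l <= ss}.
Hypothesis sl : size (s0 :: l) = size fs.
Hypothesis cok : cyc_ok G s0 s0 l.
Hypothesis dF : uniq [seq [seq p.1 | p <- s.1] | s <- s0 :: l].
Hypothesis dR : uniq [seq [seq p.1 | p <- s.1 & (cr s.2 p =? 0)%Z] | s <- s0 :: l].

Let k := size (s0 :: l).
(** The default [s0] makes the index k wrap around to 0. *)
Let S i := nth s0 (s0 :: l) i.
Let Wi i := [seq p.1 | p <- (S i).1].
Let Ri i := [seq p.1 | p <- (S i).1 & (cr (S i).2 p =? 0)%Z].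
Let x i := phi (S i).2.1.
Let good (p : pt2) := p = (p.1, (zdot cu p.1, zdot cv' p.1)).

Let Sk : S k = S 0. Proof. by rewrite /S nth_default. Qed.

Let S_ss i : S i \in ss.
Proof.
have [ik|ki] := ltnP i k; first by apply: lss; apply: mem_nth.
by rewrite /S nth_default //; apply: lss; rewrite mem_head.
Qed.

Let S_fs i : exists2 f, f \in fs & (S i).1 = proj2d cu cv' f.2 /\ Wi i = verts w V f.1.
Proof.
have /mapP[f ff E] := S_ss i; exists f => //; rewrite /Wi E /=; split => //.
by rewrite proj2d_fst; have [_ ->] := fsL ff.
Qed.

Let S_good i : {in (S i).1, forall p, good p}.
Proof. by have [f _ [-> _]] := S_fs i => p /mapP[z _ ->]. Qed.

Let ok i : (i < k)%N -> sector_ok G (S i) (S i.+1).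
Proof.
move=> ik; have [H _] := cyc_okP s0 cok ik; move: H; rewrite -/(S i).
suff -> : nth s0 (rcons l s0) i = S i.+1 by [].
rewrite /S /= nth_rcons; case: ltngtP => // [lt|->]; last by rewrite nth_default.
by rewrite nth_default // ltnW.
Qed.

Let ray i : (i < k)%N -> (S i).2 \in (S i).1.
Proof.
move=> ik; have /mapP[f ff E] := S_ss i; rewrite E /=.
case: (first_ray_mem (proj2d cu cv' f.2)) => // E0.
by have /and5P[] := ok ik; rewrite E /= E0 /cr /=.
Qed.

Let k0 : (0 < k)%N. Proof. by []. Qed.

Let ray' i : (i <= k)%N -> (S i).2 \in (S i).1.
Proof. by rewrite leq_eqVlt => /predU1P[->|/ray//]; rewrite Sk ray. Qed.

Let dotU z : dot (phi u) (phi z) = zr (zdot cu z) / zr N.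
Proof. exact: dot_phi. Qed.
Let dotV z : dot (phi v) (phi z) = zr (zdot cv' z) / zr N.
Proof. exact: dot_phi. Qed.

Let cr_z (y z : vec) : Z := (zdot cu y * zdot cv' z - zdot cv' y * zdot cu z)%Z.

Let crE p q : good p -> good q -> cr p q = cr_z p.1 q.1.
Proof. by rewrite /cr => -> ->. Qed.

Let crossE y z : cross (phi u) (phi v) (phi y) (phi z) = zr (cr_z y z) / zr N ^+ 2.
Proof.
rewrite /cross !dotU !dotV /cr_z zrB !zrM; field.
exact: (zN_neq0 N0).
Qed.

Let N2 : 0 < (zr N ^+ 2)^-1.
Proof. by rewrite invr_gt0 exprn_gt0 // (zN_gt0 N0). Qed.

Let cross_lt y z : (0 < cross (phi u) (phi v) (phi y) (phi z)) = (0 <? cr_z y z)%Z.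
Proof. by rewrite crossE pmulr_lgt0 // -zr0 zr_lt. Qed.
Let cross_le y z : (0 <= cross (phi u) (phi v) (phi y) (phi z)) = (0 <=? cr_z y z)%Z.
Proof. by rewrite crossE pmulr_lge0 // -zr0 zr_le. Qed.
Let cross_gt y z : (cross (phi u) (phi v) (phi y) (phi z) < 0) = (cr_z y z <? 0)%Z.
Proof. by rewrite crossE pmulr_llt0 // -zr0 zr_lt. Qed.

Let Gi i : (i < k)%N -> G = [seq z <- Wi i | (zdot cu z =? 0)%Z && (zdot cv' z =? 0)%Z].
Proof.
move=> ik; have /and5P[_ _ /lseqP <- _ _] := ok ik.
have [f ff [E _]] := S_fs i; rewrite /Wi E proj2d_fst proj2d_filter.
by apply: eq_filter => z; rewrite /is0 /=; case: ifP.
Qed.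

Let RiE i : (i < k)%N -> Ri i = [seq z <- Wi i | (cr_z (S i).2.1 z =? 0)%Z].
Proof.
move=> ik; have [f ff [E _]] := S_fs i; have g := S_good (ray ik).
rewrite /Ri /Wi [in LHS]E [in RHS]E proj2d_fst proj2d_filter.
by apply: eq_filter => z; rewrite crE.
Qed.

Let RiE' i : (i < k)%N -> Ri i.+1 = [seq z <- Wi i | (cr_z z (S i.+1).2.1 =? 0)%Z].
Proof.
move=> ik; have /and5P[_ _ _ _ /lseqP E'] := ok ik; rewrite /Ri -E'.
have [f ff [E _]] := S_fs i; have g := S_good (ray' ik).
rewrite /Wi [in LHS]E [in RHS]E proj2d_fst proj2d_filter.
by apply: eq_filter => z; rewrite crE.
Qed.

Let posi i : (i < k)%N -> (0 <? cr_z (S i).2.1 (S i.+1).2.1)%Z.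
Proof.
by move=> ik; have /and5P[H _ _ _ _] := ok ik; rewrite -(crE (S_good (ray ik)) (S_good (ray' ik))).
Qed.

Let wz i z : (i < k)%N -> z \in Wi i ->
  (0 <=? cr_z (S i).2.1 z)%Z /\ (0 <=? cr_z z (S i.+1).2.1)%Z.
Proof.
move=> ik /mapP[p pS ->]; have /and5P[_ /allP/(_ p pS)/andP[A B] _ _ _] := ok ik.
have gp := S_good pS; have g := S_good (ray ik); have g' := S_good (ray' ik).
by rewrite -!crE.
Qed.

Let xW i : (i < k)%N -> (S i).2.1 \in Wi i.
Proof. by move=> ik; apply/map_f/ray. Qed.

Let xW' i : (i < k)%N -> (S i.+1).2.1 \in Wi i.
Proof.
move=> ik; have : (S i.+1).2.1 \in Ri i.+1.
  by rewrite /Ri; apply: map_f; rewrite mem_filter ray' // andbT /cr; apply/Z.eqb_eq; lia.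
by rewrite RiE' // mem_filter => /andP[].
Qed.

Let F i := [seq phi z | z <- Wi i].

Let gU : {in [seq phi z | z <- G], forall z, dot (phi u) z = 0}.
Proof.
move=> _ /mapP[z zG ->]; move: zG; rewrite (Gi k0) mem_filter => /andP[/andP[/Z.eqb_eq E _] _].
by rewrite dotU E zr0 mul0r.
Qed.
Let gV : {in [seq phi z | z <- G], forall z, dot (phi v) z = 0}.
Proof.
move=> _ /mapP[z zG ->]; move: zG; rewrite (Gi k0) mem_filter => /andP[/andP[_ /Z.eqb_eq E] _].
by rewrite dotV E zr0 mul0r.
Qed.

Let c_xk : x k = x 0%N. Proof. by rewrite /x Sk. Qed.
Let c_xF i : (i < k)%N -> x i \in F i /\ x i.+1 \in F i.
Proof. by move=> ik; split; apply: map_f; [apply: xW | apply: xW']. Qed.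
Let c_xx i : (i < k)%N -> 0 < cross (phi u) (phi v) (x i) (x i.+1).
Proof. by move=> ik; rewrite cross_lt posi. Qed.
Let c_xz i : (i < k)%N -> {in F i, forall z, 0 <= cross (phi u) (phi v) (x i) z}.
Proof. by move=> ik _ /mapP[z zW ->]; rewrite cross_le; have [] := wz ik zW. Qed.
Let c_zx i : (i < k)%N -> {in F i, forall z, 0 <= cross (phi u) (phi v) z (x i.+1)}.
Proof. by move=> ik _ /mapP[z zW ->]; rewrite cross_le; have [] := wz ik zW. Qed.
Let c_low i : (i.+1 < k)%N -> cross (phi u) (phi v) (x 0%N) (x i) < 0 ->
  cross (phi u) (phi v) (x 0%N) (x i.+1) < 0.
Proof.
move=> ik; rewrite !cross_gt.
have [_ low] := cyc_okP s0 cok (ltnW ik).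
have g0 := S_good (ray k0); have gi := S_good (ray (ltnW ik)); have gi' := S_good (ray ik).
rewrite -!crE // => H; exact: low.
Qed.

Let angles : angles_sum_2pi (pcv G) (fun i : 'I_k => pcv (Wi i)).
Proof. exact: (cycle_angles k0 c_xk gU gV c_xF c_xx c_xz c_zx c_low). Qed.

Let winds : winds_once (pcv G) (fun i : 'I_k => pcv (Wi i)).
Proof. exact: (cycle_winds k0 c_xk gU gV c_xF c_xx c_xz c_zx c_low). Qed.

Let WiL i : exists2 f, f \in L & Wi i = verts w V f.
Proof. by have [f ff [_ ->]] := S_fs i; exists f.1 => //; have [] := fsL ff. Qed.

Let WiV i : {subset Wi i <= V}.
Proof. by have [f _ ->] := WiL i; apply: verts_sub. Qed.

Let face_R i : (i < k)%N -> face (pcv (Wi i)) (pcv (Ri i)).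
Proof.
move=> ik; pose h := dot (phi v) (x i) *: phi u - dot (phi u) (x i) *: phi v.
have hE z : dot h (phi z) = - cross (phi u) (phi v) (x i) (phi z).
  by rewrite dotBl !dotZl /cross; ring.
apply: (@pface_by _ _ _ _ _ h 0) => [z zW|z].
  by rewrite hE oppr_le0 cross_le; have [] := wz ik zW.
by rewrite RiE // !mem_filter hE oppr_eq0 crossE mulf_eq0 (gt_eqF N2) orbF zr_eq0.
Qed.

Let face_R' i : (i < k)%N -> face (pcv (Wi i)) (pcv (Ri i.+1)).
Proof.
move=> ik; pose h := dot (phi u) (x i.+1) *: phi v - dot (phi v) (x i.+1) *: phi u.
have hE z : dot h (phi z) = - cross (phi u) (phi v) (phi z) (x i.+1).
  by rewrite dotBl !dotZl /cross; ring.
apply: (@pface_by _ _ _ _ _ h 0) => [z zW|z].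
  by rewrite hE oppr_le0 cross_le; have [] := wz ik zW.
by rewrite RiE' // !mem_filter hE oppr_eq0 crossE mulf_eq0 (gt_eqF N2) orbF zr_eq0.
Qed.

Let RiW i : (i < k)%N -> {subset Ri i <= Wi i}.
Proof. by move=> ik z; rewrite RiE // mem_filter => /andP[]. Qed.

Let face_G i : (i < k)%N -> face (pcv (Ri i)) (pcv G).
Proof.
move=> ik; pose h := dot (phi u) (x i.+1) *: phi v - dot (phi v) (x i.+1) *: phi u.
have hE z : dot h (phi z) = - cross (phi u) (phi v) (phi z) (x i.+1).
  by rewrite dotBl !dotZl /cross; ring.
apply: (@pface_by _ _ _ _ _ h 0) => [z /(RiW ik) zW|z].
  by rewrite hE oppr_le0 cross_le; have [] := wz ik zW.
rewrite (Gi ik) RiE // !mem_filter hE oppr_eq0 crossE mulf_eq0 (gt_eqF N2) orbF zr_eq0.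
by rewrite andbA (det2_eq0 _ _ (posi ik)).
Qed.

Let GW i : (i < k)%N -> {subset G <= Wi i}.
Proof. by move=> ik z; rewrite (Gi ik) mem_filter => /andP[]. Qed.

Let face_WG i : (i < k)%N -> face (pcv (Wi i)) (pcv G).
Proof.
(* Minus the sum of the determinants with the two bounding rays: both are nonnegative on the facet
   and vanish together only over the origin, that is, on the peak. *)
move=> ik; pose h := (dot (phi u) (x i.+1) - dot (phi u) (x i)) *: phi v
  - (dot (phi v) (x i.+1) - dot (phi v) (x i)) *: phi u.
have hE z : dot h (phi z) = - (cross (phi u) (phi v) (phi z) (x i.+1) + cross (phi u) (phi v) (x i) (phi z)).
  by rewrite dotBl !dotZl /cross; ring.
apply: (@pface_by _ _ _ _ _ h 0) => [z zW|z].
  by rewrite hE oppr_le0 addr_ge0 // cross_le; have [] := wz ik zW.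
rewrite (Gi ik) !mem_filter hE oppr_eq0.
have [zW|] := boolP (z \in Wi i); rewrite ?andbF // !andbT.
have [A B] := wz ik zW.
rewrite paddr_eq0 ?cross_le // !crossE !mulf_eq0 (gt_eqF N2) !orbF !zr_eq0.
exact: (det2_eq0 _ _ (posi ik)).
Qed.

Let rank_R i : (i < k)%N -> zrank n (Ri i) = n.-1.
Proof.
move=> ik; rewrite -(rk_phi sw w0 N0 aPhi).
have nn : n.-1 = (n - 2).+1 by lia.
apply/eqP; rewrite eqn_leq; apply/andP; split.
  rewrite -ltnS prednK; last by lia.
  pose h := dot (phi v) (x i) *: phi u - dot (phi u) (x i) *: phi v.
  have hE z : dot h (phi z) = - cross (phi u) (phi v) (x i) (phi z).
    by rewrite dotBl !dotZl /cross; ring.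
  apply: (@rk_le_level _ _ _ h) => [|_ /mapP[z zR ->]].
    apply/eqP => h0; have := c_xx ik; have := hE (S i.+1).2.1.
    by rewrite h0 dot0l => /esym/eqP; rewrite oppr_eq0 => /eqP ->; rewrite ltxx.
  move: zR; rewrite RiE // mem_filter => /andP[/Z.eqb_eq E _].
  by rewrite hE crossE E zr0 mul0r oppr0.
(* If the rank were at most n - 2, the ridge would span no more than the peak, where u and v vanish;
   but its ray x i does not project to 0. *)
rewrite nn ltnNge; apply/negP => le.
have GR : {subset G <= Ri i}.
  move=> z; rewrite (Gi ik) RiE // !mem_filter => /andP[/andP[/Z.eqb_eq A /Z.eqb_eq B] ->].
  by rewrite andbT /cr_z A B; apply/Z.eqb_eq; lia.
have sub : (spn [seq phi x | x <- G] <= spn [seq phi x | x <- Ri i])%MS.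
  by apply: spnS => _ /mapP[y yT ->]; apply/map_f/GR.
have eqs : (spn [seq phi x | x <- Ri i] <= spn [seq phi x | x <- G])%MS.
  rewrite -(geq_leqif (mxrank_leqif_sup sub)) -!/(rk _) (leq_trans le) //.
  by rewrite (rk_phi sw w0 N0 aPhi) rG.
have xR : x i \in [seq phi x | x <- Ri i].
  by apply: map_f; rewrite RiE // mem_filter xW // andbT /cr_z; apply/Z.eqb_eq; lia.
have xG := submx_trans (mem_spn xR) eqs.
have := c_xx ik; rewrite /cross (dot_spn0 gU xG) (dot_spn0 gV xG) !mul0r subrr ltxx //.
Qed.

Let S_ordS (i : 'I_k) : S (ordS i) = S i.+1.
Proof.
rewrite /=; have := ltn_ord i; rewrite leq_eqVlt => /predU1P[E|lt]; last by rewrite modn_small.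
by rewrite E modnn Sk.
Qed.

Lemma peak_cycle_ok : exists (k : nat) (F Rd : 'I_k -> set 'rV[R]_n),
  [/\ peak_cycle PP (pcv G) F Rd, angles_sum_2pi (pcv G) F & winds_once (pcv G) F].
Proof.
exists k, (fun i => pcv (Wi i)), (fun i => pcv (Ri i)); split => //; split.
- split.
    move=> i j E; apply/ord_inj/eqP.
    have [f _ fE] := WiL i; have [g _ gE] := WiL j.
    have E' : Wi i = Wi j.
      apply: (filter_inj fE gE) => z.
      by apply/idP/idP; apply: (pcv_sub sw w0 N0 VN aPhi); rewrite ?E //; apply: WiV.
    by rewrite -(nth_uniq [::] _ _ dF) ?size_map ?ltn_ord // !(nth_map s0) ?ltn_ord //; apply/eqP.
  apply/seteqP; split=> [_ [i _ <-]|_ [[f fL ->] Ff]].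
    split; last exact: face_WG.
    by have [f fL ->] := WiL i; exists f.
  have GV : {subset G <= V} by move=> z /(GW k0)/WiV.
  have /fsG - /(_ fL) ff := pface_sub sw w0 N0 VN aPhi GV (@verts_sub _ _ _) Ff.
  have uS : uniq (s0 :: l) by apply: map_uniq dF.
  (* [s0 :: l] is free of repetitions, contained in [ss] and as long, so the chain has met every
     facet at the peak. *)
  have [_ eqS] := uniq_min_size uS lss (eq_leq (etrans (size_map _ _) (esym sl))).
  have : (let Q := proj2d cu cv' (verts w V f) in (Q, first_ray Q)) \in s0 :: l.
    by rewrite eqS; apply: (map_f (fun f => let Q := proj2d cu cv' f.2 in (Q, first_ray Q)) ff).
  move=> /(nthP s0)[i ik E]; exists (Ordinal ik) => //=.
  by rewrite /Wi /S E /= proj2d_fst.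
- move=> i j E; apply/ord_inj/eqP.
  have [f _ fE] := WiL i; have [g _ gE] := WiL j.
  have E' : Ri i = Ri j.
    apply: (@filter_inj _ V _ _ (fun z => (cr_z (S i).2.1 z =? 0)%Z && in_key w f z)
       (fun z => (cr_z (S j).2.1 z =? 0)%Z && in_key w g z)).
    + by rewrite RiE // fE /verts -filter_predI.
    + by rewrite RiE // gE /verts -filter_predI.
    move=> z; apply/idP/idP; apply: (pcv_sub sw w0 N0 VN aPhi); rewrite ?E // => y /RiW;
      by move=> /(_ (ltn_ord _)) /WiV.
  by rewrite -(nth_uniq [::] _ _ dR) ?size_map ?ltn_ord // !(nth_map s0) ?ltn_ord //; apply/eqP.
- move=> i; split; last exact: face_G.
  have [f fL fE] := WiL i; split; last by exists (pcv (Wi i)); [exists f; rewrite ?fE | apply: face_R].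
  apply/(has_dim_verts _ fL); first by rewrite -fE; apply: RiW.
  by rewrite rank_R //; lia.
- move=> i; split; first exact: face_R.
  by rewrite /Ri S_ordS; apply: face_R'.
Qed.

End Cyc.

Lemma peak_okP : peak_ok w fs G -> exists (k : nat) (F Rd : 'I_k -> set 'rV[R]_n),
  [/\ peak_cycle PP (pcv G) F Rd, angles_sum_2pi (pcv G) F & winds_once (pcv G) F].
Proof.
rewrite /peak_ok; case E0: fs => [//|f0 [//|f1 [//|f2 fs']]]; rewrite -E0.
set u := vadd _ _; set v := vadd _ (vscale _ (kr f2.1)).
set ss := [seq _ | f <- fs].
case E1: ss => [//|s0 ss']; rewrite -E1 => /and4P[/eqP sl].
have s0ss : s0 \in ss by rewrite E1 mem_head.
have := @chain_sub (size fs) s0 ss s0ss.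
case E2: (chain (size fs) s0 ss) sl => [//|s l] sl lss cok /all_diffP dF /all_diffP dR.
have ss0 : s = s0.
  move: E2; case: (size fs) => //= m; by case: [seq _ <- _ | _] => [|? ?] [].
by subst s; apply: (@peak_cycle_ok u v s0 l).
Qed.

End Data.
End Peak.

(** * Ridges, peaks and edges of a representative facet *)

Lemma adjP n w k k' W W' : adj n w k k' W W' -> let G := [seq z <- W | in_key w k' z] in
  [/\ supports w k' W G, supports w k W' G & zrank n G = n.-1].
Proof. by move=> /and3P[? ? /eqP]. Qed.

Lemma mask_key w k (W : seq vec) : mask [seq in_key w k z | z <- W] W = [seq z <- W | in_key w k z].
Proof. by rewrite filter_mask. Qed.

Lemma mask_count (m m' : bitseq) : size m = size m' -> inb m (nth false m') -> (bcount m <= bcount m')%N.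
Proof.
elim: m m' => [|b m IH] [|b' m'] //= [sm] H.
have le : (bcount m <= bcount m')%N by apply: IH => // i mi; exact: (H i.+1).
have := H 0%N; rewrite /=; case: b {H} => [/(_ isT) ->|_] //.
by case: b' => //; apply: leqW.
Qed.

Lemma pairs_okP w N tab i (W W0 : seq vec) : pairs_ok w N tab i W W0 ->
  forall a b, (a < size W)%N -> (b < size W0)%N ->
  [\/ (2 * zdot (hmul w (nth [::] W a)) (nth [::] W0 b) =? N)%Z,
      (zdot (hmul w (nth [::] W a)) (nth [::] W0 b) =? N)%Z |
      exists c, [/\ c != (i + a)%N, c != b & nth false (nth [::] (nth [::] tab (i + a)) b) c]].
Proof.
elim: W i => [|x W IH] i //= /andP[H Hr] [|a] b aW bW; last first.
  by rewrite addnS -addSn; apply: IH.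
rewrite addn0 /=; set row := nth [::] tab i in H *.
move: H; set loop := (fix loop (j : nat) (ys : seq vec) (row : seq bitseq) {struct ys} : bool := _).
suff : forall j ys r, loop j ys r -> forall b', (b' < size ys)%N ->
  [\/ (2 * zdot (hmul w x) (nth [::] ys b') =? N)%Z,
      (zdot (hmul w x) (nth [::] ys b') =? N)%Z |
      exists c, [/\ c != i, c != (j + b')%N & nth false (nth [::] r b') c]].
  by move=> H Hl; have := H 0%N W0 row Hl b bW; rewrite add0n.
move=> j ys; elim: ys j => [|y ys IHy] j [|R r] //= /andP[Hy Hl] [|b'] bys; last first.
  by rewrite addnS -addSn; apply: IHy.
rewrite addn0 /=; move: Hy; case: ifP => [_ _|_]; first by constructor 1.
case: ifP => [_ _|_]; first by constructor 2.
case/hasP => c _ /andP[]; rewrite negb_or => /andP[ci cj]; rewrite bgetE => Rc.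
by constructor 3; exists c.
Qed.

Lemma arith_n n : (2 < n)%N -> [/\ (n - 2).+1 = n.-1, (n - 3).+1 = (n - 2)%N,
  (n - 2 <= n.-1)%N, n.-1 <> n & (n - 2)%N <> n].
Proof. by move=> ?; split; lia. Qed.

Lemma arith_n' n : (2 < n)%N -> (n.-1 <= n - 2)%N = false.
Proof. by move=> ?; lia. Qed.

Section TwoPoints.
Context {R : realType}.
Variables (n : nat) (w : vec) (N : Z) (V : seq vec).
Hypothesis sw : size w = n.
Hypothesis w0 : all (fun a => 0 <? a)%Z w.
Hypothesis N0 : (0 <? N)%Z.
Hypothesis VN : all (fun z => (size z == n) && (zdot (hmul w z) z =? N)%Z) V.
Variable Phi : 'M[R]_n.
Hypothesis aPhi : adm w N Phi.
Notation phi := (phi Phi).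

(* A line meets a sphere in at most two points. *)
Lemma two_points (T : seq vec) (c : 'rV[R]_n) (K : R) : {subset T <= V} -> K != 0 ->
  {in T, forall z, dot c (phi z) = K} -> zrank n T = 2 ->
  exists x y, [/\ x \in T, y \in T, x != y & forall z, z \in T -> z = x \/ z = y].
Proof.
move=> TV K0 lev rT.
case E : T => [|x T']; first by move: rT; rewrite E -(rk_phi sw w0 N0 aPhi) /rk /spn big_nil mxrank0.
have xT : x \in T by rewrite E mem_head.
have /hasP[y yT yx] : has (predC1 x) T.
  apply/negPn/negP; rewrite -all_predC => /allP all1.
  have : (rk [seq phi z | z <- T] <= 1)%N.
    apply: (@leq_trans (\rank (phi x))); last exact: rank_leq_row.
    apply/mxrankS/spn_subP => _ /mapP[z zT ->].
    by have := all1 z zT; rewrite /= negbK => /eqP ->.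
  by rewrite (rk_phi sw w0 N0 aPhi) rT.
rewrite /= in yx; rewrite -E; exists x, y; split; rewrite // 1?eq_sym // => z zT.
have xV := TV x xT; have yV := TV y yT; have zV := TV z zT.
have sph := phi_sphere sw N0 VN aPhi TV.
have xx := sph _ (map_f _ xT); have yy := sph _ (map_f _ yT); have zz := sph _ (map_f _ zT).
have pxy : phi y != phi x.
  by apply: contra yx => /eqP /(phi_inj sw w0 N0 aPhi (Vsize VN yV) (Vsize VN xV)) ->.
have r2 : rk [:: phi x; phi y] = 2%N.
  by apply: (rk2 K0 (lev x xT) (lev y yT)); rewrite eq_sym.
have sub : (spn [:: phi x; phi y] <= spn [seq phi z | z <- T])%MS.
  by apply: spnS => u; rewrite !inE => /orP[]/eqP ->; apply: map_f.
have : (phi z <= spn [:: phi x; phi y])%MS.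
  apply: submx_trans (mem_spn (map_f phi zT)) _.
  by rewrite -(geq_leqif (mxrank_leqif_sup sub)) -!/(rk _) (rk_phi sw w0 N0 aPhi) rT r2.
move=> /spn_comb[a]; rewrite !big_ord_recl big_ord0 addr0 /= => zE.
set al := a 0%N in zE; set be := a _ in zE.
have ab : al + be = 1.
  by apply: (mulIf K0); rewrite mul1r -[RHS](lev z zT) zE dotDr !dotZr !lev // mulrDl.
move: zz; rewrite zE dotDl !dotDr !dotZl !dotZr xx yy (dotC (phi y)) => zz.
have q1 : dot (phi x) (phi y) < 1 by apply: dot_unit_lt1 => //; rewrite eq_sym.
have beE : be = 1 - al by lra.
have : al * be * (1 - dot (phi x) (phi y)) = 0 by rewrite beE in zz *; lra.
move=> /eqP; rewrite !mulf_eq0 [1 - _ == 0]gt_eqF ?subr_gt0 // orbF => /orP[]/eqP h0.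
  right; apply: (phi_inj sw w0 N0 aPhi (Vsize VN zV) (Vsize VN yV)).
  by rewrite zE h0 scale0r add0r (_ : be = 1) ?scale1r //; lra.
left; apply: (phi_inj sw w0 N0 aPhi (Vsize VN zV) (Vsize VN xV)).
by rewrite zE h0 scale0r addr0 (_ : al = 1) ?scale1r //; lra.
Qed.
End TwoPoints.

Section Rep.
Context {R : realType}.
Variables (n : nat) (w : vec) (N : Z) (V : seq vec).
Hypothesis sw : size w = n.
Hypothesis w0 : all (fun a => 0 <? a)%Z w.
Hypothesis N0 : (0 <? N)%Z.
Hypothesis VN : all (fun z => (size z == n) && (zdot (hmul w z) z =? N)%Z) V.
Hypothesis VU : uniq V.
Hypothesis n3 : (2 < n)%N.
Variable L : seq key.
Hypothesis FR : {in L, forall k, zrank n (verts w V k) = n /\ (0 <? kK k)%Z}.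
Variable Phi : 'M[R]_n.
Hypothesis aPhi : adm w N Phi.
Variable k : key.
Hypothesis kL : k \in L.
Hypothesis rk_ok : rep_ok n w N V L k.

Notation zr := (@zr R).
Notation phi := (phi Phi).
Notation pcv := (pcv Phi).
Notation PP := (PP w V L Phi).
Let W := verts w V k.
Let bits k' : bitseq := [seq in_key w k' z | z <- W].
Let one := nseq (size W) true.
Let zero := nseq (size W) false.
Let M := [seq (k', bits k') | k' <- L].
Let NB := [seq (p, verts w V p.1) | p <- M & (n - 2 <= bcount p.2)%N && ~~ bsub one p.2].
Let NBa := [seq (p, (n.-1 <= bcount p.1.2)%N && adj n w k p.1.1 W p.2) | p <- NB].
Let RD := [seq p.1 | p <- NBa & p.2].
Let NBs := RD ++ [seq p.1 | p <- NBa & ~~ p.2].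
Let ridges := bsort [seq p.1.2 | p <- RD].
Let tab := reltab w N W.
Let peaks_of m :=
  bsort (bundup [seq t <- [seq band m m' | m' <- ridges] | (n - 2 <= bcount t)%N && ~~ bsub m t] [::]).
Let pk := [seq (m, peaks_of m) | m <- ridges].

Let checks : [/\ all (fun p => bsub one p.2 ==> keq p.1 k) M,
      all (fun p => size [seq q <- NB | bsub p.1.2 q.1.2] == 1%N) RD,
      pairs_ok w N tab 0 W W,
      search tab [::] one (size W).+1 ridges zero zero /\
      all (fun p => search tab [::] p.1 (size W).+1 p.2 zero (bnot p.1)) pk &
      all (fun g => (zrank n (mask g W) == (n - 2)%N) ==>
        peak_ok w ((k, W) :: [seq (q.1.1, q.2) | q <- NBs & bsub g q.1.2]) (mask g W))
        (bundup (flatten [seq p.2 | p <- pk]) [::])].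
Proof. by move: rk_ok => /and5P[_ _ A B /and4P[C D E F]]. Qed.

Let WV : {subset W <= V}. Proof. exact: verts_sub. Qed.
Let rW : zrank n W = n. Proof. by have [] := FR kL. Qed.
Let kap := zr (kK k) / zr N.
Let kap0 : kap != 0. Proof. exact: (kK_neq0 N0 FR kL). Qed.
Let lev : {in W, forall z, dot (phi (kr k)) (phi z) = kap}.
Proof. exact: (verts_level sw N0 aPhi). Qed.

Let mem_NB q : q \in NB -> [/\ q.1.1 \in L, q.1.2 = bits q.1.1, q.2 = verts w V q.1.1,
  (n - 2 <= bcount q.1.2)%N & ~~ bsub one q.1.2].
Proof.
move=> /mapP[p]; rewrite mem_filter => /andP[/andP[c f] /mapP[k' k'L pE]] ->.
by move: c f; rewrite pE /=; split.
Qed.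

Let NB_mem k' : k' \in L -> (n - 2 <= bcount (bits k'))%N -> ~~ bsub one (bits k') ->
  ((k', bits k'), verts w V k') \in NB.
Proof.
move=> k'L c f; apply: (map_f (fun p : key * bitseq => (p, verts w V p.1)) (x := (k', bits k'))).
by rewrite mem_filter c f /=; apply: (map_f (fun k' => (k', bits k')) k'L).
Qed.

Let mem_RD q : q \in RD -> q \in NB /\ adj n w k q.1.1 W q.2.
Proof.
move=> /mapP[p]; rewrite mem_filter => /andP[p2 /mapP[q' q'N pE]] ->.
by move: p2; rewrite pE /= => /andP[].
Qed.

Let mem_NBs q : (q \in NBs) = (q \in NB).
Proof.
rewrite mem_cat; apply/orP/idP => [[/mem_RD[]//|]|qN].
  by move=> /mapP[p]; rewrite mem_filter => /andP[_ /mapP[q' q'N ->]] ->.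
set b := (n.-1 <= bcount q.1.2)%N && adj n w k q.1.1 W q.2.
have mem_b : (q, b) \in NBa.
  exact: (map_f (fun p => (p, (n.-1 <= bcount p.1.2)%N && adj n w k p.1.1 W p.2)) qN).
by have [bT|bF] := boolP b; [left|right]; apply/mapP; exists (q, b) => //;
  rewrite mem_filter mem_b andbT.
Qed.

Let bits_size k' : size (bits k') = size W. Proof. exact: size_map. Qed.

Let bits_nth k' i : (i < size W)%N -> nth false (bits k') i = in_key w k' (nth [::] W i).
Proof. by move=> iW; rewrite (nth_map [::]). Qed.

Let full_key k' : k' \in L -> (forall i, (i < size W)%N -> nth false (bits k') i) -> k' = k.
Proof.
move=> k'L H; have [/allP A _ _ _ _] := checks.
have := A _ (map_f (fun k' => (k', bits k')) k'L) => /implyP /= A'; apply/keqP/A'.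
apply/bsubP => [|i]; first by rewrite size_nseq bits_size.
by move=> ii; apply: H; rewrite ltnNge; apply: contraTN ii => iW; rewrite nth_default ?size_nseq.
Qed.

Let one_full (t : bitseq) : size t = size W -> ~~ bsub one t -> exists2 i, (i < size W)%N & ~~ nth false t i.
Proof.
move=> st nf; have [i iW ti] : exists2 i, i \in iota 0 (size W) & ~~ nth false t i.
  apply/hasP; rewrite has_predC; apply: contra nf => /allP H.
  apply/bsubP => [|i ii]; first by rewrite size_nseq.
  apply: H; rewrite mem_iota add0n leq0n /= ltnNge; apply: contraTN ii => iW.
  by rewrite nth_default ?size_nseq.
by exists i => //; rewrite mem_iota add0n in iW.
Qed.

Let through (t : bitseq) k0 : size t = size W -> k0 \in L -> {subset mask t W <= verts w V k0} ->
  inb t (nth false (bits k0)).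
Proof.
move=> st k0L H i ti.
have iW : (i < size W)%N by rewrite ltnNge; apply: contraTN ti => iW; rewrite nth_default ?st.
rewrite bits_nth //; have : nth [::] W i \in mask t W by apply/(mem_maskP _ st); exists i.
by move=> /H; rewrite mem_filter => /andP[].
Qed.

Let tab_cl c b : valid Phi c b W -> forall i j l,
  nth false (tbits Phi c b W) i -> nth false (tbits Phi c b W) j ->
  nth false (nth [::] (nth [::] tab i) j) l -> nth false (tbits Phi c b W) l.
Proof. by move=> H i j l; apply: tab_closed. Qed.

Let ridge_size m : m \in ridges -> size m = size W.
Proof. by rewrite mem_bsort => /mapP[q /mem_RD[/mem_NB[_ -> _ _ _] _] ->]. Qed.

Let tsetT c b : zrank n (tset Phi c b W) <> n -> exists2 z, z \in W & dot c (phi z) != b.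
Proof.
move=> rT; have : ~~ all (fun z => dot c (phi z) == b) W.
  by apply/negP => /all_filterP TW; apply: rT; rewrite -[RHS]rW -{2}TW.
by rewrite -has_predC => /hasP[z zW]; exists z.
Qed.

(** The tight set of a supporting functional is closed under the table and is not all of [W], so the
    search applies to it. *)
Let cover_ridge c b : valid Phi c b W -> zrank n (tset Phi c b W) <> n ->
  exists2 q, q \in RD & {subset tset Phi c b W <= mask q.1.2 W}.
Proof.
move=> H rT; have [_ _ _ [S _] _] := checks.
have [m mr Tm] : exists2 m, m \in ridges & forall i, nth false (tbits Phi c b W) i -> nth false m i.
  apply: (searchP (m := size W) (tab_cl H) _ _ _ S) => //; rewrite ?size_nseq //.
  - split; rewrite ?size_nseq // => full.
    have [z zW /negP] := tsetT rT; apply.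
    have /(nthP [::])[i iW <-] := zW.
    by have := full i; rewrite nth_nseq iW (nth_map [::]) // => /(_ isT).
  - by move=> i /tbitsE[].
  - by move=> i; rewrite nth_nseq; case: ifP.
  - by move=> i; rewrite nth_nseq; case: ifP.
have sm := ridge_size mr; move: mr; rewrite mem_bsort => /mapP[q qR mE]; exists q => //.
by rewrite -mE; apply: tset_mask.
Qed.

Let RD_facts q : q \in RD -> [/\ q.1.1 \in L, q.1.2 = bits q.1.1, q.2 = verts w V q.1.1,
   ~~ bsub one q.1.2 & adj n w k q.1.1 W q.2].
Proof. by move=> /mem_RD[/mem_NB[? ? ? ? ?] ?]. Qed.

Let RD_mask q : q \in RD -> mask q.1.2 W = [seq z <- W | in_key w q.1.1 z].
Proof. by move=> /RD_facts[_ -> _ _ _]; rewrite mask_key. Qed.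

Let face_tset G d : has_dim d G -> face (pcv W) G -> exists c b,
  [/\ valid Phi c b W, G = pcv (tset Phi c b W) & zrank n (tset Phi c b W) = d.+1].
Proof.
move=> dG /pface[c [b [H GE]]]; exists c, b; split => //.
by apply/(has_dim_verts sw w0 N0 FR aPhi d kL (@tset_sub _ _ _ c b W)); rewrite -/(pcv _) -GE.
Qed.

Let ridge_case G : face (pcv W) G -> has_dim (n - 2) G ->
  exists2 q, q \in RD & G = pcv (mask q.1.2 W).
Proof.
move=> fG dG; have [c [b [H GE rT]]] := face_tset dG fG.
have [q qR sub] : exists2 q, q \in RD & {subset tset Phi c b W <= mask q.1.2 W}.
  by apply: cover_ridge => //; rewrite rT; have [-> _ _ ? _] := arith_n n3.
exists q => //; rewrite GE; apply/esym/eq_pcv.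
apply: (tight_max sw w0 N0 aPhi kap0 lev) => //; first by move=> z /mem_mask.
have [_ _ _ _ /adjP[_ _ rG]] := RD_facts qR.
by rewrite RD_mask // rG rT; have [-> _ _ _ _] := arith_n n3.
Qed.

Let RD_count q : q \in RD -> (n.-1 <= bcount q.1.2)%N.
Proof.
move=> /mapP[p]; rewrite mem_filter => /andP[p2 /mapP[q' q'N pE]] ->.
by move: p2; rewrite pE /= => /andP[].
Qed.

Let ridge_facets q : q \in RD -> let F' := pcv (verts w V q.1.1) in
  pcv W <> F' /\ [set F0 | PP F0 /\ face F0 (pcv (mask q.1.2 W))] = [set pcv W; F'].
Proof.
move=> qR F'; have [k'L mE WE nf /adjP[s1 s2 rG]] := RD_facts qR.
have sm : size q.1.2 = size W by rewrite mE.
split.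
  move=> E; have [i iW] := one_full sm nf; rewrite mE bits_nth // => /negP; apply.
  have : nth [::] W i \in verts w V q.1.1.
    apply: (pcv_sub sw w0 N0 VN aPhi WV (@verts_sub _ _ _)); first by rewrite E.
    exact: mem_nth.
  by rewrite mem_filter => /andP[].
rewrite RD_mask //; apply/seteqP; split=> [F [[k0 k0L ->] fF]|F [->|->]]; last 2 first.
- by split; [exists k | have [] := supportsP sw w0 N0 VN aPhi s1].
- by split; [exists q.1.1 | rewrite /F' -WE; have [] := supportsP sw w0 N0 VN aPhi s2].
have GV : {subset mask q.1.2 W <= V} by move=> z /mem_mask/WV.
rewrite -RD_mask // in fF; have sub := pface_sub sw w0 N0 VN aPhi GV (@verts_sub _ _ _) fF.
have Hin := through sm k0L sub.
have [f|f] := boolP (bsub one (bits k0)).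
  left; rewrite (full_key k0L) // => i iW; have /bsubP : bsub one (bits k0) by [].
  by rewrite size_nseq bits_size => /(_ erefl); apply; rewrite nth_nseq iW.
(* Another facet through the ridge contains its points, at least n - 1 of them, so it occurs in
   [NB], where only one facet containing the ridge is allowed. *)
right; have cnt : (n - 2 <= bcount (bits k0))%N.
  apply: leq_trans (mask_count (etrans sm (esym (bits_size k0))) Hin).
  by apply: leq_trans (RD_count qR); have [] := arith_n n3.
have kN := NB_mem k0L cnt f.
have [_ /allP/(_ q qR)/eqP s1' _ _ _] := checks.
have [qN _] := mem_RD qR.
have m1 : q \in [seq q' <- NB | bsub q.1.2 q'.1.2].
  by rewrite mem_filter qN andbT; apply/bsubP.
have m2 : ((k0, bits k0), verts w V k0) \in [seq q' <- NB | bsub q.1.2 q'.1.2].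
  by rewrite mem_filter kN andbT; apply/bsubP => //; rewrite sm bits_size.
case E : [seq _ <- NB | _] s1' m1 m2 => [|a [|]] // _.
by rewrite !inE => /eqP <- /eqP E'; rewrite /F' -E'.
Qed.

Lemma rep_ridge G : face (pcv W) G -> has_dim (n - 2) G ->
  exists F F', F <> F' /\ [set F0 | PP F0 /\ face F0 G] = [set F; F'].
Proof.
move=> fG dG; have [q qR ->] := ridge_case fG dG.
by have [? ?] := ridge_facets qR; exists (pcv W), (pcv (verts w V q.1.1)).
Qed.

(** The common hyperplane would be that of the neighbour, which meets [W] only in the ridge, a
    proper part of [W]. *)
Lemma rep_crease F : PP F -> pcv W <> F -> share_ridge PP (pcv W) F ->
  ~ exists H, [/\ hyperplane H, pcv W `<=` H & F `<=` H].
Proof.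
move=> PF WF [G [[dG _] fG fF]] [H [[c [b [c0 HE]]] WH FH]].
have [q qR GE] := ridge_case fG dG; have [_ FF] := ridge_facets qR.
have FE : F = pcv (verts w V q.1.1).
  have : [set F0 | PP F0 /\ face F0 (pcv (mask q.1.2 W))] F by split => //; rewrite -GE.
  by rewrite FF => -[E|//]; case: WF.
have [k'L mE WE nf /adjP[s1 s2 rG]] := RD_facts qR.
have rV : rk [seq phi z | z <- verts w V q.1.1] = n.
  by rewrite (rk_phi sw w0 N0 aPhi); have [] := FR k'L.
have [i iW] := one_full (etrans (congr1 size mE) (bits_size _)) nf.
rewrite mE bits_nth // => /negP; apply.
have Hb : {in [seq phi z | z <- verts w V q.1.1], forall z, dot c z = b}.
  move=> _ /mapP[z zV ->]; have := FH (phi z); rewrite FE HE; apply.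
  by apply: mem_cv; apply: map_f.
have Hl : {in [seq phi z | z <- verts w V q.1.1],
    forall z, dot (phi (kr q.1.1)) z = zr (kK q.1.1) / zr N}.
  by move=> _ /mapP[z zV ->]; apply: (verts_level sw N0 aPhi zV).
have [_ LE] := level_unique (kK_neq0 N0 FR k'L) c0 rV Hl Hb.
have : level c b (phi (nth [::] W i)).
  by rewrite -HE; apply: WH; apply: mem_cv; apply: map_f; apply: mem_nth.
rewrite LE => /eqP; rewrite (dot_phi_eq sw N0 aPhi) => E.
have : nth [::] W i \in [seq z <- W | (wdot w (kr q.1.1) z =? kK q.1.1)%Z].
  by rewrite mem_filter E mem_nth.
by have [<- _] := supportsP sw w0 N0 VN aPhi s1; rewrite mem_filter => /andP[].
Qed.

Let cover_peak q c b : q \in RD -> valid Phi c b W -> {subset tset Phi c b W <= mask q.1.2 W} ->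
  zrank n (tset Phi c b W) = (n - 2)%N ->
  exists t, [/\ t \in peaks_of q.1.2, size t = size W & {subset tset Phi c b W <= mask t W}].
Proof.
move=> qR H sub rT; have [_ _ _ [_ /allP S] _] := checks.
have qr : q.1.2 \in ridges by rewrite mem_bsort; apply: map_f.
have sq := ridge_size qr.
have {}S := S _ (map_f (fun m => (m, peaks_of m)) qr).
have tsz t : t \in peaks_of q.1.2 -> size t = size W.
  rewrite mem_bsort mem_bundup in_nil orbF mem_filter => /andP[_ /mapP[m _ ->]].
  by rewrite size_band sq.
have [t tp Tt] : exists2 t, t \in peaks_of q.1.2 &
    forall i, nth false (tbits Phi c b W) i -> nth false t i.
  apply: (searchP (m := size W) (tab_cl H) _ _ _ S) => //; rewrite ?size_nseq //.
  - split => // full; have := mask_tset sq full => /= sub2.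
    have : (zrank n (mask q.1.2 W) <= zrank n (tset Phi c b W))%N.
      by rewrite -!(rk_phi sw w0 N0 aPhi); apply: rkS => _ /mapP[z zm ->]; apply/map_f/sub2.
    have [_ _ _ _ /adjP[_ _ rG]] := RD_facts qR.
    by rewrite RD_mask // rG rT arith_n'.
  - by move=> i /tbitsE[].
  - by rewrite size_map.
  - by move=> i; rewrite nth_nseq; case: ifP.
  - move=> i; rewrite nth_bnot => /andP[iq nq]; apply: contra nq => /tbitsE[iW].
    move=> /sub /(mem_maskP _ sq) [j [jW qj E]].
    have [_ qE _ _ _] := RD_facts qR.
    by move: qj; rewrite qE !bits_nth // E.
by exists t; split; [|exact: tsz|apply: tset_mask => //; exact: tsz].
Qed.

Let peak_case G : face (pcv W) G -> has_dim (n - 3) G ->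
  exists t, [/\ t \in bundup (flatten [seq p.2 | p <- pk]) [::], size t = size W,
    zrank n (mask t W) = (n - 2)%N & G = pcv (mask t W)].
Proof.
move=> fG dG; have [c [b [H GE rT]]] := face_tset dG fG.
have [_ n33 _ _ n2n] := arith_n n3; rewrite n33 in rT.
have [q qR sub] : exists2 q, q \in RD & {subset tset Phi c b W <= mask q.1.2 W}.
  by apply: cover_ridge => //; rewrite rT.
have [t [tp ts subt]] := cover_peak qR H sub rT.
have [k'L qE _ _ /adjP[s1 _ rG]] := RD_facts qR.
have sq : size q.1.2 = size W by rewrite qE.
(* t is the intersection of the ridge q with a second ridge and misses a point of q. With rank above
   n - 2 it would span q, which would then lie in the hyperplane of the second ridge, and t would
   miss nothing. *)
have rt : (zrank n (mask t W) <= n - 2)%N.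
  move: tp; rewrite mem_bsort mem_bundup in_nil orbF mem_filter => /andP[/andP[_ nt]].
  case/mapP => m mr tE; have sm := ridge_size mr.
  move: mr; rewrite mem_bsort => /mapP[q' q'R mE].
  have [k''L q'E _ _ /adjP[s1' _ _]] := RD_facts q'R.
  have tq : {subset mask t W <= mask q.1.2 W}.
    by apply: mask_inb => // i; rewrite tE nth_band ?sq ?sm // => /andP[].
  have tq' : {subset mask t W <= mask q'.1.2 W}.
    by rewrite -mE; apply: mask_inb => // i; rewrite tE nth_band ?sq ?sm // => /andP[].
  rewrite leqNgt; apply/negP => lt; case/negP: nt.
  apply/bsubP => [|i qi]; first by rewrite sq ts.
  have iW : (i < size W)%N by rewrite -sq ltnNge; apply: contraTN qi => ?; rewrite nth_default.
  have zq : nth [::] W i \in mask q.1.2 W by apply/(mem_maskP _ sq); exists i.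
  have r'' : {in mask t W, forall z, (wdot w (kr q'.1.1) z =? kK q'.1.1)%Z}.
    by move=> z /tq'; rewrite RD_mask // mem_filter in_keyE => /andP[/andP[]].
  have van : dot (kap *: phi (kr q'.1.1) - (zr (kK q'.1.1) / zr N) *: phi (kr k)) (phi (nth [::] W i)) = 0.
    have sub' : (spn [seq phi x | x <- mask t W] <= spn [seq phi x | x <- mask q.1.2 W])%MS.
      by apply: spnS => _ /mapP[y yT ->]; apply/map_f/tq.
    have eqs : (spn [seq phi x | x <- mask q.1.2 W] <= spn [seq phi x | x <- mask t W])%MS.
      rewrite -(geq_leqif (mxrank_leqif_sup sub')) -!/(rk _) !(rk_phi sw w0 N0 aPhi).
      by rewrite RD_mask // rG; have [<- _ _ _ _] := arith_n n3.
    apply: (dot_spn0 _ (submx_trans (mem_spn (map_f phi zq)) eqs)) => _ /mapP[z zt ->].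
    have /eqP E : dot (phi (kr q'.1.1)) (phi z) == zr (kK q'.1.1) / zr N.
      by rewrite (dot_phi_eq sw N0 aPhi) r''.
    by rewrite dotBl !dotZl E lev ?(mem_mask zt) // mulrC subrr.
  have : (wdot w (kr q'.1.1) (nth [::] W i) =? kK q'.1.1)%Z.
    rewrite -(dot_phi_eq sw N0 aPhi); move/eqP: van.
    rewrite dotBl !dotZl lev ?mem_nth // subr_eq0 [X in _ == X]mulrC (inj_eq (mulfI kap0)) //.
  have [GE' _] := supportsP sw w0 N0 VN aPhi s1' => E.
  have : nth [::] W i \in [seq z <- W | in_key w q'.1.1 z] by rewrite GE' mem_filter E mem_nth.
  rewrite tE nth_band ?sq ?sm // qi /= mE q'E bits_nth // mem_filter => /andP[]//.
have eqT : mask t W =i tset Phi c b W.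
  by apply: (tight_max sw w0 N0 aPhi kap0 lev) => //; [move=> z /mem_mask | rewrite rT].
exists t; split => //.
- rewrite mem_bundup orbF; apply/flattenP; exists (peaks_of q.1.2) => //.
  apply/mapP; exists (q.1.2, peaks_of q.1.2) => //; apply: (map_f (fun m => (m, peaks_of m))).
  by rewrite mem_bsort; apply: map_f.
- rewrite -rT -!(rk_phi sw w0 N0 aPhi); apply: eq_rk; exact: eq_mem_map.
- by rewrite GE; apply/esym/eq_pcv.
Qed.

Let peak_count t : t \in bundup (flatten [seq p.2 | p <- pk]) [::] -> (n - 2 <= bcount t)%N.
Proof.
rewrite mem_bundup orbF => /flattenP[s /mapP[p /mapP[m mr ->] ->]] /=.
by rewrite mem_bsort mem_bundup in_nil orbF mem_filter => /andP[/andP[]].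
Qed.

Lemma rep_peak G : face (pcv W) G -> has_dim (n - 3) G ->
  exists (k : nat) (F Rd : 'I_k -> set 'rV[R]_n),
      [/\ peak_cycle PP G F Rd, angles_sum_2pi G F & winds_once G F].
Proof.
move=> fG dG; have [t [tp ts rt ->]] := peak_case fG dG.
have [_ _ _ _ /allP/(_ t tp)/implyP] := checks; rewrite rt eqxx => /(_ isT) ok.
apply: (peak_okP sw w0 N0 VN n3 FR aPhi _ _ rt ok) => [f|k0 k0L sub].
  rewrite inE => /predU1P[->//|/mapP[q]]; rewrite mem_filter mem_NBs => /andP[_ /mem_NB[? _ ? _ _]] ->.
  by split.
have Hin := through ts k0L sub.
have [f|f] := boolP (bsub one (bits k0)).
  rewrite (full_key k0L) ?mem_head // => i iW; have /bsubP : bsub one (bits k0) by [].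
  by rewrite size_nseq bits_size => /(_ erefl); apply; rewrite nth_nseq iW.
rewrite inE; apply/orP; right.
have cnt : (n - 2 <= bcount (bits k0))%N.
  exact: leq_trans (peak_count tp) (mask_count (etrans ts (esym (bits_size k0))) Hin).
apply: (map_f (fun q : key * bitseq * seq vec => (q.1.1, q.2)) (x := ((k0, bits k0), verts w V k0))).
by rewrite mem_filter mem_NBs NB_mem // andbT; apply/bsubP => //; rewrite ts bits_size.
Qed.

(** An edge has rank 2 and contains just two points of V; a relation between these and a third point
    would put that point on the edge as well. *)
Lemma rep_edge E : face (pcv W) E -> has_dim 1 E -> unit_segment E.
Proof.
move=> fE dE; have [c [b [H EE rT]]] := face_tset dE fE.
have TW : {subset tset Phi c b W <= W} := @tset_sub _ _ _ c b W.
have [x [y [xT yT xy only]]] := two_points sw w0 N0 VN aPhi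
  (fun z zT => WV (TW z zT)) kap0 (fun z zT => lev (TW z zT)) rT.
have xW := TW x xT; have yW := TW y yT; have xV := WV xW; have yV := WV yW.
have sph := phi_sphere sw N0 VN aPhi WV.
have xx := sph _ (map_f _ xW); have yy := sph _ (map_f _ yW).
have -> : E = cv [:: phi x; phi y].
  rewrite EE; apply: (eq_cv (s := [seq phi z | z <- _]) (t := [seq phi z | z <- [:: x; y]])).
  apply: eq_mem_map => z; rewrite !inE; apply/idP/orP => [/only[->|->]|[]/eqP ->] //;
    by rewrite eqxx; auto.
apply: unit_segment_cv => //; apply/eqP; rewrite (dot_phi_half sw N0 aPhi).
have [_ _ P _ _] := checks.
have /(nthP [::])[i iW xi] := xW; have /(nthP [::])[j jW yj] := yW.
case: (pairs_okP P iW jW); [by rewrite xi yj | rewrite xi yj => E1 |].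
  have : dot (phi x) (phi y) = 1.
    by rewrite (dot_phi sw aPhi); move/Z.eqb_spec: E1; rewrite /wdot => ->; rewrite divff // (zN_neq0 N0).
  have := dot_unit_lt1 xx yy; move=> h h1; move: xy; suff -> : x = y by rewrite eqxx.
  apply: (phi_inj sw w0 N0 aPhi (Vsize VN xV) (Vsize VN yV)); apply/eqP/negPn/negP => ne.
  by move: (h ne); rewrite h1 ltxx.
move=> [l []]; rewrite add0n => li lj rel.
have bi : nth false (tbits Phi c b W) i.
  by move: xT; rewrite mem_filter (nth_map [::]) // xi => /andP[].
have bj : nth false (tbits Phi c b W) j.
  by move: yT; rewrite mem_filter (nth_map [::]) // yj => /andP[].
have /tbitsE[lW /only] := tab_cl H bi bj rel.
have neq m m' : (m < size W)%N -> (m' < size W)%N -> m != m' -> nth [::] W m <> nth [::] W m'.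
  by move=> mW m'W mm' /eqP; rewrite nth_uniq ?filter_uniq // (negPf mm').
by case=> E'; exfalso; [apply: (neq l i) | apply: (neq l j)]; rewrite // E' ?xi ?yj.
Qed.

End Rep.

(** * Unit-edge facets, external facets and folds *)

Section Vertices.
Context {R : realType} {n : nat}.
Implicit Types (s : seq 'rV[R]_n).

Lemma cv_nil : cv (R := R) (n := n) [::] = set0.
Proof.
by apply/seteqP; split=> // x /cvP[a [_ /eqP]]; rewrite big_nil eq_sym oner_eq0.
Qed.

Lemma face_vertex s v : on_sphere s -> face (cv s) [set v] <-> v \in s.
Proof.
move=> sph; split=> [/face_cv[c [b [H E]]]|vs].
  have ts z : z \in tight c b s -> z = v /\ z \in s.
    move=> zt; split; last by move: zt; rewrite mem_filter => /andP[].
    by have : cv (tight c b s) z := mem_cv zt; rewrite -E.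
  case tE : (tight c b s) E ts => [|z t] E; last by move=> /(_ z (mem_head _ _))[<-].
  by have : [set v] v by []; rewrite E cv_nil.
apply/face_cv; exists v, 1; split=> [z zs|].
  have [->|zv] := eqVneq z v; first by rewrite sph.
  by rewrite ltW // dot_unit_lt1 ?sph // eq_sym.
rewrite -cv1; apply: eq_cv => z; rewrite mem_filter inE; apply/eqP/andP => [->|[/eqP zE zs]].
  by rewrite vs sph.
by apply/eqP/negPn/negP => zv; have := dot_unit_lt1 (sph v vs) (sph z zs); rewrite eq_sym zE ltxx => /(_ zv).
Qed.

Lemma vertices_cv s : on_sphere s -> vertices (cv s) = [set` s].
Proof. by move=> sph; apply/seteqP; split=> v /(face_vertex v sph). Qed.
End Vertices.

(* The two kinds of facets of P, the creased condition included. *)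
Definition extF {R : realType} {n} (U F : set 'rV[R]_n) := facets (hull U) F /\
  exists c b, [/\ c != 0, b != 0, U `<=` halfspace c b, F `<=` level c b & U `&` level c b `<=` F].

Definition foldF {R : realType} {n} (U F : set 'rV[R]_n) :=
  exists c b, [/\ c != 0, F `<=` level c b, ~ external U (level c b) & shallow U (level c b) F].

Lemma epairsP w N V W m : m \in epairs w N V W -> size m = size W /\
  exists i j, [/\ nth false m i, nth false m j & exposed w N V (nth [::] W i) (nth [::] W j)].
Proof.
elim: W m => [|x W IH] m //=; set loop := (fix loop (ys : seq vec) : seq bitseq := _).
have P ys r : r \in loop ys -> size r = size ys /\ exists j, nth false r j /\ exposed w N V x (nth [::] ys j).
  elim: ys r => [|y ys IHy] r //=.
  have Q : r \in [seq false :: r0 | r0 <- loop ys] -> size r = (size ys).+1 /\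
      exists j, nth false r j /\ exposed w N V x (nth [::] (y :: ys) j).
    by move=> /mapP[r' /IHy[<- [j [? ?]]] ->]; split=> //; exists j.+1.
  case: ifP => // ex; rewrite inE => /predU1P[->|//]; rewrite /= size_map.
  by split=> //; exists 0%N.
rewrite mem_cat => /orP[]/mapP[r].
  by move=> /P[<- [j [? ?]]] ->; split=> //; exists 0%N, j.+1.
by move=> /IH[<- [i [j [? ? ?]]]] ->; split=> //; exists i.+1, j.+1.
Qed.

Lemma kmaskP W k : all (fun i => i < size W)%N (ka k) -> size (kmask W k) = size W /\
  {in ka k, forall i, nth false (kmask W k) i}.
Proof.
rewrite /kmask; elim: (ka k) => [|a s IH] /=; first by rewrite size_map.
move=> /andP[aW /IH[sz H]]; rewrite size_bset; split=> // i; rewrite inE.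
set q := foldr _ _ _ in sz H *.
have bs (l : bitseq) : forall u v, (u < size l)%N -> nth false l v || (v == u) -> nth false (bset u l) v.
  by elim: l => [|x l IHl] [|u] [|v] //= ul; rewrite ?orbF //; apply: IHl.
move=> /predU1P[->|/H qi]; apply: bs; rewrite ?sz ?eqxx ?orbT ?qi //.
Qed.

Section Fixed.
Context {R : realType}.
Variables (n : nat) (w : vec) (N : Z) (V : seq vec).
Hypothesis sw : size w = n.
Hypothesis w0 : all (fun a => 0 <? a)%Z w.
Hypothesis N0 : (0 <? N)%Z.
Hypothesis VN : all (fun z => (size z == n) && (zdot (hmul w z) z =? N)%Z) V.
Hypothesis n3 : (2 < n)%N.
Variable Phi : 'M[R]_n.
Hypothesis aPhi : adm w N Phi.
Notation zr := (@zr R).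
Notation phi := (phi Phi).
Notation pcv := (pcv Phi).
Notation tset := (tset Phi).
Notation valid := (valid Phi).

Let dphi := dot_phi sw aPhi.
Let zN0 : 0 < zr N := zN_gt0 N0.

Lemma wdotN z : z \in V -> wdot w z z = N.
Proof. by move=> /(allP VN)/andP[_ /Z.eqb_spec]. Qed.

Lemma dphi_self z : z \in V -> dot (phi z) (phi z) = 1.
Proof. by move=> zV; rewrite dphi wdotN // divff // gt_eqF. Qed.

Lemma exposed_not_unit c b x y : b != 0 -> valid c b V ->
  x \in tset c b V -> y \in tset c b V -> exposed w N V x y ->
  ~ unit_edge_facet (pcv (tset c b V)).
Proof.
move=> b0 Hc xT yT ex ue; set T := tset c b V in xT yT ue.
have TV : {subset T <= V} := @tset_sub _ _ _ c b V.
have xV := TV x xT; have yV := TV y yT.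
move: ex; rewrite /exposed; case: ifP => // nu; case: ifP => // nN /allP ex.
have pxy : phi x != phi y.
  apply/eqP => /(phi_inj sw w0 N0 aPhi (Vsize VN xV) (Vsize VN yV)) E.
  by move: nN; rewrite E -/(wdot w y y) (wdotN yV) Z.eqb_refl.
pose h := phi (vadd x y); pose m := zr (N + wdot w x y) / zr N.
have mE : m = 1 + dot (phi x) (phi y).
  by rewrite /m zrD mulrDl divff ?gt_eqF // dphi.
have hx : dot h (phi x) = m.
  by rewrite /h phiD dotDl dphi_self // mE (dotC (phi y)).
have hy : dot h (phi y) = m by rewrite /h phiD dotDl dphi_self // mE addrC.
have tri z : z \in V -> [\/ z = x, z = y | dot h (phi z) < m].
  move=> zV; have := ex z zV; case: ifP => [lt _|_].
    by constructor 3; rewrite /h dphi /m ltr_pM2r ?invr_gt0 // zr_lt.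
  by case: ifP => [/veqP|_ /veqP]; [constructor 1 | constructor 2].
have fE : face (pcv T) (pcv [:: x; y]).
  apply: (@pface_by _ _ _ _ _ h m) => [z zT|z].
    by case: (tri z (TV z zT)) => [->|->|/ltW//]; rewrite ?hx ?hy.
  rewrite mem_filter !inE; apply/orP/andP => [[]/eqP ->|[/eqP hz zT]]; rewrite ?hx ?hy ?eqxx //.
  by case: (tri z (TV z zT)) => [->|->|]; rewrite ?eqxx; auto; rewrite hz ltxx.
have lev z : z \in T -> dot c (phi z) = b by rewrite mem_filter => /andP[/eqP].
have dE : has_dim 1 (pcv [:: x; y]).
  apply/(has_dim_cv _ b0 (c := c)) => [_ /mapP[z + ->]|].
    by rewrite !inE => /orP[]/eqP ->; apply: lev.
  by apply: (rk2 b0 (lev x xT) (lev y yT)).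
have /unit_segment_dist/eqP := ue _ fE dE; rewrite dist_sphere ?dphi_self //.
by rewrite (dot_phi_half sw N0 aPhi) -/(unitb N (hmul w x) y) nu.
Qed.

Lemma phi_vsum (s : seq vec) : phi (vsum s) = \sum_(z <- s) phi z.
Proof.
elim: s => [|z s IH] /=; first by rewrite big_nil phiE toRow0 mul0mx.
by rewrite big_cons phiD IH.
Qed.

Lemma zr_foldr (B : seq (Z * vec)) :
  zr (foldr Z.add 0%Z [seq p.1 | p <- B]) = \sum_(p <- B) zr p.1.
Proof. by elim: B => [|p B IH] /=; rewrite ?big_nil ?zr0 // big_cons zrD IH. Qed.

Lemma zr_nat k : zr (Z.of_nat k) = k%:R.
Proof.
elim: k => [|k IH]; first by rewrite zr0.
by rewrite Nat2Z.inj_succ -Z.add_1_r zrD IH zr1 natr1.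
Qed.

(** Weighted by the coefficients of [B], whose sum is t, the slacks b - <c, p> add up to (t - u) b.
    This cannot be negative, and if it is 0 then all points of [B] are tight, an exposed pair among
    them. *)
Lemma kill_sound W k c b : 0 < b -> valid c b V -> kill_ok w N V W k ->
  unit_edge_facet (pcv (tset c b V)) ->
  ~ {in ka k, forall i, nth [::] W i \in tset c b W}.
Proof.
move=> b0 Hc; rewrite /kill_ok; set A := [seq nth _ _ _ | _ <- _].
set B := [seq (_, _) | _ <- _]; set t := foldr _ _ _; set u := (_ * _)%Z.
move=> /and5P[_ /allP kV km0 /allP B0 /andP[/veqP E fin]] ue kT.
have BV p : p \in B -> p.2 \in V by case/mapP => q /kV qV ->; apply: mem_nth.
have /(congr1 (fun x => dot c (phi x))) := E.
rewrite phiZ dotZr !phi_vsum !dot_sumr big_map.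
have -> : \sum_(j <- ka k) dot c (phi (nth [::] W j)) = (size A)%:R * b.
  rewrite big_seq (eq_bigr (fun=> b)) => [|j /kT]; last by rewrite mem_filter => /andP[/eqP].
  by rewrite -big_seq big_const_seq count_predT iter_addr_0 size_map mulr_natl.
under [RHS]eq_bigr do idtac.
rewrite big_map; under [RHS]eq_bigr do rewrite phiZ dotZr.
move=> sumE.
have tE : zr t = \sum_(p <- B) zr p.1 by rewrite /t zr_foldr.
have uE : zr u * b = \sum_(p <- B) zr p.1 * dot c (phi p.2).
  by rewrite /u zrM zr_nat -mulrA sumE.
have slack p : p \in B -> 0 <= zr p.1 * (b - dot c (phi p.2)).
  move=> pB; apply: mulr_ge0; last by rewrite subr_ge0 Hc // BV.
  by rewrite ltW // -zr0 zr_lt; exact: B0.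
have dE : \sum_(p <- B) zr p.1 * (b - dot c (phi p.2)) = (zr t - zr u) * b.
  rewrite mulrBl uE tE mulr_suml -sumrB; apply: eq_bigr => p _; exact: mulrBr.
have dge : 0 <= (zr t - zr u) * b by rewrite -dE big_seq; apply: sumr_ge0 => p; apply: slack.
move: fin; case: ifP => [lt _|_ /andP[/Z.eqb_spec tu /hasP[p pB /hasP[q qB ex]]]].
  by move: dge; rewrite pmulr_lge0 // subr_ge0 leNgt zr_lt lt.
have tightB r : r \in B -> r.2 \in tset c b V.
  move=> rB; rewrite mem_filter BV // andbT.
  have /eqP : \sum_(p <- B) zr p.1 * (b - dot c (phi p.2)) = 0 by rewrite dE tu subrr mul0r.
  rewrite big_seq psumr_eq0 // => /allP/(_ _ rB).
  rewrite rB /= mulf_eq0.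
  by rewrite gt_eqF ?subr_eq0 /= 1?eq_sym // -zr0 zr_lt; exact: B0.
exact: (exposed_not_unit (lt0r_neq0 b0) Hc (tightB p pB) (tightB q qB) ex).
Qed.

Lemma affine_rank W c b : zrank n.+1 [seq 1%Z :: z | z <- W] = n.+1 -> b != 0 ->
  ~ {in W, forall z, dot c (phi z) = b}.
Proof.
move=> rW b0 H.
(* e is the vector (-b, c Phi^T). It is orthogonal to all (1, z), hence 0 by full rank, although b
   is not 0. *)
pose e : 'rV[R]_n.+1 := \row_i (if unlift ord0 i is Some j then (c *m Phi^T) 0 j else - b).
have : e = 0.
  apply: (rk_full_dot0 (s := [seq toRow n.+1 x | x <- [seq 1%Z :: z | z <- W]])).
    by rewrite -zrankE.
  move=> _ /mapP[_ /mapP[z zW ->] ->]; rewrite dotE big_ord_recl !mxE unlift_none /= mulr1.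
  have -> : \sum_(i < n) e 0 (lift ord0 i) * toRow n.+1 (1%Z :: z) 0 (lift ord0 i) = dot c (phi z).
    rewrite /dot phiE trmx_mul mulmxA mxE; apply: eq_bigr => i _.
    by rewrite !mxE liftK mxE.
  by rewrite H // addNr.
move=> /rowP /(_ ord0); rewrite !mxE unlift_none => /eqP; rewrite oppr_eq0 (negPf b0) //.
Qed.

Variable L : seq key.
Hypothesis FR : {in L, forall k, zrank n (verts w V k) = n /\ (0 <? kK k)%Z}.

Let kap0 k : k \in L -> 0 < zr (kK k) / zr N.
Proof. by move=> /FR[_ K0]; rewrite divr_gt0 // -zr0 zr_lt. Qed.

Lemma vf_sound p c b : vf_ok n w N V L p -> 0 < b -> valid c b V -> zrank n (tset c b V) = n ->
  unit_edge_facet (pcv (tset c b V)) -> p.1 \in tset c b V ->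
  exists2 k, k \in L & {subset verts w V k <= tset c b V}.
Proof.
move=> + b0 Hc rT ue; set v := p.1; rewrite /vf_ok -/v.
set W := v :: _; set one := map (fun _ : vec => true) _; set zero := map (fun _ : vec => false) _.
set M := map _ L; set Ts := bsort _; set kills := _ ++ _.
move=> /and5P[_ _ /eqP aff /(all_nthP (Kill [::] 0 [::])) kok S] vT.
have TV : {subset tset c b V <= V} := @tset_sub _ _ _ c b V.
have vV := TV v vT.
have WV : {subset W <= V}.
  by move=> z; rewrite inE => /predU1P[->//|]; rewrite mem_filter => /andP[].
have HW : valid c b W by move=> z /WV; apply: Hc.
have TWT z : z \in tset c b W -> z \in tset c b V.
  by rewrite !mem_filter => /andP[-> /WV].
(* By [vertex_span] the facet is spanned by v and its unit neighbours on the facet, so restriction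
   to [W] loses no rank. *)
have rTW : zrank n (tset c b W) = n.
  rewrite -(rk_phi sw w0 N0 aPhi).
  have lev : {in [seq phi z | z <- tset c b V], forall z, dot c z = b}.
    by move=> _ /mapP[z + ->]; rewrite mem_filter => /andP[/eqP].
  have := @vertex_span R n _ c b (phi v) (phi_sphere sw N0 VN aPhi TV) (lt0r_neq0 b0) lev _ (map_f _ vT) ue.
  rewrite (rk_phi sw w0 N0 aPhi) => /(_ rT) r1; apply/eqP; rewrite eqn_leq rank_leq_col /= -[leqLHS]r1.
  apply: rkS => x; rewrite inE => /predU1P[->|].
    have vTW : v \in tset c b W by move: vT; rewrite !mem_filter mem_head => /andP[->].
    exact: map_f vTW.
  rewrite mem_filter => /andP[vx /mapP[z zT xE]]; rewrite xE in vx *.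
  rewrite (dot_phi_half sw N0 aPhi) in vx.
  suff zTW : z \in tset c b W by exact: map_f zTW.
  by move: zT; rewrite !mem_filter inE mem_filter /unitb => /andP[-> ->]; rewrite vx orbT.
have b0' := lt0r_neq0 b0.
have [t tTs Tt] : exists2 t, t \in Ts & forall i, nth false (tbits Phi c b W) i -> nth false t i.
  apply: (searchP (m := size W) _ _ _ _ S) => //; rewrite ?size_bset ?size_map //.
  - by move=> i j l; apply: tab_closed HW.
  - move=> m; rewrite mem_cat => /orP[/epairsP[sm [i [j [mi mj ex]]]]|/(nthP [::])[q qp]].
      split=> // full; have [_ /TWT Ti] := tbitsE (full i mi); have [_ /TWT Tj] := tbitsE (full j mj).
      exact: (exposed_not_unit b0' Hc Ti Tj ex).
    rewrite size_map in qp; rewrite (nth_map (Kill [::] 0 [::])) //; set k := nth _ _ q => <-.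
    have ok : kill_ok w N V W k := kok q qp; have /kmaskP[sz km] : all (fun i => i < size W)%N (ka k) by case/and5P: ok.
    split=> // full; apply: (kill_sound b0 Hc ok ue) => i /km/full /tbitsE[_ //].
  - split; rewrite ?size_map // => full; apply: (affine_rank (c := c) aff b0') => z zW.
    have /(nthP [::])[i iW <-] := zW; have := full i; rewrite (nth_map [::]) // => /(_ isT) /tbitsE[_].
    by rewrite mem_filter => /andP[/eqP].
  - by move=> i /tbitsE[].
  - move=> s; rewrite mem_bsort mem_filter => /andP[_ /mapP[k _ ->]]; exact: size_map.
  - move=> i /nth_bset[->|]; last first.
      by have [iW|iW] := ltnP i (size W); [rewrite (nth_map [::]) | rewrite nth_default ?size_map].
    by rewrite /= ; move: vT; rewrite mem_filter => /andP[].
  - by move=> i; have [iW|iW] := ltnP i (size W); [rewrite (nth_map [::]) | rewrite nth_default ?size_map].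
move: tTs; rewrite mem_bsort mem_filter => /andP[_ /mapP[k kL tE]].
have TWk : {in tset c b W, forall z, z \in verts w V k}.
  move=> z zT; have : z \in mask t W.
    by apply: (tset_mask (Phi := Phi) (c := c) (b := b)) => //; rewrite tE size_map.
  by rewrite tE mask_key !mem_filter => /andP[-> /WV].
exists k => // z zk; rewrite mem_filter (verts_sub zk) andbT.
set kap := zr (kK k) / zr N.
have lev := verts_level sw N0 aPhi (Phi := Phi) (k := k) (V := V).
(* The tight points of [W] have full rank and lie on both hyperplanes, so the hyperplanes agree.
   This makes all vertices of the listed facet tight, not only those in [W]. *)
have : kap *: c - b *: phi (kr k) = 0.
  apply: (rk_full_dot0 (s := [seq phi z | z <- tset c b W])); first by rewrite (rk_phi sw w0 N0 aPhi).
  move=> _ /mapP[y yT ->]; rewrite dotBl !dotZl lev ?TWk //.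
  by move: yT; rewrite mem_filter => /andP[/eqP -> _]; rewrite mulrC subrr.
move=> /eqP; rewrite subr_eq0 => /eqP E.
have := congr1 (fun x => dot x (phi z)) E; rewrite !dotZl lev // mulrC => /eqP.
by rewrite (inj_eq (mulIf (lt0r_neq0 (kap0 kL)))).
Qed.

Lemma ext_sound k : k \in L -> ext_ok w V k -> extF [set` [seq phi z | z <- V]] (pcv (verts w V k)).
Proof.
move=> kL; rewrite /ext_ok; case E: (ks k) => [|//] /= /allP le.
set c := phi (kr k); set b := zr (kK k) / zr N.
have lev : {in verts w V k, forall z, dot c (phi z) = b} := verts_level sw N0 aPhi (k := k) (V := V).
have vE z : (z \in verts w V k) = (z \in V) && (wdot w (kr k) z =? kK k)%Z.
  rewrite mem_filter in_keyE E; case: (z \in V); rewrite ?andbF // andbT.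
  by rewrite (_ : hmul w [::] = [::]) ?andbT //; case: (w).
have b0 : b != 0 by rewrite lt0r_neq0 ?kap0.
have c0 : c != 0.
  apply: contraNneq b0 => c0; have [rk _] := FR kL.
  case vk : (verts w V k) rk => [|z s]; last by rewrite -(lev z) ?vk ?mem_head // c0 dot0l eqxx.
  by move=> r0; move: n3; rewrite -r0 -(rk_phi sw w0 N0 aPhi) /rk /spn big_nil mxrank0.
have H : valid c b V by move=> z zV; rewrite (dot_phi_le sw N0 aPhi); apply: le.
split.
  split; first by apply: (pface_by H) => z; rewrite vE mem_filter andbC (dot_phi_eq sw N0 aPhi).
  apply/(has_dim_cv _ b0 (c := c)) => [_ /mapP[z zk ->]|]; first exact: lev.
  by rewrite (rk_phi sw w0 N0 aPhi); have [-> _] := FR kL; rewrite subn1 prednK // (ltn_trans _ n3).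
exists c, b; split => //.
- by move=> _ /mapP[z zV ->]; apply: H.
- by apply: cv_level => _ /mapP[z zk ->]; apply: lev.
- move=> _ [/mapP[z zV ->] /eqP]; rewrite (dot_phi_eq sw N0 aPhi) => rz.
  by apply: mem_cv; apply: map_f; rewrite vE zV.
Qed.

Lemma fold_sound k sh : k \in L -> fold_ok n w V k sh ->
  foldF [set` [seq phi z | z <- V]] (pcv (verts w V k)).
Proof.
move=> kL; rewrite /fold_ok; set c' := hmul w (kr k); set d' := hmul w sh.1.
set WH := [seq _ <- _ | _].
move=> /and5P[/hasP[z1 z1V lt1] /hasP[z2 z2V lt2] /hasP[a ad a0] /eqP sd].
move=> /and3P[/Z.eqb_spec dr /allP half /and4P[/eqP sp /allP pW /allP pd /eqP rp]].
set c := phi (kr k); set b := zr (kK k) / zr N; set d := phi sh.1.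
have b0 : b != 0 by rewrite lt0r_neq0 ?kap0.
have lev : {in verts w V k, forall z, dot c (phi z) = b} := verts_level sw N0 aPhi (k := k) (V := V).
have WHE z : (z \in WH) = (z \in V) && (dot c (phi z) == b).
  by rewrite mem_filter andbC (dot_phi_eq sw N0 aPhi).
have vE z : (z \in verts w V k) = (z \in WH) && (dot d (phi z) <= 0).
  have -> : 0 = zr 0 / zr N by rewrite zr0 mul0r.
  rewrite mem_filter in_keyE WHE (dot_phi_le sw N0 aPhi) -andbA andbC -!andbA.
  rewrite -/(wdot w (kr k) z) -(dot_phi_eq sw N0 aPhi) -/c -/b.
  case zV : (z \in V); rewrite ?andbF //= andbC.
  case ez : (dot c (phi z) == b) => //=.
  have /half : z \in WH by rewrite WHE zV ez.
  by rewrite /wdot; case: ifP => [_ ->|_ /negPf ->].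
have [rkn _] := FR kL.
have rkV : rk [seq phi z | z <- WH] = n.
  apply/eqP; rewrite eqn_leq rank_leq_col -[leqLHS]rkn -(rk_phi sw w0 N0 aPhi); apply: rkS.
  by move=> _ /mapP[z + ->]; rewrite vE => /andP[? _]; apply: map_f.
have levW : {in [seq phi z | z <- WH], forall x, dot c x = b}.
  by move=> _ /mapP[z + ->]; rewrite WHE => /andP[_ /eqP].
have c0 : c != 0.
  apply: contraNneq b0 => c0.
  case vk : (verts w V k) rkn => [|z s]; last by rewrite -(lev z) ?vk ?mem_head // c0 dot0l eqxx.
  by move=> r0; move: n3; rewrite -r0 -(rk_phi sw w0 N0 aPhi) /rk /spn big_nil mxrank0.
have d0 : d != 0.
  apply/eqP => d0; have sh0 : sh.1 = nseq n 0%Z.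
    apply: (phi_inj sw w0 N0 aPhi sd); rewrite ?size_nseq // -/d d0 phiE.
    by rewrite (_ : toRow n _ = 0) ?mul0mx //; apply/rowP => i; rewrite !mxE nth_nseq ltn_ord.
  move: ad a0; rewrite /d' sh0 => /(nthP 0%Z)[i iw <-]; rewrite nth_hmul nth_nseq.
  by rewrite if_same Z.mul_0_r.
have UH : [set` [seq phi z | z <- V]] `&` level c b = [set` [seq phi z | z <- WH]].
  apply/seteqP; split=> [_ [/mapP[z zV ->] /eqP cz]|_ /mapP[z + ->]].
    by apply: map_f; rewrite WHE zV.
  by rewrite WHE => /andP[zV /eqP cz]; split=> //; apply: map_f.
exists c, b; split => //.
- by apply: cv_level => _ /mapP[z zk ->]; apply: lev.
(* The supporting functional is a multiple of c of unknown sign; z1 and z2 lie strictly on the two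
   sides, so both signs are excluded. *)
- move=> [c2 [b2 [c20 lE le]]].
  have lev2 : {in [seq phi z | z <- WH], forall x, dot c2 x = b2}.
    by move=> x /levW; rewrite -[dot c x = b]/(level c b x) lE.
  have : b *: c2 - b2 *: c = 0.
    by apply: (rk_full_dot0 rkV) => x xW; rewrite dotBl !dotZl levW // lev2 // mulrC subrr.
  move=> /eqP; rewrite subr_eq0 => /eqP E.
  have b20 : b2 != 0.
    apply: contra c20 => /eqP b20; move: E; rewrite b20 scale0r => /eqP.
    by rewrite scaler_eq0 (negPf b0).
  have side z : z \in V -> b2 * dot c (phi z) <= b2 * b.
    move=> zV; rewrite -dotZl -E dotZl mulrC ler_pM2r ?kap0 //.
    by apply: le; apply: map_f.
  have := side z1 z1V; have := side z2 z2V.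
  have [lt1' lt2'] : dot c (phi z1) < b /\ b < dot c (phi z2).
    by split; rewrite ltNge ?(dot_phi_ge sw N0 aPhi) ?(dot_phi_le sw N0 aPhi) /wdot -Z.ltb_antisym.
  have := b20; rewrite neq_lt => /orP[] ?; nra.
(* The foot of the perpendicular from the origin, equidistant from all unit vectors on the
   hyperplane. *)
set o := (b / dot c c) *: c; set s := o :: [seq phi z | z <- sh.2].
have cc : dot c c != 0 by rewrite dot_eq0.
have co : dot c o = b by rewrite /o dotZr divfK.
have levs : {in s, forall x, dot c x = b}.
  move=> x; rewrite inE => /predU1P[->//|/mapP[z /pW]]; rewrite vmemP => zW ->.
  by apply: levW; apply: map_f.
have dc : dot d c = 0.
  by rewrite dphi /wdot -/d' dr zr0 mul0r.
have ds : {in s, forall x, dot d x = 0}.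
  move=> x; rewrite inE => /predU1P[->|/mapP[z /pd /Z.eqb_spec dz ->]].
    by rewrite /o dotZr dc mulr0.
  by rewrite dphi /wdot -/d' dz zr0 mul0r.
have rs : rk s = n.-1.
  rewrite -rp -(rk_phi sw w0 N0 aPhi) /=; apply/eqP; rewrite eqn_leq; apply/andP; split; apply: mxrankS.
    apply/spn_subP => x; rewrite inE => /predU1P[->|xs]; last by apply: mem_spn; rewrite inE xs orbT.
    by apply: scalemx_sub; apply: mem_spn; exact: mem_head.
  apply/spn_subP => x; rewrite inE => /predU1P[->|xs]; last by apply: mem_spn; rewrite inE xs orbT.
  have -> : phi (kr k) = (dot c c / b) *: o.
    by rewrite /o scalerA mulrA divfK // divff // scale1r.
  by apply: scalemx_sub; apply: mem_spn; exact: mem_head.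
(* The spanning points lie in the kernel of d and have its rank n - 1, so the boundary flat is the
   slice of this kernel by the hyperplane. *)
have ker : (spn s == kermx d^T)%MS.
  have sub : (spn s <= kermx d^T)%MS.
    apply/spn_subP => x xs; apply/sub_kermxP/matrixP => i j; rewrite !ord1 -/(dot x d) dotC ds // mxE //.
  rewrite -(geq_leqif (mxrank_leqif_eq sub)) mxrank_ker mxrank_tr rank_rV d0 subn1 -/(rk s) rs //.
pose p (i : 'I_(n - 2)) : 'rV[R]_n := phi (nth [::] sh.2 i).
have pE : (o |` range p) = [set` s].
  apply/seteqP; split=> [x [->|[i _ <-]]|x]; rewrite /= ?mem_head //.
    by rewrite inE; apply/orP; right; apply: map_f; rewrite mem_nth // sp.
  rewrite inE => /predU1P[->|/mapP[z /(nthP [::])[i il <-] ->]]; first by left.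
  by right; rewrite sp in il; exists (Ordinal il).
have affL : aff (o |` range p) = [set y | (y <= spn s)%MS /\ dot c y = b].
  by rewrite pE; apply: aff_between => // x; apply: mem_cv.
exists o, p, (aff (o |` range p)), (level c b `&` halfspace d 0); split.
- rewrite UH; split.
    rewrite (@aff_between _ _ [seq phi z | z <- WH] c b) //; last by move=> x; apply: mem_cv.
    by split=> //; rewrite submx_full //; apply/eqP.
  exists (Num.sqrt (1 - b ^+ 2 / dot c c)) => _ /mapP[z zW ->].
  have zV : z \in V by move: zW; rewrite WHE => /andP[].
  rewrite /enorm; congr Num.sqrt; rewrite dotBl !dotBr dphi_self //.
  rewrite [dot (phi z) o]dotC /o !dotZl !dotZr (levW _ (map_f _ zW)).
  by field.
- move=> i; rewrite UH; apply: (map_f phi (x := nth [::] sh.2 i)).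
  by rewrite -vmemP; apply: pW; rewrite mem_nth // sp.
- split=> //; rewrite /has_dim affL aff_slice.
  apply/(flat_slice b0 (y0 := o)) => //; first by apply: mem_spn; exact: mem_head.
  by rewrite -/(rk s) rs; have [-> _] := arith_n n3.
- exists d, 0; split=> //; rewrite affL; apply/seteqP.
  have kE y : (y <= spn s)%MS <-> dot d y = 0.
    rewrite (eqmxP ker); split=> [/sub_kermxP/matrixP/(_ 0 0)|dy].
      by rewrite -/(dot y d) dotC mxE.
    by apply/sub_kermxP/matrixP => i j; rewrite !ord1 -/(dot y d) dotC dy mxE.
  by split=> y [? ?]; split=> //; apply/kE.
- rewrite pcvE vertices_cv; last by apply: (phi_sphere sw N0 VN aPhi); exact: verts_sub.
  rewrite setIA UH; apply/seteqP; split=> [_ /mapP[z + ->]|_ [/mapP[z zW ->] dz]].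
    by rewrite vE => /andP[zW dz]; split=> //; apply: map_f.
  by apply: map_f; rewrite vE zW.
Qed.

Lemma convex_edge v y c b : convex_at w N V v -> 0 < b -> valid c b V ->
  v \in tset c b V -> y \in tset c b V -> v != y ->
  (forall z, z \in tset c b V -> z = v \/ z = y) -> dot (phi v) (phi y) = 2^-1.
Proof.
move=> /allP H b0 Hc vT yT vy only.
have TV : {subset tset c b V <= V} := @tset_sub _ _ _ c b V.
have vV := TV v vT; have yV := TV y yT.
have cv' : dot c (phi v) = b by move: vT; rewrite mem_filter => /andP[/eqP].
have cy : dot c (phi y) = b by move: yT; rewrite mem_filter => /andP[/eqP].
move: (H y yV); case: ifP => [u _|_].
  by apply/eqP; rewrite (dot_phi_half sw N0 aPhi).
case: ifP => [/Z.eqb_spec E|_].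
  have /dot_unit_lt1 : dot (phi v) (phi v) = 1 by apply: dphi_self.
  move=> /(_ _ (dphi_self yV)); rewrite dphi /wdot E divff ?gt_eqF // ltxx => X; exfalso.
  suff /X : phi v != phi y by [].
  by apply: contra vy => /eqP /(phi_inj sw w0 N0 aPhi (Vsize VN vV) (Vsize VN yV)) ->.
rewrite /=; case: ifP => [/hasP[z zV] + _|_ /hasP[z1 z1V /= /hasP[z2 z2V]]].
  case: ifP => // zv; case: ifP => // zy rel; exfalso.
  case: (only z (relrow_tight Hc vT yT zV rel)) => E.
    by move/negP: zv; apply; apply/veqP.
  by move/negP: zy; apply; apply/veqP.
rewrite vmemP => z3V; have := Hc _ z3V; have := Hc _ z1V; have := Hc _ z2V.
rewrite !(phiD, phiZ, dotDr, dotZr) cv' cy -[zr (-1)]/(-1) -[zr 2]/2; lra.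
Qed.

End Fixed.

(** * Transfer along the symmetries *)

Section OrbitSound.
Variables (T : eqType) (G : Type) (mem : T -> seq T -> bool) (act : G -> T -> T) (gs : seq G).

Lemma addnew_sub xs seen new : {subset addnew mem xs seen new <= xs ++ new}.
Proof.
elim: xs new => [|x xs IH] new y //=; do 2?case: ifP => _; rewrite ?inE.
- by move=> /IH ->; rewrite orbT.
- by move=> /IH ->; rewrite orbT.
- by move=> /IH; rewrite !mem_cat !inE => /or3P[] ->; rewrite ?orbT.
Qed.

Lemma orbit_seen fuel seen todo : {subset seen <= orbit_list mem act gs fuel seen todo}.
Proof.
elim: fuel seen todo => [|f IH] seen [|x todo] y //= ys.
by apply: IH; rewrite mem_cat ys orbT.
Qed.

Lemma orbit_ind (P : T -> Prop) fuel seen todo :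
  (forall i g0, (i < size gs)%N -> forall x, P x -> P (act (nth g0 gs i) x)) ->
  {in seen, forall x, P x} -> {in todo, forall x, P x} ->
  {in orbit_list mem act gs fuel seen todo, forall x, P x}.
Proof.
move=> HP; elim: fuel seen todo => [|f IH] seen todo Hs Ht //=.
case: todo Ht => [//|x0 todo'] Ht; set todo := x0 :: todo' in Ht *.
have HN : {in addnew mem [seq act g x | x <- todo, g <- gs] seen [::], forall x, P x}.
  move=> y /addnew_sub; rewrite cats0 => /(nthP y)[i il <-].
  elim: todo Ht i il => [|x s IHs] Ht i //.
  rewrite allpairs_cons nth_cat size_cat size_map => il.
  case: ltnP => ig.
    case: gs ig il HP => [//|g0 gs'] ig _ HP; rewrite (nth_map g0) //.
    by apply: HP => //; apply: Ht; exact: mem_head.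
  by apply: IHs; [move=> z zs; apply: Ht; rewrite inE zs orbT | rewrite ltn_subLR].
apply: IH => // y; rewrite mem_cat => /orP[]; [exact: HN|exact: Hs].
Qed.
End OrbitSound.

Section Transfer.
Context {R : realType}.
Variables (n : nat) (w : vec) (N : Z) (V : seq vec).
Hypothesis sw : size w = n.
Hypothesis w0 : all (fun a => 0 <? a)%Z w.
Hypothesis N0 : (0 <? N)%Z.
Hypothesis VN : all (fun z => (size z == n) && (zdot (hmul w z) z =? N)%Z) V.
Hypothesis VU : uniq V.
Hypothesis n3 : (2 < n)%N.
Variables (L : seq key).
Notation zr := (@zr R).

Definition VS (Phi : 'M[R]_n) : set 'rV[R]_n := [set` [seq phi Phi z | z <- V]].

Section OneGen.
Variable g : gen.
Hypothesis gok : gen_ok n w g.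
Hypothesis gV : all (fun z => gexact g z && vmem (gact g z) V) V.
Hypothesis gL : all (fun k => kexact g k && kmem (kact g k) L) L.
Variable Phi : 'M[R]_n.
Hypothesis aPhi : adm w N Phi.

Definition gmx : 'M[R]_n := (zr g.1)^-1 *: toMx n g.2 *m Phi.

Let D0 : zr g.1 != 0.
Proof. by case/and4P: gok => D0 _ _ _; rewrite gt_eqF // -zr0 zr_lt. Qed.

Lemma gmx_adm : adm w N gmx.
Proof.
have /and4P[_ /eqP sM /allP rM /allP dM] := gok.
rewrite /adm /gmx -scalemxAl linearZ /= -scalemxAl -scalemxAr scalerA trmx_mul.
rewrite mulmxA -(mulmxA (toMx n g.2)) aPhi -scalemxAr -scalemxAl scalerA.
suff -> : toMx n g.2 *m diag_mx (toRow n w) *m (toMx n g.2)^T = (zr g.1 ^+ 2) *: diag_mx (toRow n w) :> 'M[R]_n.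
  by rewrite scalerA -invfM -expr2 mulrAC mulVf ?mul1r // expf_neq0.
apply/matrixP => i j; rewrite !mxE.
have := dM i; rewrite mem_iota /= ltn_ord => /(_ isT) /allP /(_ (val j)).
rewrite mem_iota /= ltn_ord => /(_ isT) /Z.eqb_spec /(congr1 zr).
rewrite (@zdotE _ n) ?size_hmul ?sw ?geq_minl // => E.
have -> : \sum_k (toMx n g.2 *m diag_mx (toRow n w)) i k * (toMx n g.2)^T k j =
   \sum_(i0 < n) zr (nth 0%Z (hmul w (nth [::] g.2 i)) i0) * zr (nth 0%Z (nth [::] g.2 j) i0).
  apply: eq_bigr => k _; rewrite mul_mx_diag !mxE nth_hmul zrM; congr (_ * _); exact: mulrC.
rewrite E; case: (eqVneq i j) => [->|ij]; first by rewrite eqxx mulr1n !zrM expr2.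
by rewrite mulr0n mulr0 ifN ?zr0.
Qed.

Lemma phi_gmx x : gexact g x -> phi gmx x = phi Phi (gact g x).
Proof.
have /and4P[_ /eqP sM _ _] := gok; move=> /veqP /(congr1 (toRow (R := R) n)).
rewrite toRowZ toRow_vmul ?sM // /phi /gmx mulmxA -scalemxAr => <-.
by rewrite scalerA mulVf // scale1r.
Qed.

Let gVx z : z \in V -> gexact g z /\ gact g z \in V.
Proof. by move=> /(allP gV)/andP[]; rewrite vmemP. Qed.

Lemma gact_inj : {in V &, injective (gact g)}.
Proof.
move=> x y xV yV E; have [xg _] := gVx xV; have [yg _] := gVx yV.
by apply: (phi_inj sw w0 N0 gmx_adm (Vsize VN xV) (Vsize VN yV)); rewrite !phi_gmx // E.
Qed.

Lemma gact_V : V =i [seq gact g z | z <- V].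
Proof.
have uV : uniq [seq gact g z | z <- V] by rewrite map_inj_in_uniq //; exact: gact_inj.
have sub : {subset [seq gact g z | z <- V] <= V} by move=> _ /mapP[z /gVx[_ ?] ->].
by have [_ E] := uniq_min_size uV sub (eq_leq (esym (size_map _ _))); move=> z; rewrite E.
Qed.

Lemma wdot_gact x y : gexact g x -> gexact g y -> wdot w (gact g x) (gact g y) = wdot w x y.
Proof.
move=> gx gy; apply: (@zr_inj R); apply: (mulIf (invr_neq0 (zN_neq0 (R := R) N0))).
by rewrite -(dot_phi sw aPhi) -(dot_phi sw gmx_adm) !phi_gmx.
Qed.

Lemma verts_kact k : k \in L -> kact g k \in L /\
  verts w V (kact g k) =i [seq gact g z | z <- verts w V k].
Proof.
move=> /(allP gL)/andP[/andP[gr gs]]; rewrite kmemP => gkL; split=> // z.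
have key z0 : z0 \in V -> in_key w (kact g k) (gact g z0) = in_key w k z0.
  by move=> /gVx[gz _]; rewrite !in_keyE /= -!/(wdot w _ _) !wdot_gact.
apply/idP/mapP => [|[z0 + ->]]; rewrite !mem_filter.
  move=> /andP[zk]; rewrite gact_V => /mapP[z0 z0V E].
  by exists z0; rewrite // mem_filter -key // -E zk.
by move=> /andP[zk zV]; rewrite key // zk; have [_ ->] := gVx zV.
Qed.

Lemma pcv_kact k : k \in L -> pcv gmx (verts w V k) = pcv Phi (verts w V (kact g k)).
Proof.
move=> kL; have [_ E] := verts_kact kL; rewrite (eq_pcv _ E) /pcv; congr cv.
rewrite -map_comp; apply/eq_in_map => z /verts_sub /gVx[gz _]; exact: phi_gmx.
Qed.

Lemma VS_gmx : VS gmx = VS Phi.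
Proof.
apply/seteqP; split=> _ /mapP[z zV ->]; have [gz gzV] := gVx zV.
  by rewrite phi_gmx //; apply: map_f.
move: zV; rewrite gact_V => /mapP[y yV ->]; rewrite -phi_gmx; last by have [] := gVx yV.
exact: map_f.
Qed.

(** The keys are only known to be mapped into the list. The induced map [tau] on the finitely many
    vertex lists is injective, hence onto, which gives the other inclusion. Lists without repetition
    replace keys because injectivity comes from [gact_inj] on points. *)
Lemma PP_gmx : PP w V L gmx = PP w V L Phi.
Proof.
pose tau W := [seq z <- V | z \in [seq gact g y | y <- W]].
pose Ls := undup [seq verts w V k | k <- L].
have tauE k : k \in L -> tau (verts w V k) = verts w V (kact g k).
  move=> kL; have [_ E] := verts_kact kL.
  by apply: eq_in_filter => z zV; rewrite -E mem_filter zV andbT.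
have LsE W : W \in Ls -> exists2 k, k \in L & W = verts w V k.
  by rewrite mem_undup => /mapP[k ? ->]; exists k.
have subV W : W \in Ls -> {subset W <= V} by move=> /LsE[k _ ->]; exact: verts_sub.
have tauI : {in Ls &, injective tau}.
  move=> W1 W2 W1L W2L E.
  have sub A B : A \in Ls -> B \in Ls -> tau A = tau B -> {subset A <= B}.
    move=> AL BL AB z zA; have zV := subV A AL z zA; have [_ gzV] := gVx zV.
    have : gact g z \in tau A by rewrite mem_filter gzV andbT map_f.
    rewrite AB mem_filter => /andP[/mapP[y yB /gact_inj E'] _].
    by rewrite E' // (subV B BL).
  have [[k1 _ E1] [k2 _ E2]] := (LsE _ W1L, LsE _ W2L).
  apply: (filter_inj E1 E2) => z; apply/idP/idP; exact: sub.
have uT : uniq [seq tau W | W <- Ls] by rewrite map_inj_in_uniq // undup_uniq.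
have sub : {subset [seq tau W | W <- Ls] <= Ls}.
  move=> _ /mapP[W /LsE[k kL ->] ->]; rewrite tauE // mem_undup; apply: map_f.
  by have [] := verts_kact kL.
have [_ E] := uniq_min_size uT sub (eq_leq (esym (size_map _ _))).
apply/seteqP; split=> F [k kL ->].
  by exists (kact g k); [have [] := verts_kact kL | rewrite pcv_kact].
have : verts w V k \in Ls by rewrite mem_undup map_f.
rewrite -E => /mapP[W /LsE[k' k'L ->]]; rewrite tauE // => ->.
by exists k'; rewrite ?pcv_kact.
Qed.

End OneGen.

Variable gs : seq gen.
Hypothesis gsok : all (gen_ok n w) gs.
Hypothesis gsV : all (fun g => all (fun z => gexact g z && vmem (gact g z) V) V) gs.
Hypothesis gsL : all (fun g => all (fun k => kexact g k && kmem (kact g k) L) L) gs.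

Let genP i (g0 : gen) : (i < size gs)%N -> let g := nth g0 gs i in
  [/\ gen_ok n w g, all (fun z => gexact g z && vmem (gact g z) V) V
    & all (fun k => kexact g k && kmem (kact g k) L) L].
Proof.
by move=> il; split; [move/(all_nthP g0): gsok|move/(all_nthP g0): gsV|move/(all_nthP g0): gsL]; apply.
Qed.

Variable rk0 : seq key.
Hypothesis LE : L = orbit_list kmem kact gs 100 rk0 rk0.

Let rkL : {subset rk0 <= L}. Proof. by rewrite LE; apply: orbit_seen. Qed.

Lemma key_ind (P : 'M[R]_n -> key -> Prop) :
  (forall Phi, adm w N Phi -> {in rk0, forall k, P Phi k}) ->
  (forall i g0, (i < size gs)%N -> let g := nth g0 gs i in forall Phi, adm w N Phi -> forall k, k \in L ->
     P (gmx g Phi) k -> P Phi (kact g k)) ->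
  forall Phi, adm w N Phi -> {in L, forall k, P Phi k}.
Proof.
move=> H0 H1; suff H : {in L, forall k, k \in L /\ forall Phi, adm w N Phi -> P Phi k}.
  by move=> Phi aPhi k /H[_]; apply.
have H0' : {in rk0, forall k, k \in L /\ forall Phi, adm w N Phi -> P Phi k}.
  by move=> k kr; split=> [|Phi aPhi]; [exact: rkL | exact: H0].
rewrite {1}LE; apply: (@orbit_ind _ _ _ _ _ (fun k => k \in L /\ forall Phi, adm w N Phi -> P Phi k)) => //.
move=> i g0 il k' [k'L Hk'].
have [go gV gL] := genP g0 il.
split=> [|Phi aPhi]; last by apply: H1 => //; apply: Hk'; apply: gmx_adm.
by have /andP[_] := allP gL k' k'L; rewrite kmemP.
Qed.

Lemma key_transfer (Q : set 'rV[R]_n -> set (set 'rV[R]_n) -> set 'rV[R]_n -> Prop) :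
  (forall Phi, adm w N Phi -> {in rk0, forall k, Q (VS Phi) (PP w V L Phi) (pcv Phi (verts w V k))}) ->
  forall Phi, adm w N Phi -> {in L, forall k, Q (VS Phi) (PP w V L Phi) (pcv Phi (verts w V k))}.
Proof.
move=> H; apply: key_ind => // i g0 il g Phi aPhi k kL; have [go gV gL] := genP g0 il.
by rewrite VS_gmx // PP_gmx // pcv_kact.
Qed.

Lemma FR_transfer (Phi : 'M[R]_n) : adm w N Phi -> {in rk0, forall k, zrank n (verts w V k) = n /\ (0 <? kK k)%Z} ->
  {in L, forall k, zrank n (verts w V k) = n /\ (0 <? kK k)%Z}.
Proof.
move=> aPhi0 H; apply: (key_ind (P := fun _ k => _) _ _ aPhi0) => [|i g0 il g {aPhi0}Phi aPhi k kL [rk K0]].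
  by move=> ? _; exact: H.
have [go gV gL] := genP g0 il; split=> //.
rewrite -[RHS]rk -(rk_phi sw w0 N0 (gmx_adm go aPhi) (verts w V k)) -(rk_phi sw w0 N0 aPhi); apply: eq_rk.
have [_ E] := verts_kact go gV gL aPhi kL.
suff -> : [seq phi (gmx g Phi) z | z <- verts w V k] = [seq phi Phi z | z <- [seq gact g z | z <- verts w V k]].
  exact: eq_mem_map.
rewrite -map_comp; apply/eq_in_map => z /verts_sub zV; apply: phi_gmx => //.
by have /andP[] := allP gV z zV.
Qed.

Variable vr : seq vec.
Hypothesis vrV : {subset vr <= V}.
Hypothesis VO : all (fun z => vmem z (orbit_list vmem gact gs 100 vr vr)) V.

Lemma vec_transfer (Q : set 'rV[R]_n -> set (set 'rV[R]_n) -> 'rV[R]_n -> Prop) :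
  (forall Phi, adm w N Phi -> {in vr, forall v, Q (VS Phi) (PP w V L Phi) (phi Phi v)}) ->
  forall Phi, adm w N Phi -> {in V, forall v, Q (VS Phi) (PP w V L Phi) (phi Phi v)}.
Proof.
move=> H0 Phi0 aPhi0 v /(allP VO); rewrite vmemP => vO.
suff [_ /(_ _ aPhi0)//] : v \in V /\ forall Phi, adm w N Phi -> Q (VS Phi) (PP w V L Phi) (phi Phi v).
have H0' : {in vr, forall z, z \in V /\ forall Phi, adm w N Phi -> Q (VS Phi) (PP w V L Phi) (phi Phi z)}.
  by move=> z zr; split=> [|Phi aPhi]; [exact: vrV | exact: H0].
apply: (@orbit_ind _ _ _ _ _
  (fun v => v \in V /\ forall Phi, adm w N Phi -> Q (VS Phi) (PP w V L Phi) (phi Phi v)) _ _ _ _ _ _ v vO) => //.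
move=> i g0 il z [zV Hz].
have [go gV gL] := genP g0 il; have /andP[gz] := allP gV z zV; rewrite vmemP => gzV; split=> // Phi aPhi.
have := Hz _ (gmx_adm go aPhi).
by rewrite VS_gmx // PP_gmx // phi_gmx.
Qed.

End Transfer.

(** * Assembly of the polytope *)

Lemma repsP T (fo : key -> T -> bool) (eo : key -> bool) (reps : seq (key * option T)) :
  all (fun p => if p.2 is Some sh then fo p.1 sh else eo p.1) reps ->
  [/\ {in [seq p.1 | p <- reps], forall k, (exists sh, fo k sh) \/ eo k},
   all (fun p => if p.2 is Some _ then false else true) reps ->
     {in [seq p.1 | p <- reps], forall k, eo k}
   & has (fun p => if p.2 is Some _ then true else false) reps ->
     exists2 k, k \in [seq p.1 | p <- reps] & exists sh, fo k sh].
Proof.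
elim: reps => [//|[k [sh|]] reps IH] /= /andP[H /IH[H1 H2 H3]]; split=> //.
- by move=> k'; rewrite inE => /predU1P[->|/H1//]; left; exists sh.
- by exists k; [exact: mem_head | exists sh].
- by move=> k'; rewrite inE => /predU1P[->|/H1//]; right.
- by move=> /H2 H2' k'; rewrite inE => /predU1P[->|/H2'].
- by move=> /H3[k' k'r E]; exists k' => //; rewrite inE k'r orbT.
Qed.

Lemma vrepsP (ok : vec * seq kill -> bool) vreps : all ok vreps ->
  {in [seq p.1 | p <- vreps], forall v, exists2 p, p.1 = v & ok p}.
Proof.
elim: vreps => [//|p s IH] /= /andP[okp /IH H] v; rewrite inE => /predU1P[->|/H//].
by exists p.
Qed.

Lemma pathsP (ok : key -> seq key -> bool) (k0 : key) (ks : seq key) (paths : seq (seq key)) :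
  size paths = size ks ->
  all (fun p => if p.2 is k :: s then [&& keq k p.1, ok k s & keq (last k s) k0] else false) (zip ks paths) ->
  {in ks, forall k, exists2 s, ok k s & last k s = k0}.
Proof.
elim: ks paths => [|k ks IH] [|p paths] //= [sp] /andP[H /(IH _ sp) IHk] k'.
rewrite inE => /predU1P[->|/IHk//].
by case: p H => [//|a s] /and3P[/keqP <- oka /keqP E]; exists s.
Qed.

Lemma crt_sym T (r : T -> T -> Prop) x y : (forall a b, r a b -> r b a) ->
  clos_refl_trans T r x y -> clos_refl_trans T r y x.
Proof.
move=> rs; elim=> [a b /rs|a|a b c _ H1 _ H2]; [exact: rt_step | exact: rt_refl |].
exact: rt_trans H2 H1.
Qed.

Lemma cv_nil_dim (R : realType) n d : ~ has_dim d (cv (R := R) (n := n) [::]).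
Proof.
have nil0 : {in [::], forall z : 'rV[R]_n, dot 0 z = 1} by [].
by move=> /(has_dim_cv _ (oner_neq0 R) nil0); rewrite /rk /spn big_nil mxrank0.
Qed.

Section Soundness.
Context {R : realType}.
Variables (n : nat) (w : vec) (N : Z) (V : seq vec).
Hypothesis sw : size w = n.
Hypothesis w0 : all (fun a => 0 <? a)%Z w.
Hypothesis N0 : (0 <? N)%Z.
Hypothesis VN : all (fun z => (size z == n) && (zdot (hmul w z) z =? N)%Z) V.
Hypothesis VU : uniq V.
Hypothesis n3 : (2 < n)%N.
Variables (L : seq key).
Hypothesis FR : {in L, forall k, zrank n (verts w V k) = n /\ (0 <? kK k)%Z}.
Notation zr := (@zr R).

Section Fixed.
Variable Phi : 'M[R]_n.
Hypothesis aPhi : adm w N Phi.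
Notation phi := (phi Phi).
Notation pcv := (pcv Phi).
Notation PP := (PP w V L Phi).
Notation VS := (VS V Phi).

Definition joined (P : set (set 'rV[R]_n)) := clos_refl_trans _
  (fun F1 F2 => [/\ P F1, P F2 & share_ridge P F1 F2]).

Lemma path_joined k s : path_ok n w V L k s -> joined PP (pcv (verts w V k)) (pcv (verts w V (last k s))).
Proof.
elim: s k => [|k' s IH] k /=; first by move=> _; exact: rt_refl.
rewrite kmemP => /and3P[kL /adjP[s1 s2 rG] ok].
have k'L : k' \in L by move: ok; case: (s) => [|? ?] /=; rewrite kmemP => /andP[].
apply: rt_trans (IH _ ok); apply: rt_step; split; [by exists k | by exists k' |].
have [GE f1] := supportsP sw w0 N0 VN aPhi s1; have [_ f2] := supportsP sw w0 N0 VN aPhi s2.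
have dG : has_dim (n - 2) (pcv [seq z <- verts w V k | in_key w k' z]).
  apply/(has_dim_verts sw w0 N0 FR aPhi _ kL) => [z|]; first by rewrite mem_filter => /andP[].
  by rewrite rG; have [->] := arith_n n3.
by eexists; split; [split; [exact: dG | exists (pcv (verts w V k)) => //; exists k] | exact: f1 | exact: f2].
Qed.

Hypothesis HR : {in L, forall k G, face (pcv (verts w V k)) G -> has_dim (n - 2) G ->
  exists F F', F <> F' /\ [set F0 | PP F0 /\ face F0 G] = [set F; F']}.
Hypothesis HK : {in L, forall k G, face (pcv (verts w V k)) G -> has_dim (n - 3) G ->
  exists (k : nat) (F Rd : 'I_k -> set 'rV[R]_n),
      [/\ peak_cycle PP G F Rd, angles_sum_2pi G F & winds_once G F]}.
Hypothesis HE : {in L, forall k E, face (pcv (verts w V k)) E -> has_dim 1 E -> unit_segment E}.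
Hypothesis HC : {in L, forall k F, PP F -> pcv (verts w V k) <> F ->
  share_ridge PP (pcv (verts w V k)) F ->
  ~ exists H, [/\ hyperplane H, pcv (verts w V k) `<=` H & F `<=` H]}.
Hypothesis HX : {in L, forall k, foldF VS (pcv (verts w V k)) \/ extF VS (pcv (verts w V k))}.
Variable k0 : key.
Hypothesis HJ : {in L, forall k, joined PP (pcv (verts w V k)) (pcv (verts w V k0))}.
Hypothesis HV : {in V, forall v, (exists2 F, PP F & F (phi v)) /\
  forall F, facets (hull VS) F -> unit_edge_facet F -> F (phi v) -> exists2 F', PP F' & F' `<=` F}.
Hypothesis V0 : \sum_(z <- V) phi z = 0.
Hypothesis k0L : k0 \in L.

Let Vn : rk [seq phi z | z <- V] = n.
Proof.
apply/eqP; rewrite eqn_leq rank_leq_col /=; have [rk0 _] := FR k0L.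
rewrite -[leqLHS]rk0 -(rk_phi sw w0 N0 aPhi); apply: rkS => _ /mapP[z /verts_sub zV ->].
exact: map_f.
Qed.

Let sph : on_sphere [seq phi z | z <- V] := phi_sphere sw N0 VN aPhi (fun z zV => zV).
Let sphk k : on_sphere [seq phi z | z <- verts w V k] := phi_sphere sw N0 VN aPhi (@verts_sub w V k).

Let Vnil : [seq phi z | z <- V] != [::].
Proof.
by apply/eqP => E; move: n3; rewrite -Vn E /rk /spn big_nil mxrank0.
Qed.

Let n0 : (0 < n)%N. Proof. exact: ltn_trans n3. Qed.

Let lev k : {in [seq phi z | z <- verts w V k],
  forall x, dot (phi (kr k)) x = zr (kK k) / zr N}.
Proof. by move=> _ /mapP[z zk ->]; apply: (verts_level sw N0 aPhi zk). Qed.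

Let rkk k : k \in L -> rk [seq phi z | z <- verts w V k] = n.
Proof. by move=> /FR[r _]; rewrite (rk_phi sw w0 N0 aPhi). Qed.

Let K0 k : k \in L -> zr (kK k) / zr N != 0 := kK_neq0 N0 FR (k := k).

Let level_eq F c b c' b' : PP F -> c != 0 -> c' != 0 -> F `<=` level c b -> F `<=` level c' b' ->
  level c b = level c' b'.
Proof.
move=> [k kL ->] c0 c'0 H H'.
have sub d e : pcv (verts w V k) `<=` level d e ->
    {in [seq phi z | z <- verts w V k], forall z, dot d z = e}.
  by move=> Hd z zk; apply: Hd; apply: mem_cv.
have [_ ->] := level_unique (K0 kL) c0 (rkk kL) (@lev k) (sub _ _ H).
by have [_ ->] := level_unique (K0 kL) c'0 (rkk kL) (@lev k) (sub _ _ H').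
Qed.

Let kr0 k : k \in L -> phi (kr k) != 0.
Proof.
move=> kL; apply: contra (K0 kL) => /eqP c0; have := rkk kL.
case E : [seq phi z | z <- verts w V k] => [|z s].
  by rewrite /rk /spn big_nil mxrank0 => r0; move: n3; rewrite -r0.
by rewrite -(@lev k z) ?E ?mem_head // c0 dot0l eqxx.
Qed.

Let dim_F k : k \in L -> has_dim (n - 1) (pcv (verts w V k)).
Proof.
move=> kL; apply/(has_dim_cv _ (K0 kL) (@lev k)).
by rewrite rkk // subn1 prednK.
Qed.

Lemma PP_polytope : polytope PP.
Proof.
split.
- rewrite (_ : PP = [set pcv (verts w V k) | k in [set` L]]).
    by apply: finite_image; exact: finite_seq.
  by apply/seteqP; split=> F [k kL E]; exists k.
- move=> _ [k kL ->]; split; last exact: dim_F.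
  by eexists; split; last reflexivity; exact: finite_seq.
- by move=> G [dG [_ [k kL ->] fG]]; apply: HR kL _ fG dG.
- by move=> G [dG [_ [k kL ->] fG]]; apply: HK kL _ fG dG.
- move=> _ _ [k kL ->] [k' k'L ->]; apply: rt_trans (HJ kL) _.
  apply: crt_sym (HJ k'L) => A B [PA PB [G [rG fA fB]]]; split=> //.
  by exists G.
- move=> _ [k kL ->]; rewrite pcvE (aff_cv_full (K0 kL) (@lev k) (rkk kL)); split.
    by exists (phi (kr k)), (zr (kK k) / zr N); split=> //; exact: kr0.
  by move/eqP; rewrite dot0r eq_sym; apply/negP; exact: K0.
- by move=> _ F' [k kL ->] PF' ne sh; apply: HC kL _ PF' ne sh.
Qed.

Lemma PP_unit_edge : unit_edge PP.
Proof. by move=> E [dE [_ [k kL ->] fE]]; apply: HE kL _ fE dE. Qed.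

Lemma PP_vertex_set : vertex_set PP = VS.
Proof.
apply/seteqP; split=> [v [_ [_ [k kL ->] /(face_vertex v (@sphk k))]]|_ /mapP[z zV ->]].
  by move=> /mapP[z /verts_sub zV ->]; apply: map_f.
have [[_ [k kL ->] Fz] _] := HV zV.
have vk := cv_sphere (@sphk k) (dphi_self sw N0 VN aPhi zV) Fz.
split; last by exists (pcv (verts w V k)); [exists k | apply/face_vertex].
rewrite -cv1; apply/(has_dim_cv _ (K0 kL) (c := phi (kr k))) => [x|].
  by rewrite inE => /eqP ->; apply: lev.
rewrite /rk /spn big_seq1 genmxE rank_rV.
suff -> : phi z != 0 by [].
by rewrite -dot_eq0 (dphi_self sw N0 VN aPhi) // oner_eq0.
Qed.

Let facet_tight F : facets (hull VS) F -> exists c b,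
  [/\ 0 < b, c != 0, VS `<=` halfspace c b, F = cv (tight c b [seq phi z | z <- V])
    & F `<=` level c b].
Proof.
move=> /(facet_hull n0 _ Vn Vnil); rewrite big_map => /(_ V0)[c [b [b0 c0 H FE _]]].
exists c, b; split=> //; rewrite FE; apply: cv_level => z.
by rewrite mem_filter => /andP[/eqP].
Qed.

Lemma fold_not_facet F : PP F -> foldF VS F -> ~ facets (hull VS) F.
Proof.
move=> PF [c [b [c0 Fl ne _]]] /facet_tight[c' [b' [_ c'0 le _ Fl']]]; apply: ne.
by exists c', b'; split=> //; apply: level_eq Fl Fl'.
Qed.

Lemma PP_case F : PP F -> foldF VS F \/ extF VS F. Proof. by move=> [k kL ->]; apply: HX. Qed.

Lemma ext_not_internal F H : PP F -> extF VS F -> F `<=` H -> ~ internal VS H.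
Proof.
move=> PF [_ [c [b [c0 _ le Fl _]]]] FH [[c' [b' [c'0 HE']]]]; apply.
rewrite HE' in FH *; exists c, b; split=> //; exact: level_eq PF c'0 c0 FH Fl.
Qed.

Lemma PP_creased : creased PP.
Proof.
rewrite /creased PP_vertex_set; split=> F H PF.
  move=> [c [b [c0 HE' le]]] FH; case: (PP_case PF) => [[c' [b' [c'0 Fl ne _]]]|[_ [c' [b' [c'0 _ _ Fl sub]]]]].
    by exfalso; apply: ne; exists c, b; split=> //; rewrite HE' in FH; exact: level_eq PF _ _ Fl FH.
  by rewrite HE' in FH *; rewrite (level_eq PF c0 c'0 FH Fl).
move=> int FH; case: (PP_case PF) => [[c' [b' [c'0 Fl _ sh]]]|ex]; last first.
  by case: (ext_not_internal PF ex FH int).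
have [[c [b [c0 HE']]] _] := int.
by rewrite HE' in FH *; rewrite (level_eq PF c0 c'0 FH Fl).
Qed.

Lemma PP_fold : [set F | fold PP F] = [set F | PP F /\ ~ facets (hull VS) F].
Proof.
apply/seteqP; split=> F [PF]; rewrite ?PP_vertex_set.
  move=> [H [int FH]]; split=> //; case: (PP_case PF) => [|ex]; first exact: fold_not_facet.
  by case: (ext_not_internal PF ex FH int).
move=> nf; split=> //; case: (PP_case PF) => [[c [b [c0 Fl ne _]]]|[]//].
by exists (level c b); rewrite PP_vertex_set; split=> //; split=> //; exists c, b.
Qed.

(** The vertex search puts a listed F' inside F. The hyperplane of F supports V, so F' is no fold;
    being external, F' contains all points of V on its hyperplane, which is that of F. *)
Lemma unit_facet_PP F : facets (hull VS) F -> unit_edge_facet F -> PP F /\ extF VS F.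
Proof.
move=> fF ue; have [c [b [b0 c0 le FE Fl]]] := facet_tight fF.
have [_ dF] := fF.
have [x] : exists x, x \in tight c b [seq phi z | z <- V].
  case E : (tight c b _) => [|x s]; last by exists x; rewrite mem_head.
  by exfalso; move: dF; rewrite FE E; apply: cv_nil_dim.
move=> xt; have := xt; rewrite mem_filter => /andP[_ /mapP[z zV xE]].
have [_ H] := HV zV.
have [F' PF' sub] : exists2 F', PP F' & F' `<=` F.
  by apply: H => //; rewrite -xE FE; apply: mem_cv.
have F'l : F' `<=` level c b by apply: subset_trans Fl.
case: (PP_case PF') => [[c' [b' [c'0 Fl' ne _]]]|ex].
  by exfalso; apply: ne; exists c, b; split=> //; exact: level_eq PF' _ _ Fl' F'l.
have [_ [c' [b' [c'0 _ _ Fl' mem]]]] := ex.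
suff -> : F = F' by [].
apply/seteqP; split=> //; rewrite FE; have [k kL F'E] := PF'.
apply: cv_sub; first by rewrite F'E; apply: convex_cv.
move=> y; rewrite mem_filter => /andP[/eqP cy yV]; apply: mem.
by rewrite (level_eq PF' c'0 c0 Fl' F'l).
Qed.

Lemma PP_unit_facets : [set F | PP F /\ exists H, external VS H /\ F `<=` H] =
  [set F | facets (hull VS) F /\ unit_edge_facet F].
Proof.
apply/seteqP; split=> F.
  move=> [PF [H [[c [b [c0 HE' le]]] FH]]].
  have fF : facets (hull VS) F.
    case: (PP_case PF) => [[c' [b' [c'0 Fl ne _]]]|[]//].
    by exfalso; apply: ne; exists c, b; split=> //; rewrite HE' in FH; exact: level_eq PF _ _ Fl FH.
  by split=> // E fE dE; have [k kL FE] := PF; rewrite FE in fE; apply: HE kL _ fE dE.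
move=> [fF ue]; have [PF [_ [c [b [c0 _ le Fl _]]]]] := unit_facet_PP fF ue.
by split=> //; exists (level c b); split=> //; exists c, b.
Qed.

(* The points of [V] have mean 0, so a nonzero supporting functional has a positive maximum. *)
Lemma tset_pos c b : valid Phi c b V -> (zrank n (tset Phi c b V) < n)%N -> 0 < b.
Proof.
move=> H rT.
have slack z : z \in V -> 0 <= b - dot c (phi z) by move=> zV; rewrite subr_ge0 H.
have S : \sum_(z <- V) (b - dot c (phi z)) = b *+ size V.
  rewrite sumrB -dot_sumr V0 dot0r subr0 big_const_seq count_predT iter_addr_0 //.
have sV : (0 < size V)%N by rewrite lt0n size_eq0; apply: contraNneq Vnil => ->.
have b0 : 0 <= b *+ size V by rewrite -S big_seq; apply: sumr_ge0.
rewrite pmulrn_lge0 // in b0; rewrite lt0r b0 andbT; apply/eqP => bE.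
move: S; rewrite bE mul0rn in slack * => /eqP; rewrite big_seq psumr_eq0 // => /allP E.
have all_t : tset Phi c 0 V = V.
  apply/all_filterP/allP => z zV; have := E z zV; rewrite zV /= sub0r oppr_eq0 //.
by move: rT; rewrite bE all_t -(rk_phi sw w0 N0 aPhi) Vn ltnn.
Qed.

Lemma convex_vertex v : v \in V -> convex_at w N V v ->
  forall F E, facets (hull VS) F -> face F E -> has_dim 1 E -> E (phi v) -> unit_segment E.
Proof.
move=> vV cvx F E /facet_tight[c [b [b0 c0 le FE Fl]]] fE dE Ev.
have H : valid Phi c b V by move=> z zV; apply: le; apply: map_f.
have FT : F = pcv (tset Phi c b V) by rewrite FE /tight filter_map.
have [c1 [b1 [H1 EE]]] := (pface Phi _ _).1 (eq_ind F (fun X => face X E) fE _ FT).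
(* An edge of a facet of the hull is cut out by a single functional valid on all of V, the form in
   which [convex_edge] applies. *)
have [c2 [b2 [H2 ET]]] : exists c2 b2, valid Phi c2 b2 V /\
    tset Phi c1 b1 (tset Phi c b V) = tset Phi c2 b2 V.
  have [||c2 [b2 [H2 E2]]] := @tight_trans R n [seq phi z | z <- V] c b c1 b1.
  - by move=> _ /mapP[z zV ->]; apply: H.
  - by move=> x; rewrite mem_filter => /andP[cx /mapP[z zV xE]]; rewrite xE in cx *; apply: H1;
      rewrite mem_filter cx.
  exists c2, b2; split=> [z zV|]; first by apply: H2; apply: map_f.
  apply/esym; have phiI : {in V &, injective phi}.
    by move=> x y xV yV; apply: (phi_inj sw w0 N0 aPhi); apply: (Vsize VN).
  move: E2; rewrite /tight !filter_map => /(congr1 (fun s => [seq z <- V | phi z \in s])).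
  have filt (p : pred vec) (s : seq vec) : {subset s <= V} ->
      forall z, z \in V -> (phi z \in [seq phi z | z <- s]) = (z \in s).
    by move=> sV z zV; apply/idP/idP => [/mapP[y ys /(phiI _ _ zV (sV _ ys)) ->]|/(map_f phi)].
  have filt2 (q : pred vec) : [seq z <- V | phi z \in [seq phi z | z <- [seq z <- V | q z]]] = [seq z <- V | q z].
    apply: eq_in_filter => z zV; rewrite filt // ?mem_filter ?zV ?andbT // => y.
    by rewrite mem_filter => /andP[].
  rewrite filt2 /tset -filter_predI filt2 => ->.
  by apply: eq_filter.
rewrite ET in EE; set T := tset Phi c2 b2 V in EE.
have TV : {subset T <= V} := @tset_sub _ _ _ c2 b2 V.
have Tl z : z \in T -> dot c (phi z) = b.
  by rewrite /T -ET !mem_filter => /and3P[_ /eqP].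
have rT : zrank n T = 2.
  have := dE; rewrite EE => /(has_dim_cv _ (lt0r_neq0 b0) (c := c)).
  rewrite (rk_phi sw w0 N0 aPhi); apply => _ /mapP[z zT ->]; exact: Tl.
have b20 : 0 < b2 by apply: (tset_pos H2); rewrite -/T rT.
have [x [y [xT yT xy only]]] := two_points sw w0 N0 VN aPhi TV (lt0r_neq0 b0) Tl rT.
have vT : v \in T.
  apply: (phi_mem sw w0 N0 VN aPhi vV TV).
  apply: (cv_sphere (phi_sphere sw N0 VN aPhi TV) (dphi_self sw N0 VN aPhi vV)).
  by rewrite -[cv _]/(pcv T) -EE.
have [u [uT vu onlyu]] : exists u, [/\ u \in T, v != u & forall z, z \in T -> z = v \/ z = u].
  case: (only v vT) => ->; [exists y | exists x]; split=> //; first by rewrite eq_sym.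
  by move=> z /only[]; auto.
have -> : E = cv [:: phi v; phi u].
  rewrite EE; apply: (@eq_pcv R n Phi T [:: v; u]) => z; rewrite !inE.
  by apply/idP/orP => [/onlyu[->|->]|[]/eqP ->] //; rewrite eqxx; auto.
apply: unit_segment_cv; rewrite ?(dphi_self sw N0 VN aPhi) ?TV //.
exact: (convex_edge sw w0 N0 VN aPhi cvx b20 H2 vT uT vu onlyu).
Qed.

Lemma convex_unit F : {in V, forall v, forall F E, facets (hull VS) F -> face F E -> has_dim 1 E ->
    E (phi v) -> unit_segment E} -> facets (hull VS) F -> unit_edge_facet F.
Proof.
move=> H fF E fE dE; have [c [b [b0 c0 le FE Fl]]] := facet_tight fF.
rewrite FE in fE; have [c1 [b1 [_ EE]]] := (face_cv _ _).1 fE.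
case tE : (tight c1 b1 _) EE => [|x s] EE.
  by exfalso; move: dE; rewrite EE; apply: cv_nil_dim.
have xt : x \in tight c1 b1 (tight c b [seq phi z | z <- V]) by rewrite tE mem_head.
have /mapP[z zV xE] : x \in [seq phi z | z <- V] by move: xt; rewrite !mem_filter => /and3P[].
apply: (H z zV F) => //; first by rewrite FE.
by rewrite -xE EE; apply: mem_cv; rewrite mem_head.
Qed.

End Fixed.
End Soundness.

(** The conclusion of the theorem for an arbitrary n: soundness concerns any certificate, whose
    dimension is a field of a record and not [cdim c]. *)
Definition carries_creased {R : realType} {n} (b : bool) (V : set 'rV[R]_n) : Prop :=
  exists P : set (set 'rV[R]_n),
    [/\ polytope P, unit_edge P & vertex_set P = V] /\
    (if b then P = facets (hull V) else ~ convex P /\ P <> facets (hull V)) /\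
    creased P /\
    [set F | P F /\ exists H, external V H /\ F `<=` H] =
      [set F | facets (hull V) F /\ unit_edge_facet F] /\
    [set F | fold P F] = [set F | P F /\ ~ facets (hull V) F].

Lemma vuniqE (s : seq vec) : vuniq s = uniq s.
Proof. by elim: s => //= x s ->; rewrite vmemP; case: (x \in s). Qed.

Lemma cfg_sound (R : realType) b (C : cfg) (Phi : 'M[R]_(c_n C)) : cfg_ok b C -> (2 < c_n C)%N ->
  adm (c_w C) (c_N C) Phi -> carries_creased b (VS (c_V C) Phi).
Proof.
case: C Phi => n w N V gs reps paths vreps; rewrite [c_n _]/= [c_w _]/= [c_N _]/= [c_V _]/=.
move=> Phi ok n3 aPhi; move: ok; rewrite /cfg_ok.
set rk0 := [seq p.1 | p <- reps]; set vr := [seq p.1 | p <- vreps].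
set k0 := head _ rk0; pose L0 := orbit_list kmem kact gs 100 rk0 rk0.
(* [L] becomes a variable known only through an equation, which keeps the orbit from being
   unfolded. *)
rewrite -/L0; have [L LE] : {L | L = L0} by exists L0.
rewrite -LE.
move=> /and5P[/and5P[/eqP sw w0 N0 VN /andP[vU /veqP V0]] /and4P[gsok gsV gsL VO]].
move=> /andP[/andP[rk_n /eqP sp] pok] sh /and3P[/allP rok vok cvx].
have VU : uniq V by rewrite -vuniqE.
have rkL : {subset rk0 <= L} by rewrite LE; apply: orbit_seen.
have rep k : k \in rk0 -> rep_ok n w N V L k.
  by move=> kr; have := rok; rewrite -/(all _ _) => /allP; rewrite -(all_map fst (rep_ok n w N V L)) => /allP; apply.
have vrok := vrepsP vok.
have vrV : {subset vr <= V}.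
  by move=> v /vrok[p <-] /and5P[]; rewrite vmemP.
have FR : {in L, forall k, zrank n (verts w V k) = n /\ (0 <? kK k)%Z}.
  apply: (FR_transfer sw w0 N0 VN VU gsok gsV gsL LE aPhi) => k /rep.
  by move=> /and5P[/eqP].
have k0r : k0 \in rk0 by rewrite /k0; case: (rk0) rk_n => //= a s _; exact: mem_head.
have k0L := rkL _ k0r.
have [fe ce ff] := repsP sh.
have paths_ok := pathsP (k0 := k0) (ks := rk0 ++ [seq kact g k0 | g <- gs]) (ok := path_ok n w V L)
  (etrans sp _) pok.
have {}paths_ok := paths_ok (esym (etrans (size_cat _ _) (congr1 (addn _) (size_map _ _)))).
have KT (Q : set 'rV[R]_n -> set (set 'rV[R]_n) -> set 'rV[R]_n -> Prop) H :=
  key_transfer sw w0 N0 VN VU gsok gsV gsL LE (Q := Q) H aPhi.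
have HR : {in L, forall k G, face (pcv Phi (verts w V k)) G -> has_dim (n - 2) G ->
  exists F1 F2, F1 <> F2 /\ [set F0 | PP w V L Phi F0 /\ face F0 G] = [set F1; F2]}.
  apply: (KT (fun U P F => forall G, face F G -> has_dim (n - 2) G ->
    exists F1 F2, F1 <> F2 /\ [set F0 | P F0 /\ face F0 G] = [set F1; F2])).
  by move=> Psi aPsi k kr G; exact: (rep_ridge sw w0 N0 VN n3 FR aPsi (rkL _ kr) (rep _ kr)).
have HK : {in L, forall k G, face (pcv Phi (verts w V k)) G -> has_dim (n - 3) G ->
  exists (k : nat) (F Rd : 'I_k -> set 'rV[R]_n),
      [/\ peak_cycle (PP w V L Phi) G F Rd, angles_sum_2pi G F & winds_once G F]}.
  apply: (KT (fun U P F => forall G, face F G -> has_dim (n - 3) G ->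
    exists (k : nat) (F Rd : 'I_k -> set 'rV[R]_n),
      [/\ peak_cycle P G F Rd, angles_sum_2pi G F & winds_once G F])).
  by move=> Psi aPsi k kr G; exact: (rep_peak sw w0 N0 VN n3 FR aPsi (rkL _ kr) (rep _ kr)).
have HE : {in L, forall k E, face (pcv Phi (verts w V k)) E -> has_dim 1 E -> unit_segment E}.
  apply: (KT (fun U P F => forall E, face F E -> has_dim 1 E -> unit_segment E)).
  by move=> Psi aPsi k kr E; exact: (rep_edge sw w0 N0 VN VU FR aPsi (rkL _ kr) (rep _ kr)).
have HC : {in L, forall k F, PP w V L Phi F -> pcv Phi (verts w V k) <> F ->
  share_ridge (PP w V L Phi) (pcv Phi (verts w V k)) F ->
  ~ exists H, [/\ hyperplane H, pcv Phi (verts w V k) `<=` H & F `<=` H]}.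
  apply: (KT (fun U P F => forall F', P F' -> F <> F' -> share_ridge P F F' ->
    ~ exists H, [/\ hyperplane H, F `<=` H & F' `<=` H])).
  by move=> Psi aPsi k kr F; exact: (rep_crease sw w0 N0 VN n3 FR aPsi (rkL _ kr) (rep _ kr)).
have HX : {in L, forall k, foldF (VS V Phi) (pcv Phi (verts w V k)) \/ extF (VS V Phi) (pcv Phi (verts w V k))}.
  apply: (KT (fun U P F => foldF U F \/ extF U F)) => Psi aPsi k kr.
  case: (fe k kr) => [[sh' fo]|eo]; [left | right].
    exact: (fold_sound sw w0 N0 VN n3 aPsi FR (rkL _ kr) fo).
  exact: (ext_sound sw w0 N0 n3 aPsi FR (rkL _ kr) eo).
have sumV (Psi : 'M[R]_n) : \sum_(z <- V) phi Psi z = 0 :> 'rV[R]_n.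
  rewrite -phi_vsum V0 /phi (_ : toRow n _ = 0) ?mul0mx //; apply/rowP => i.
  by rewrite !mxE (nth_map 0%Z) ?sw.
have rkV (Psi : 'M[R]_n) : adm w N Psi -> rk [seq phi Psi z | z <- V] = n.
  move=> aPsi; apply/eqP; rewrite eqn_leq rank_leq_col /=.
  have [e _] := FR _ k0L; rewrite -[leqLHS]e -(rk_phi sw w0 N0 aPsi); apply: rkS => _ /mapP[z /verts_sub zV ->].
  exact: map_f.
have HV := vec_transfer sw w0 N0 VN VU gsok gsV gsL vrV VO (Q := fun U P x =>
  (exists2 F, P F & F x) /\
  forall F, facets (hull U) F -> unit_edge_facet F -> F x -> exists2 F', P F' & F' `<=` F) _ aPhi.
have {}HV : {in V, forall v, (exists2 F, PP w V L Phi F & F (phi Phi v)) /\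
  forall F, facets (hull (VS V Phi)) F -> unit_edge_facet F -> F (phi Phi v) ->
    exists2 F', PP w V L Phi F' & F' `<=` F}.
  apply: HV => Psi aPsi v vvr; have vV := vrV v vvr; have [p pv okp] := vrok v vvr; split.
    have /and5P[_ /hasP[k kL kv] _ _ _] := okp; exists (pcv Psi (verts w V k)); first by exists k.
    by apply: mem_cv; apply: map_f; rewrite mem_filter -pv kv pv.
  move=> F fF ue Fv.
  have S0 : \sum_(z <- [seq phi Psi z | z <- V]) z = 0 by rewrite big_map; exact: sumV.
  have rV := rkV Psi aPsi.
  have [|c [m [b0 c0 H FE rF]]] := facet_hull (ltn_trans (isT : (0 < 2)%N) n3) S0 rV _ fF.
    by apply/eqP => E; move: n3; rewrite -rV E /rk /spn big_nil mxrank0.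
  have FT : F = pcv Psi (tset Psi c m V) by rewrite FE /tight filter_map.
  have Hv : valid Psi c m V by move=> z zV; apply: H; apply: map_f.
  have [k kL sub] : exists2 k, k \in L & {subset verts w V k <= tset Psi c m V}.
    apply: (vf_sound sw w0 N0 VN aPsi FR okp b0 Hv); rewrite -?FT //.
      by rewrite -(rk_phi sw w0 N0 aPsi) -[RHS]rF /tight filter_map.
    rewrite pv mem_filter vV andbT; apply/eqP.
    have : F `<=` level c m by rewrite FE; apply: cv_level => x; rewrite mem_filter => /andP[/eqP].
    exact.
  exists (pcv Psi (verts w V k)); first by exists k.
  by rewrite FT; apply: cv_sub; [exact: convex_cv | move=> _ /mapP[z /sub zT ->]; apply: mem_cv; apply: map_f].

have HJ : {in L, forall k, joined (PP w V L Phi) (pcv Phi (verts w V k)) (pcv Phi (verts w V k0))}.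
  apply: (key_ind sw gsok gsV gsL LE (P := fun Psi k =>
    joined (PP w V L Psi) (pcv Psi (verts w V k)) (pcv Psi (verts w V k0))) _ _ aPhi).
    move=> Psi aPsi k kr; have [|s ps <-] := paths_ok k; first by rewrite mem_cat kr.
    exact: (path_joined sw w0 N0 VN n3 FR aPsi ps).
  move=> i g0 il g Psi aPsi k kL.
  have go : gen_ok n w g by move/(all_nthP g0): gsok; apply.
  have gV : all (fun z => gexact g z && vmem (gact g z) V) V by move/(all_nthP g0): gsV; apply.
  have gL : all (fun k => kexact g k && kmem (kact g k) L) L by move/(all_nthP g0): gsL; apply.
  rewrite (PP_gmx sw w0 N0 VN VU go gV gL aPsi) !(pcv_kact sw w0 N0 VN VU go gV gL aPsi) //.
  (* The path from k, moved by g, ends at the image of the first representative; a certified path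
     leads back from there. *)
  move=> J; apply: rt_trans J _.
  have [|s ps E] := paths_ok (kact g k0); last by have := path_joined sw w0 N0 VN n3 FR aPsi ps; rewrite E.
  by rewrite mem_cat; apply/orP; right; apply/(nthP k0); exists i; rewrite ?size_map // (nth_map g0).
exists (PP w V L Phi); split; [split|split; [|split; [|split]]].
- exact: (PP_polytope sw w0 N0 n3 FR aPhi HR HK HC HJ).
- exact: (PP_unit_edge HE).
- exact: (PP_vertex_set sw N0 VN FR aPhi HV).
(* In the non-convex case one fold suffices, being no facet of the hull. In the convex case the
   absence of folds makes all listed facets facets of the hull, and [convex_vertex] makes every
   facet of the hull unit-edge, hence listed. *)
- case: b cvx => [/andP[/allP cv_at /ce eo]|/ff[k kr [sh' fo]]]; last first.
    set F := pcv Phi (verts w V k); have PF : PP w V L Phi F by exists k => //; exact: rkL.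
    have nf := fold_not_facet sw w0 N0 n3 FR aPhi (sumV Phi) k0L PF (fold_sound sw w0 N0 VN n3 aPhi FR (rkL _ kr) fo).
    have ne : PP w V L Phi <> facets (hull (VS V Phi)) by move=> E; apply: nf; rewrite -E.
    by split=> //; rewrite /convex (PP_vertex_set sw N0 VN FR aPhi HV).
  apply/seteqP; split=> F.
    move=> [k kL ->]; move: k kL; apply: (KT (fun U P F => facets (hull U) F)) => Psi aPsi k kr.
    by have [] := ext_sound sw w0 N0 n3 aPsi FR (rkL _ kr) (eo k kr).
  move=> fF; have [] // := unit_facet_PP sw w0 N0 n3 FR aPhi HX HV (sumV Phi) k0L fF.
  apply: (convex_unit sw w0 N0 n3 FR aPhi (sumV Phi) k0L) => // v vV.
  have VT := vec_transfer sw w0 N0 VN VU gsok gsV gsL vrV VO (Q := fun U P x =>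
    forall F E, facets (hull U) F -> face F E -> has_dim 1 E -> E x -> unit_segment E) _ aPhi vV.
  apply: VT => Psi aPsi v' v'vr.
  exact: (convex_vertex sw w0 N0 VN n3 FR aPsi (sumV Psi) k0L (vrV _ v'vr) (cv_at v' v'vr)).
- exact: (PP_creased sw w0 N0 VN FR aPhi HX HV).
- exact: (PP_unit_facets sw w0 N0 n3 FR aPhi HE HX HV (sumV Phi) k0L).
- exact: (PP_fold sw w0 N0 VN n3 FR aPhi HX HV (sumV Phi) k0L).
Qed.

(** * The configurations *)

(** Coordinates are doubled to make the half-integral vectors integral. *)
Definition sg2 (s : bool) : Z := if s then (-2)%Z else 2%Z.

Definition zphi (m : nat) : seq vec :=
  [seq [seq if k == p.1 then sg2 q.1 else if k == p.2 then sg2 q.2 else 0%Z | k <- iota 0 m]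
    | p <- [seq (i, j) | i <- iota 0 m, j <- iota i.+1 (m - i.+1)],
      q <- [:: (false, false); (false, true); (true, false); (true, true)]].

Definition zaxes (m : nat) : seq vec :=
  [seq [seq if k == i then sg2 s else 0%Z | k <- iota 0 m] | i <- iota 0 m, s <- [:: false; true]].

Fixpoint zhalf (m : nat) (odd : bool) : seq vec :=
  if m is m'.+1 then [seq 1%Z :: z | z <- zhalf m' odd] ++ [seq (-1)%Z :: z | z <- zhalf m' (~~ odd)]
  else if odd then [::] else [:: [::]].

Definition zcolor (c : color) : seq vec :=
  match c with A => zaxes 4 | B => zhalf 4 false | Defs.C => zhalf 4 true end.

Definition zext (b : Z) (W : seq vec) : seq vec := [seq rcons z b | z <- W].

(* Twice the cosine and 2/sqrt 3 times the sine of k pi / 3. *)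
Definition zhex (k : nat) : Z * Z :=
  nth (0, 0)%Z [:: (2, 0); (1, 1); (-1, 1); (-2, 0); (-1, -1); (1, -1)]%Z k.

Definition zX (c : seq color) : seq vec :=
  zext 0 (zext 0 (zphi 4)) ++
  flatten [seq zext (zhex k).2 (zext (zhex k).1 (zcolor (nth A c k))) | k <- iota 0 6].

Definition zE7 (lower : bool) : seq vec :=
  zext 0 (zphi 6) ++ zext 2 [:: nseq 6 0%Z] ++ zext (-2) [:: nseq 6 0%Z] ++
  zext 1 (zhalf 6 false) ++ zext (-1) (zhalf 6 lower).

Definition zL5 : seq vec := zext 0 (zphi 4) ++ zext 2 (zaxes 4) ++ zext (-2) (zhalf 4 true).

(** With 2 m = k <a, a>, the mirror image of x is (m x - k <x, a> a) / m; the denominator m goes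
    into the scale. *)
Definition zmirror (w : vec) (m : Z) (a : vec) (k : Z) (W : seq vec) : seq vec :=
  [seq vscale m x | x <- [seq x <- W | (0 <=? wdot w x a)%Z]] ++
  [seq vadd (vscale m x) (vscale (- (k * wdot w x a))%Z a) | x <- [seq x <- W | (0 <? wdot w x a)%Z]].

Section Link.
Context {R : realType}.
Notation zr := (@zr R).

(** A weight is the square of the irrational factor of its axis: 3 for the sines of multiples of pi
    / 3, 2 for the last axis in dimension 7. *)
Definition coord_mx n (w : vec) (s : Z) : 'M[R]_n :=
  (zr s)^-1 *: diag_mx (\row_i Num.sqrt (zr (nth 0%Z w i))).

Definition listed n (w : vec) (s : Z) (W : seq vec) (X : set 'rV[R]_n) := X = VS W (coord_mx n w s).

Lemma coord_mx_adm n w s : size w = n -> all (fun a => 0 <? a)%Z w ->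
  adm w (s * s) (coord_mx n w s).
Proof.
move=> sw /allP w0; rewrite /adm /coord_mx linearZ /= tr_diag_mx -scalemxAl -scalemxAr scalerA mulmx_diag.
rewrite zrM invfM; congr (_ *: diag_mx _); apply/rowP => i; rewrite !mxE -expr2 sqr_sqrtr //.
by rewrite ltW // -zr0 zr_lt; apply: w0; rewrite mem_nth // sw.
Qed.

Lemma phi_scale n w s z i : phi (coord_mx n w s) z 0 i =
  zr (nth 0%Z z i) * Num.sqrt (zr (nth 0%Z w i)) / zr s.
Proof. by rewrite /phi /coord_mx -scalemxAr mul_mx_diag !mxE mulrC. Qed.

Lemma listedU n w s W W' (X X' : set 'rV[R]_n) :
  listed w s W X -> listed w s W' X' -> listed w s (W ++ W') (X `|` X').
Proof.
move=> -> ->; apply/seteqP; split=> x; rewrite /VS /= map_cat mem_cat => H; first by apply/orP.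
exact/orP.
Qed.

Lemma listed_ext n w s a b W (t : R) (X : set 'rV[R]_n) : size w = n ->
  {in W, forall z, size z = n} -> zr b * Num.sqrt (zr a) / zr s = t -> listed w s W X ->
  listed (rcons w a) s (zext b W) [set ext1 x t | x in X].
Proof.
move=> sw sW tE ->.
have E z : z \in W -> phi (coord_mx (n + 1) (rcons w a) s) (rcons z b) = ext1 (phi (coord_mx n w s) z) t.
  move=> /sW sz; apply/rowP => i; rewrite phi_scale /ext1 mxE !nth_rcons sw sz.
  case: splitP => [j ij|j ij]; rewrite ij.
    by rewrite phi_scale.
  by rewrite ord1 addn0 eqxx tE mxE.
apply/seteqP; split=> [_ [_ /mapP[z zW ->] <-]|_ /mapP[_ /mapP[z zW ->] ->]].
  by rewrite -E //; apply/mapP; exists (rcons z b) => //; apply: map_f.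
by rewrite E //; exists (phi (coord_mx n w s) z) => //; apply: map_f.
Qed.

Lemma listed_flatten n w s m (W : nat -> seq vec) (X : 'I_m -> set 'rV[R]_n) :
  (forall k : 'I_m, listed w s (W k) (X k)) ->
  listed w s (flatten [seq W k | k <- iota 0 m]) (\bigcup_(k in [set: 'I_m]) X k).
Proof.
move=> H; apply/seteqP; split=> [x [k _]|_ /mapP[z /flattenP[_ /mapP[k + ->] zk] ->]].
  rewrite H => /mapP[z zk ->]; apply: map_f; apply/flattenP; exists (W k) => //.
  by apply: map_f; rewrite mem_iota /=.
rewrite mem_iota /= => km; exists (Ordinal km) => //; rewrite H; exact: map_f.
Qed.

Let w1 (m i : nat) : (i < m)%N -> Num.sqrt (zr (nth 0%Z (nseq m 1%Z) i)) = 1.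
Proof. by move=> im; rewrite nth_nseq im zr1 sqrtr1. Qed.

Let zr2 : zr 2 = 2. Proof. by []. Qed.

Let sg2E s : zr (sg2 s) / zr 2 = sgn R s.
Proof.
rewrite /sgn zr2; case: s => /=; first by rewrite expr1 -[zr _]/(- 2) mulNr divff.
by rewrite expr0 zr2 divff.
Qed.

Let nth_iota_map m (f : nat -> Z) (i : 'I_m) : nth 0%Z [seq f k | k <- iota 0 m] i = f i.
Proof. by rewrite (nth_map 0%N) ?size_iota // nth_iota. Qed.

Lemma listed_phi m : listed (nseq m 1%Z) 2 (zphi m) (@Phi_D R m).
Proof.
have E (i j : 'I_m) s t : (i < j)%N -> phi (coord_mx m (nseq m 1%Z) 2)
    [seq if k == i :> nat then sg2 s else if k == j :> nat then sg2 t else 0%Z | k <- iota 0 m] =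
    sgn R s *: @e_ R _ i + sgn R t *: @e_ R _ j.
  move=> ij; apply/rowP => k; rewrite phi_scale w1 // mulr1 nth_iota_map !mxE eqxx /=.
  rewrite -!val_eqE /=; case: eqVneq => [->|ki].
    by rewrite ltn_eqF // mulr1 mulr0 addr0 sg2E.
  by rewrite mulr0 add0r; case: eqVneq => _; rewrite ?mulr1 ?sg2E // zr0 mul0r mulr0.
apply/seteqP; split=> [x [i [j [s [t [ij ->]]]]]|_ /mapP[_ /allpairsP[[p q] [/= pm qm ->]] ->]].
  rewrite -E //; apply: map_f; apply/allpairsP; exists ((val i, val j), (s, t)); split=> //=.
    apply/allpairsPdep; exists (val i), (val j); rewrite !mem_iota; split=> //=.
    by rewrite subnKC ?ij ?ltn_ord.  
  by case: s t => [] [].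
have /allpairsPdep[i [j [im jm ->]]] := pm; rewrite mem_iota /= in im.
move: jm; rewrite mem_iota subnKC // => /andP[ij jm].
exists (Ordinal im), (Ordinal jm), q.1, q.2; split=> //.
exact: (E (Ordinal im) (Ordinal jm) q.1 q.2 ij).
Qed.

Lemma listed_axes : listed (nseq 4 1%Z) 2 (zaxes 4) (@color_set R A).
Proof.
have E (i : 'I_4) s : phi (coord_mx 4 (nseq 4 1%Z) 2)
    [seq if k == i :> nat then sg2 s else 0%Z | k <- iota 0 4] = sgn R s *: @e_ R _ i.
  apply/rowP => k; rewrite phi_scale w1 // mulr1 nth_iota_map !mxE eqxx /=.
  by rewrite -!val_eqE /=; case: eqVneq => _; rewrite ?mulr1 ?sg2E // zr0 mul0r mulr0.
apply/seteqP; split=> [x [i [s ->]]|_ /mapP[_ /allpairsP[[i s] [im _ ->]] ->]].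
  rewrite -E; apply: map_f; apply/allpairsP; exists (val i, s); split=> //.
    by rewrite mem_iota ltn_ord.
  by case: s.
by rewrite mem_iota in im; exists (Ordinal im), s; rewrite -E.
Qed.

Let sgz (b : bool) : Z := if b then (-1)%Z else 1%Z.

Lemma zhalfP m o z : z \in zhalf m o <->
  exists bs, [/\ size bs = m, odd (count id bs) = o & z = [seq sgz b | b <- bs]].
Proof.
elim: m o z => [|m IH] o z /=.
  split; first by case: o; rewrite ?inE // => /eqP ->; exists [::].
  by move=> [bs [/size0nil -> <- ->]].
rewrite mem_cat; split.
  case/orP => /mapP[z' /IH[bs [sb ob ->]] ->].
    by exists (false :: bs); rewrite /= sb.
  by exists (true :: bs); rewrite /= sb ob negbK.
move=> [[|b bs] [] // [sb] ob ->]; apply/orP; case: b ob => /= ob; [right|left];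
  apply: map_f; apply/IH; exists bs; split=> //.
by rewrite -ob negbK.
Qed.

Lemma listed_half m o : listed (nseq m 1%Z) 2 (zhalf m o) (@half_vectors R m o).
Proof.
have E (bs : bitseq) (S : {set 'I_m}) : size bs = m -> (forall i : 'I_m, (i \in S) = nth false bs i) ->
    phi (coord_mx m (nseq m 1%Z) 2) [seq sgz b | b <- bs] = \row_i (sgn R (i \in S) / 2) /\
    #|S| = count id bs.
  move=> sb HS; split.
    apply/rowP => i; rewrite phi_scale w1 // mulr1 mxE (nth_map false) ?sb // HS zr2 /sgn.
    by case: nth; rewrite /= ?expr1 ?expr0.
  rewrite -sum1_card -sum1_count (big_nth false) sb big_mkord.
  by apply: eq_bigl => i; rewrite HS.
apply/seteqP; split=> [x [S [oS ->]]|_ /mapP[_ /zhalfP[bs [sb ob ->]] ->]].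
  pose bs := [seq i \in S | i <- enum 'I_m].
  have sb : size bs = m by rewrite size_map size_enum_ord.
  have HS (i : 'I_m) : (i \in S) = nth false bs i.
    by rewrite (nth_map i) ?size_enum_ord // nth_ord_enum.
  have [<- cE] := E bs S sb HS; apply: map_f; apply/zhalfP; exists bs; split=> //.
  by rewrite -cE.
pose S : {set 'I_m} := finset (fun i : 'I_m => nth false bs i).
have HS (i : 'I_m) : (i \in S) = nth false bs i by rewrite inE.
by have [-> cE] := E bs S sb HS; exists S; rewrite cE.
Qed.

Lemma listed_color c : listed (nseq 4 1%Z) 2 (zcolor c) (@color_set R c).
Proof. by case: c; [exact: listed_axes | exact: listed_half | exact: listed_half]. Qed.

Lemma size_zphi m : {in zphi m, forall z, size z = m}.
Proof. by move=> _ /allpairsP[p [_ _ ->]]; rewrite size_map size_iota. Qed.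

Lemma size_zhalf m o : {in zhalf m o, forall z, size z = m}.
Proof. by move=> _ /zhalfP[bs [<- _ ->]]; rewrite size_map. Qed.

Lemma size_zcolor c : {in zcolor c, forall z, size z = 4}.
Proof.
by case: c; [move=> _ /allpairsP[p [_ _ ->]]; rewrite size_map size_iota | exact: size_zhalf ..].
Qed.

Lemma size_zext m b W : {in W, forall z, size z = m} -> {in zext b W, forall z, size z = (m + 1)%N}.
Proof. by move=> H _ /mapP[z /H sz ->]; rewrite size_rcons sz addn1. Qed.

Lemma listed_mirror n w s W (X : set 'rV[R]_n) a (t : R) ax m k : size w = n ->
  all (fun a => 0 <? a)%Z w -> (0 <? s)%Z -> (0 <? m)%Z -> (0 <? wdot w a a)%Z ->
  (2 * m =? k * wdot w a a)%Z -> 0 < t -> ax = t *: phi (coord_mx n w s) a ->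
  listed w s W X -> listed w (m * s) (zmirror w m a k W) (mirror X ax).
Proof.
move=> sw w0 s0 m0 a0 /Z.eqb_spec mk t0 axE ->.
have P x : (0 <? x)%Z -> 0 < zr x by move=> ?; rewrite -zr0 zr_lt.
have [[zs zm] za] := (lt0r_neq0 (P _ s0), lt0r_neq0 (P _ m0), lt0r_neq0 (P _ a0)).
have aE := dot_phi sw (coord_mx_adm (n := n) s sw w0).
have dE x : dot (phi (coord_mx n w s) x) ax = t / zr s ^+ 2 * zr (wdot w x a).
  by rewrite axE dotZr aE zrM -expr2 mulrA mulrAC.
have ts0 : 0 < t / zr s ^+ 2 by rewrite divr_gt0 // exprn_gt0 // P.
have scE x : phi (coord_mx n w (m * s)) x = (zr m)^-1 *: phi (coord_mx n w s) x.
  apply/rowP => i; rewrite [RHS]mxE !phi_scale zrM invfM; ring.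
have mE x : phi (coord_mx n w (m * s)) (vscale m x) = phi (coord_mx n w s) x.
  by rewrite phiZ scE scalerA divff // scale1r.
have rE x : phi (coord_mx n w (m * s)) (vadd (vscale m x) (vscale (- (k * wdot w x a))%Z a)) =
    reflect_in ax (phi (coord_mx n w s) x).
  rewrite phiD mE phiZ scE /reflect_in dE; congr (_ + _).
  rewrite axE dotZr dotZl aE scalerA -scaleNr scalerA; congr (_ *: _).
  have mE' : zr m = zr k * zr (wdot w a a) / 2.
    have := congr1 zr mk; rewrite !zrM zr2 => E; lra.
  have k0 : zr k != 0.
    by apply: contra zm => /eqP k0; rewrite mE' k0 mul0r mul0r.
  rewrite zrN !zrM mE'; field.
  by rewrite zs za k0 lt0r_neq0.
apply/seteqP; split=> x; rewrite /VS /= map_cat mem_cat.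
  case=> [[/mapP[z zW ->]]|[_ [/mapP[z zW ->] + <-]]]; rewrite dE.
    rewrite pmulr_rge0 // -zr0 zr_le => za0; apply/orP; left.
    by rewrite -mE; apply: map_f; apply: map_f; rewrite mem_filter zW za0.
  rewrite pmulr_rgt0 // -zr0 zr_lt => za0; apply/orP; right.
  rewrite -rE; apply: map_f; apply: (map_f (fun x => vadd (vscale m x) (vscale (- (k * wdot w x a))%Z a))).
  by rewrite mem_filter zW za0.
case/orP => /mapP[_ /mapP[z + ->] ->]; rewrite mem_filter => /andP[za0 zW].
  left; rewrite mE; split; first exact: map_f.
  by rewrite dE pmulr_rge0 // -zr0 zr_le.
right; rewrite rE; exists (phi (coord_mx n w s) z) => //; split; first exact: map_f.
by rewrite dE pmulr_rgt0 // -zr0 zr_lt.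
Qed.

(** For x = pi / 3 one has 2 x = pi - x, so the double-angle formula gives (cos x + 1)(2 cos x - 1)
    = 0. *)
Lemma cos_pi3 : cos (pi / 3) = 2^-1 :> R.
Proof.
have p0 := pi_gt0 R; set x := pi / 3 : R.
have c0 : 0 < cos x by apply: cos_gt0_pihalf; rewrite /x; apply/andP; split; lra.
have : cos (x *+ 2) = - cos x.
  have -> : x *+ 2 = - x + pi by rewrite /x mulr2n; lra.
  by rewrite cosDpi cosN.
rewrite cos_mulr2n => E.
have : (cos x + 1) * (2 * cos x - 1) = 0 by move: E; rewrite mulr2n expr2; lra.
move=> /eqP; rewrite mulf_eq0 gt_eqF /= ?addr_gt0 // => /eqP; lra.
Qed.

Lemma sin_pi3 : sin (pi / 3) = Num.sqrt 3 / 2 :> R.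
Proof.
have p0 := pi_gt0 R.
have s0 : 0 < sin (pi / 3 : R) by apply: sin_gt0_pi; apply/andP; split; lra.
have E : sin (pi / 3 : R) ^+ 2 = (Num.sqrt 3 / 2) ^+ 2.
  by rewrite sin2cos2 cos_pi3 expr_div_n sqr_sqrtr //; lra.
by apply/eqP; rewrite -(eqrXn2 (n := 2)) ?(ltW s0) ?divr_ge0 ?sqrtr_ge0 // E.
Qed.

Lemma hex_values (k : 'I_6) : cos (k%:R * pi / 3) = zr (zhex k).1 / 2 :> R /\
  sin (k%:R * pi / 3) = zr (zhex k).2 * Num.sqrt 3 / 2 :> R.
Proof.
have H m : cos (m.+1%:R * pi / 3 : R) = cos (m%:R * pi / 3) / 2 - sin (m%:R * pi / 3) * Num.sqrt 3 / 2 /\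
           sin (m.+1%:R * pi / 3 : R) = sin (m%:R * pi / 3) / 2 + cos (m%:R * pi / 3) * Num.sqrt 3 / 2.
  have -> : m.+1%:R * pi / 3 = m%:R * pi / 3 + pi / 3 :> R by rewrite -natr1; field.
  by rewrite cosD sinD cos_pi3 sin_pi3 !mulrA.
have s3 : Num.sqrt 3 * Num.sqrt 3 = 3 :> R by rewrite -expr2 sqr_sqrtr.
(* With the factor sqrt 3 split off the sine, the addition theorem becomes a linear rule on pairs of
   integers. *)
have S m (a b c d : Z) : cos (m%:R * pi / 3 : R) = zr a / 2 /\ sin (m%:R * pi / 3 : R) = zr b * Num.sqrt 3 / 2 ->
    2 * zr c = zr a - 3 * zr b -> 2 * zr d = zr a + zr b ->
    cos (m.+1%:R * pi / 3 : R) = zr c / 2 /\ sin (m.+1%:R * pi / 3 : R) = zr d * Num.sqrt 3 / 2.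
  move=> [Ec Es] cE dE; have [-> ->] := H m; rewrite Ec Es; split.
    have -> : zr b * Num.sqrt 3 / 2 * Num.sqrt 3 / 2 = zr b * (Num.sqrt 3 * Num.sqrt 3) / 4 by field.
    rewrite s3; lra.
  have -> : zr d = (zr a + zr b) / 2 by lra.
  by field.
have c0 : cos (0%N%:R * pi / 3 : R) = zr 2 / 2 /\ sin (0%N%:R * pi / 3 : R) = zr 0 * Num.sqrt 3 / 2.
  by rewrite !mul0r cos0 sin0 zr2 divff.
have e1 : zr (-1) = -1 by []. have e2 : zr (-2) = -2 by [].
have z0 : zr 0 = 0 := zr0. have z1 : zr 1 = 1 := zr1.
have c1 := S _ _ _ 1%Z 1%Z c0 ltac:(lra) ltac:(lra).
have c2 := S _ _ _ (-1)%Z 1%Z c1 ltac:(lra) ltac:(lra).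
have c3 := S _ _ _ (-2)%Z 0%Z c2 ltac:(lra) ltac:(lra).
have c4 := S _ _ _ (-1)%Z (-1)%Z c3 ltac:(lra) ltac:(lra).
have c5 := S _ _ _ 1%Z (-1)%Z c4 ltac:(lra) ltac:(lra).
by case: k => [[|[|[|[|[|[|]]]]]] //= _].
Qed.

Lemma listed_X (c : 6.-tuple color) : listed [:: 1; 1; 1; 1; 1; 3]%Z 2 (zX c) (X_vectors R c).
Proof.
have comp (X : set 'rV[R]_4) t u :
    [set ext1 (ext1 x t) u | x in X] = [set ext1 x u | x in [set ext1 x t | x in X]].
  by rewrite image_comp.
have ext2 W b d t u (X : set 'rV[R]_4) : {in W, forall z, size z = 4} -> zr b / 2 = t ->
    zr d * Num.sqrt 3 / 2 = u -> listed (nseq 4 1%Z) 2 W X ->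
    listed [:: 1; 1; 1; 1; 1; 3]%Z 2 (zext d (zext b W)) [set ext1 (ext1 x t) u | x in X].
  move=> sW tE uE H; rewrite comp; apply: (@listed_ext 5 [:: 1; 1; 1; 1; 1]%Z 2 3) => //.
    exact: (size_zext (m := 4)).
  by apply: (@listed_ext 4 [:: 1; 1; 1; 1]%Z 2 1) => //; rewrite zr1 sqrtr1 mulr1.
apply: (@listedU 6).
  by apply: ext2; [exact: size_zphi | rewrite zr0 mul0r | rewrite zr0 !mul0r | exact: listed_phi].
apply: (@listed_flatten 6 _ _ 6 (fun k => zext (zhex k).2 (zext (zhex k).1 (zcolor (nth A c k))))) => k.
have [cE sE] := hex_values k.
by apply: ext2; rewrite ?(tnth_nth A); [exact: size_zcolor | | | exact: listed_color].
Qed.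

Let sqrt2 : Num.sqrt 2 * Num.sqrt 2 = 2 :> R. Proof. by rewrite -expr2 sqr_sqrtr. Qed.
Let isqrt2 : 1 / Num.sqrt 2 = Num.sqrt 2 / 2 :> R.
Proof.
have s0 : Num.sqrt 2 != 0 :> R by rewrite gt_eqF // sqrtr_gt0.
by apply: (mulIf s0); rewrite mulfVK // mulrAC sqrt2 divff.
Qed.

Lemma listed_E7 lower : listed [:: 1; 1; 1; 1; 1; 1; 2]%Z 2 (zE7 lower) (E7_like R lower).
Proof.
have zero : listed (nseq 6 1%Z) 2 [:: nseq 6 0%Z] [set 0 : 'rV[R]_6].
  have E : phi (coord_mx 6 (nseq 6 1%Z) 2) (nseq 6 0%Z) = 0 :> 'rV[R]_6.
    by apply/rowP => i; rewrite phi_scale nth_nseq if_same zr0 !mul0r mxE.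
  by apply/seteqP; split=> x; rewrite /VS /= inE E; [move=> -> | move/eqP].
have sz : {in [:: nseq 6 0%Z], forall z, size z = 6} by move=> z; rewrite inE => /eqP ->.
have ext b W (t : R) (X : set 'rV[R]_6) : {in W, forall z, size z = 6} -> t = zr b * Num.sqrt 2 / 2 ->
    listed (nseq 6 1%Z) 2 W X -> listed [:: 1; 1; 1; 1; 1; 1; 2]%Z 2 (zext b W) [set ext1 x t | x in X].
  by move=> sW tE; apply: (@listed_ext 6 [:: 1; 1; 1; 1; 1; 1]%Z 2 2) => //; rewrite tE.
have im (t : R) : [set ext1 0 t] = [set ext1 x t | x in [set (0 : 'rV[R]_6)]] by rewrite image_set1.
rewrite /E7_like /zE7 -!setUA; do 4?[apply: (@listedU 7)]; rewrite ?im; apply: ext => //.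
- exact: size_zphi.
- by rewrite zr0 !mul0r.
- exact: listed_phi.
- by rewrite zr2 mulrC mulKf.
- by rewrite -[zr _]/(- 2) mulNr mulNr mulrC mulKf.
- exact: size_zhalf.
- by rewrite isqrt2 zr1 mul1r.
- exact: listed_half.
- exact: size_zhalf.
- by rewrite isqrt2 -[zr _]/(- 1) mulN1r mulNr.
- exact: listed_half.
Qed.

Lemma listed_D5 : listed [:: 1; 1; 1; 1; 1]%Z 2 (zphi 5) (D5_vectors R).
Proof. exact: listed_phi. Qed.

Lemma listed_L5 : listed [:: 1; 1; 1; 1; 1]%Z 2 zL5 (L5_vectors R).
Proof.
have ext b W (t : R) (X : set 'rV[R]_4) : {in W, forall z, size z = 4} -> t = zr b / 2 ->
    listed (nseq 4 1%Z) 2 W X -> listed [:: 1; 1; 1; 1; 1]%Z 2 (zext b W) [set ext1 x t | x in X].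
  move=> sW tE; apply: (@listed_ext 4 [:: 1; 1; 1; 1]%Z 2 1) => //.
  by rewrite tE zr1 sqrtr1 mulr1.
rewrite /L5_vectors -setUA; apply: (@listedU 5); [|apply: (@listedU 5)]; apply: ext.
- exact: size_zphi.
- by rewrite zr0 mul0r.
- exact: listed_phi.
- exact: (size_zcolor (c := A)).
- by rewrite zr2 divff.
- exact: listed_axes.
- exact: size_zhalf.
- by rewrite -[zr _]/(- 2) mulNr divff.
- exact: listed_half.
Qed.

Lemma axis5E : axis5 R = 2 *: phi (coord_mx 5 [:: 1; 1; 1; 1; 1]%Z 2) [:: 1; 1; 1; 1; 1]%Z.
Proof.
apply/rowP => i; rewrite mxE [RHS]mxE phi_scale.
have -> : nth 0%Z [:: 1; 1; 1; 1; 1]%Z i = 1%Z by case: i => [[|[|[|[|[|]]]]]].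
by rewrite zr1 sqrtr1 mul1r mul1r divff.
Qed.

Lemma axis7E : axis7 R = 1 *: phi (coord_mx 7 [:: 1; 1; 1; 1; 1; 1; 2]%Z 2) [:: 2; 0; 0; 0; 0; 0; 1]%Z.
Proof.
apply/rowP => i; rewrite scale1r phi_scale /axis7 /ext1 mxE.
case: splitP => j ij; rewrite ij.
  rewrite !mxE eqxx /=; case: j {ij} => [[|j] jl] /=.
    by rewrite zr1 sqrtr1 zr2 mulr1 divff.
  have -> : nth 0%Z [:: 0; 0; 0; 0; 0; 1]%Z j = 0%Z by move: jl; do 6?case: j => [|j] //.
  by rewrite zr0 !mul0r.
by rewrite ord1 addn0 /= mxE isqrt2 zr1 mul1r.
Qed.

End Link.

Definition zweight (c : config) : vec :=
  match c with
  | D5 | L5 | Q5 | R5 => [:: 1; 1; 1; 1; 1]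
  | E6 | C6_72b | C6_72c | C6_72d => [:: 1; 1; 1; 1; 1; 3]
  | E7 | C7_126b | C7_126c | C7_126d => [:: 1; 1; 1; 1; 1; 1; 2]
  end%Z.

(** Doubling gives 2; mirroring multiplies it by the denominator of the reflection, 5 in dimension 5
    and 3 in dimension 7. *)
Definition zscale (c : config) : Z :=
  match c with Q5 | R5 => 10 | C7_126c | C7_126d => 6 | _ => 2 end%Z.

Definition zaxis5 : vec := [:: 1; 1; 1; 1; 1]%Z.
Definition zaxis7 : vec := [:: 2; 0; 0; 0; 0; 0; 1]%Z.

Definition zpoints (c : config) : seq vec :=
  match c with
  | D5 => zphi 5
  | L5 => zL5
  | Q5 => zmirror (zweight D5) 5 zaxis5 2 (zphi 5)
  | R5 => zmirror (zweight L5) 5 zaxis5 2 zL5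
  | E6 => zX [:: A; B; Defs.C; A; B; Defs.C]
  | C6_72b => zX [:: A; B; Defs.C; A; Defs.C; B]
  | C6_72c => zX [:: A; B; A; B; A; B]
  | C6_72d => zX [:: A; B; A; B; A; Defs.C]
  | E7 => zE7 false
  | C7_126b => zE7 true
  | C7_126c => zmirror (zweight E7) 3 zaxis7 1 (zE7 false)
  | C7_126d => zmirror (zweight E7) 3 zaxis7 1 (zE7 true)
  end.

Lemma listed_vectors (R : realType) (c : config) :
  listed (zweight c) (zscale c) (zpoints c) (vectors R c).
Proof.
case: c.
- exact: listed_D5.
- exact: listed_L5.
- by apply: (@listed_mirror R 5 (zweight D5) 2 _ _ zaxis5 2 _ 5 2); rewrite ?ltr0n //; [exact: axis5E | exact: listed_D5].
- by apply: (@listed_mirror R 5 (zweight L5) 2 _ _ zaxis5 2 _ 5 2); rewrite ?ltr0n //; [exact: axis5E | exact: listed_L5].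
- exact: listed_X.
- exact: listed_X.
- exact: listed_X.
- exact: listed_X.
- exact: listed_E7.
- exact: listed_E7.
- by apply: (@listed_mirror R 7 (zweight E7) 2 _ _ zaxis7 1 _ 3 1); rewrite ?ltr01 //; [exact: axis7E | exact: listed_E7].
- by apply: (@listed_mirror R 7 (zweight E7) 2 _ _ zaxis7 1 _ 3 1); rewrite ?ltr01 //; [exact: axis7E | exact: listed_E7].
Qed.

(** The vectors have squared norm 2, hence the factor 2 in N. The embedding is the diagonal one,
    shrunk by sqrt 2 and followed by the isometry. *)
Lemma isometric_adm (R : realType) (c : config) (V : set 'rV[R]_(cdim c)) :
  isometric (points R c) V -> exists2 Phi : 'M[R]_(cdim c),
    adm (zweight c) (2 * (zscale c * zscale c))%Z Phi & V = VS (zpoints c) Phi.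
Proof.
move=> [Q [QQ ->]]; exists ((Num.sqrt 2)^-1 *: (coord_mx (cdim c) (zweight c) (zscale c) *m Q)).
  rewrite /adm linearZ /= -scalemxAl -scalemxAr scalerA trmx_mul mulmxA -(mulmxA _ Q) QQ mulmx1.
  rewrite coord_mx_adm; [|by case: (c)|by case: (c)].
  have -> : (Num.sqrt 2)^-1 * (Num.sqrt 2)^-1 = 2^-1 :> R by rewrite -invfM -expr2 sqr_sqrtr.
  rewrite scalerA -invfM; congr (_^-1 *: _); exact/esym/(zrM 2).
rewrite /points listed_vectors; apply/seteqP; split=> x.
  move=> [_ [_ /mapP[z zV ->] <-] <-]; apply/mapP; exists z => //.
  by rewrite /phi -scalemxAl -[RHS]scalemxAr mulmxA.
move=> /mapP[z zV ->]; exists ((Num.sqrt 2)^-1 *: phi (coord_mx (cdim c) (zweight c) (zscale c)) z).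
  by exists (phi (coord_mx (cdim c) (zweight c) (zscale c)) z) => //; apply: map_f.
by rewrite /phi -scalemxAl -[RHS]scalemxAr mulmxA.
Qed.

(** * The facets *)

(** The two facet types of the rectified cross-polytope: a cross-polytope with 8 vertices and a
    rectified simplex with 10. *)
Definition data_D5 : cfg := (Cfg (cdim D5) (zweight D5) (2 * (zscale D5 * zscale D5)) (zpoints D5)
 [:: (1, [:: [:: 1; 0; 0; 0; 0]; [:: 0; 1; 0; 0; 0]; [:: 0; 0; 0; 0; 1]; [:: 0; 0; 1; 0; 0];
  [:: 0; 0; 0; 1; 0]]); (1, [:: [:: 0; 1; 0; 0; 0]; [:: 0; 0; 0; 1; 0]; [:: 1; 0; 0; 0; 0];
  [:: 0; 0; 1; 0; 0]; [:: 0; 0; 0; 0; -1]])]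
 [:: ((Key [:: 1; 0; 0; 0; 0] 2 [::]), None); ((Key [:: 1; 1; 1; 1; 1] 4 [::]), None)]
 [:: [:: (Key [:: 1; 0; 0; 0; 0] 2 [::])]; [:: (Key [:: 1; 1; 1; 1; 1] 4 [::]);
  (Key [:: 1; 0; 0; 0; 0] 2 [::])]; [:: (Key [:: 1; 0; 0; 0; 0] 2 [::])];
  [:: (Key [:: 0; 1; 0; 0; 0] 2 [::]); (Key [:: 1; 1; 1; 1; 1] 4 [::]);
  (Key [:: 1; 0; 0; 0; 0] 2 [::])]]
 [:: ([:: 2; 2; 0; 0; 0], [::])])%Z.

Lemma data_D5_ok : cfg_ok true data_D5.
Proof. by vm_cast_no_check (erefl true). Qed.

(** The first kill is a pair whose sum is itself a point of V, so that a functional tight at both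
    would exceed its maximum there. The others write twice the sum of two points as a sum of three
    points. *)
Definition data_L5 : cfg := (Cfg (cdim L5) (zweight L5) (2 * (zscale L5 * zscale L5)) (zpoints L5)
 [:: (2, [:: [:: 1; 1; -1; 1; 0]; [:: 1; 1; 1; -1; 0]; [:: 1; -1; -1; -1; 0]; [:: -1; 1; -1; -1; 0];
  [:: 0; 0; 0; 0; -2]]); (1, [:: [:: 0; 0; 0; 1; 0]; [:: -1; 0; 0; 0; 0]; [:: 0; 0; 1; 0; 0];
  [:: 0; -1; 0; 0; 0]; [:: 0; 0; 0; 0; 1]])]
 [:: ((Key [:: 2; 0; 0; 0; 0] 4 [::]), None); ((Key [:: 1; 1; 1; 1; 1] 4 [::]), None);
  ((Key [:: -1; 1; 1; 1; 1] 4 [::]), None); ((Key [:: 0; 0; 0; 0; 1] 2 [::]), None)]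
 [:: [:: (Key [:: 2; 0; 0; 0; 0] 4 [::])]; [:: (Key [:: 1; 1; 1; 1; 1] 4 [::]);
  (Key [:: 2; 0; 0; 0; 0] 4 [::])]; [:: (Key [:: -1; 1; 1; 1; 1] 4 [::]);
  (Key [:: 1; 1; 1; 1; 1] 4 [::]); (Key [:: 2; 0; 0; 0; 0] 4 [::])];
  [:: (Key [:: 0; 0; 0; 0; 1] 2 [::]); (Key [:: 1; -1; 1; 1; 1] 4 [::]);
  (Key [:: 2; 0; 0; 0; 0] 4 [::])]; [:: (Key [:: 1; 1; -1; 1; 0] 4 [::]);
  (Key [:: 1; 1; -1; 1; 1] 4 [::]); (Key [:: 2; 0; 0; 0; 0] 4 [::])];
  [:: (Key [:: 0; 0; 0; 2; 0] 4 [::]); (Key [:: 1; -1; 1; 1; 1] 4 [::]);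
  (Key [:: 2; 0; 0; 0; 0] 4 [::])]]
 [:: ([:: 2; 2; 0; 0; 0], [:: Kill [:: 4; 7]%N 1 [:: (1, 0%N)]; Kill [:: 9; 12]%N 2 [:: (1, 0%N);
  (1, 5%N); (1, 8%N)]; Kill [:: 10; 11]%N 2 [:: (1, 0%N); (1, 12%N); (1, 17%N)];
  Kill [:: 9; 11]%N 2 [:: (1, 0%N); (1, 4%N); (1, 9%N)]; Kill [:: 10; 12]%N 2 [:: (1, 0%N);
  (1, 13%N); (1, 16%N)]]); ([:: 2; 0; 0; 0; 2], [::])])%Z.

Lemma data_L5_ok : cfg_ok true data_L5.
Proof. by vm_cast_no_check (erefl true). Qed.

(** The second generator is the reflection defining the mirror image, composed with a permutation of
    the coordinates. The last representative is the only fold. *)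
Definition data_Q5 : cfg := (Cfg (cdim Q5) (zweight Q5) (2 * (zscale Q5 * zscale Q5)) (zpoints Q5)
 [:: (1, [:: [:: 0; 1; 0; 0; 0]; [:: 1; 0; 0; 0; 0]; [:: 0; 0; 0; 0; 1]; [:: 0; 0; 1; 0; 0];
  [:: 0; 0; 0; 1; 0]]); (5, [:: [:: 3; -2; -2; -2; -2]; [:: -2; -2; -2; -2; 3];
  [:: -2; -2; 3; -2; -2]; [:: -2; 3; -2; -2; -2]; [:: -2; -2; -2; 3; -2]])]
 [:: ((Key [:: 5; 0; 0; 0; 0] 50 [::]), None); ((Key [:: 5; 5; 5; -5; -5] 100 [::]), None);
  ((Key [:: 1; 1; 1; 1; 1] 20 [::]), None); ((Key [:: -5; 5; 5; 5; 5] 100 [::]), None);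
  ((Key [:: 5; -5; -5; -5; 5] 100 [::]), Some ([:: -1; -1; -1; -1; -2], [:: [:: 10; -10; 0; 0; 0];
  [:: 10; 0; -10; 0; 0]; [:: 10; 0; 0; -10; 0]]))]
 [:: [:: (Key [:: 5; 0; 0; 0; 0] 50 [::])]; [:: (Key [:: 5; 5; 5; -5; -5] 100 [::]);
  (Key [:: 5; 0; 0; 0; 0] 50 [::])]; [:: (Key [:: 1; 1; 1; 1; 1] 20 [::]);
  (Key [:: 5; 0; 0; 0; 0] 50 [::])]; [:: (Key [:: -5; 5; 5; 5; 5] 100 [::]);
  (Key [:: 1; 1; 1; 1; 1] 20 [::]); (Key [:: 5; 0; 0; 0; 0] 50 [::])];
  [:: (Key [:: 5; -5; -5; -5; 5] 100 [::]); (Key [:: 5; 0; 0; 0; 0] 50 [::])];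
  [:: (Key [:: 0; 5; 0; 0; 0] 50 [::]); (Key [:: 1; 1; 1; 1; 1] 20 [::]);
  (Key [:: 5; 0; 0; 0; 0] 50 [::])]; [:: (Key [:: 3; -2; -2; -2; -2] 50 [::]);
  (Key [:: 5; 0; 0; 0; 0] 50 [::])]]
 [:: ([:: 10; 10; 0; 0; 0], [::]); ([:: 10; -10; 0; 0; 0], [:: Kill [:: 6; 9]%N 1 [:: (1, 1%N)]])])%Z.

Lemma data_Q5_ok : cfg_ok false data_Q5.
Proof. by vm_cast_no_check (erefl true). Qed.

Definition data_R5 : cfg := (Cfg (cdim R5) (zweight R5) (2 * (zscale R5 * zscale R5)) (zpoints R5)
 [:: (5, [:: [:: -2; 3; -2; -2; -2]; [:: 3; -2; -2; -2; -2]; [:: -2; -2; -2; 3; -2];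
  [:: -2; -2; 3; -2; -2]; [:: -2; -2; -2; -2; 3]]); (1, [:: [:: 0; 0; 1; 0; 0]; [:: 1; 0; 0; 0; 0];
  [:: 0; 1; 0; 0; 0]; [:: 0; 0; 0; 1; 0]; [:: 0; 0; 0; 0; 1]])]
 [:: ((Key [:: 5; 0; 0; 0; 0] 50 [::]), None); ((Key [:: 1; 1; 1; 1; 1] 20 [::]), None);
  ((Key [:: -5; 5; 5; 5; 5] 100 [::]), None); ((Key [:: -5; -5; 5; 5; 5] 100 [::]), None);
  ((Key [:: 0; 0; 0; 0; 5] 50 [::]), None); ((Key [:: 5; 5; 5; -5; 0] 100 [::]), None);
  ((Key [:: 10; 0; 0; 0; -5] 100 [::]), None); ((Key [:: 5; 5; 5; 5; -5] 100 [::]), None);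
  ((Key [:: 5; -5; -5; -5; 5] 100 [::]), Some ([:: -1; -1; -1; -1; -2], [:: [:: 10; -10; 0; 0; 0];
  [:: 10; 0; -10; 0; 0]; [:: 10; 0; 0; -10; 0]]));
  ((Key [:: -5; -5; 5; 5; -5] 100 [::]), Some ([:: -1; -1; -1; -1; 0], [:: [:: -10; 0; 10; 0; 0];
  [:: -10; 0; 0; 10; 0]; [:: 0; -10; 10; 0; 0]]))]
 [:: [:: (Key [:: 5; 0; 0; 0; 0] 50 [::])]; [:: (Key [:: 1; 1; 1; 1; 1] 20 [::]);
  (Key [:: 5; 0; 0; 0; 0] 50 [::])]; [:: (Key [:: -5; 5; 5; 5; 5] 100 [::]);
  (Key [:: 1; 1; 1; 1; 1] 20 [::]); (Key [:: 5; 0; 0; 0; 0] 50 [::])];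
  [:: (Key [:: -5; -5; 5; 5; 5] 100 [::]); (Key [:: 5; -5; 5; 5; 5] 100 [::]);
  (Key [:: 5; 0; 0; 0; 0] 50 [::])]; [:: (Key [:: 0; 0; 0; 0; 5] 50 [::]);
  (Key [:: 5; -5; 5; 5; 5] 100 [::]); (Key [:: 5; 0; 0; 0; 0] 50 [::])];
  [:: (Key [:: 5; 5; 5; -5; 0] 100 [::]); (Key [:: 10; 0; 0; 0; -5] 100 [::]);
  (Key [:: 5; 0; 0; 0; 0] 50 [::])]; [:: (Key [:: 10; 0; 0; 0; -5] 100 [::]);
  (Key [:: 5; 0; 0; 0; 0] 50 [::])]; [:: (Key [:: 5; 5; 5; 5; -5] 100 [::]);
  (Key [:: 1; 1; 1; 1; 1] 20 [::]); (Key [:: 5; 0; 0; 0; 0] 50 [::])];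
  [:: (Key [:: 5; -5; -5; -5; 5] 100 [::]); (Key [:: 5; 0; 0; 0; 0] 50 [::])];
  [:: (Key [:: -5; -5; 5; 5; -5] 100 [::]); (Key [:: 5; -5; 5; 5; 0] 100 [::]);
  (Key [:: 5; -5; 5; 5; 5] 100 [::]); (Key [:: 5; 0; 0; 0; 0] 50 [::])];
  [:: (Key [:: -2; 3; -2; -2; -2] 50 [::]); (Key [:: -1; -1; -11; -1; -1] 100 [::]);
  (Key [:: 5; 5; -5; 5; 5] 100 [::]); (Key [:: 5; 0; 0; 0; 0] 50 [::])];
  [:: (Key [:: 0; 0; 5; 0; 0] 50 [::]); (Key [:: 5; -5; 5; 5; 5] 100 [::]);
  (Key [:: 5; 0; 0; 0; 0] 50 [::])]]
 [:: ([:: 10; 10; 0; 0; 0], [:: Kill [:: 4; 7]%N 1 [:: (1, 0%N)]; Kill [:: 9; 12]%N 2 [:: (1, 0%N);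
  (1, 4%N); (1, 6%N)]; Kill [:: 10; 11]%N 2 [:: (1, 0%N); (1, 9%N); (1, 13%N)];
  Kill [:: 9; 11]%N 2 [:: (1, 0%N); (1, 3%N); (1, 7%N)]; Kill [:: 10; 12]%N 2 [:: (1, 0%N);
  (1, 10%N); (1, 12%N)]]); ([:: 10; -10; 0; 0; 0], [:: Kill [:: 4; 6]%N 1 [:: (1, 1%N)];
  Kill [:: 8; 9]%N 2 [:: (1, 1%N); (1, 11%N); (1, 14%N)]; Kill [:: 7; 9]%N 2 [:: (1, 1%N); (1, 3%N);
  (1, 6%N)]; Kill [:: 9; 12]%N 2 [:: (1, 1%N); (1, 31%N); (1, 32%N)]]);
  ([:: 10; 0; 0; 0; 10], [::]); ([:: -10; 0; 0; 0; 10], [:: Kill [:: 3; 9]%N 1 [:: (1, 19%N)]]);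
  ([:: 5; 5; 5; -5; -10], [:: Kill [:: 6; 7]%N 1 [:: (1, 26%N)]])])%Z.

Lemma data_R5_ok : cfg_ok false data_R5.
Proof. by vm_cast_no_check (erefl true). Qed.

(** The Gosset polytope 1_22 has a single facet type, the 5-dimensional demicube with 16
    vertices. *)
Definition data_E6 : cfg := (Cfg (cdim E6) (zweight E6) (2 * (zscale E6 * zscale E6)) (zpoints E6)
 [:: (1, [:: [:: 1; 0; 0; 0; 0; 0]; [:: 0; 0; 0; 0; -1; 0]; [:: 0; 1; 0; 0; 0; 0];
  [:: 0; 0; -1; 0; 0; 0]; [:: 0; 0; 0; -1; 0; 0]; [:: 0; 0; 0; 0; 0; -1]]);
  (2, [:: [:: 1; -1; -1; 1; 0; 0]; [:: 1; 1; -1; -1; 0; 0]; [:: 0; 0; 0; 0; 1; 1];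
  [:: 1; -1; 1; -1; 0; 0]; [:: 1; 1; 1; 1; 0; 0]; [:: 0; 0; 0; 0; 3; -1]])]
 [:: ((Key [:: 0; 0; 0; 0; 6; 2] 12 [::]), None)]
 [:: [:: (Key [:: 0; 0; 0; 0; 6; 2] 12 [::])]; [:: (Key [:: 0; 0; 0; -6; 0; -2] 12 [::]);
  (Key [:: 3; 3; 3; -3; 3; 1] 12 [::]); (Key [:: 0; 0; 0; 0; 6; 2] 12 [::])];
  [:: (Key [:: 3; 3; 3; 3; 3; -1] 12 [::]); (Key [:: 0; 0; 0; 0; 6; 2] 12 [::])]]
 [:: ([:: 2; 2; 0; 0; 0; 0], [::])])%Z.

Lemma data_E6_ok : cfg_ok true data_E6.
Proof. by vm_cast_no_check (erefl true). Qed.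

Definition data_C6_72b : cfg := (Cfg (cdim C6_72b) (zweight C6_72b) (2 * (zscale C6_72b * zscale C6_72b)) (zpoints C6_72b)
 [:: (1, [:: [:: 0; 0; 0; -1; 0; 0]; [:: 0; 0; 1; 0; 0; 0]; [:: 0; 0; 0; 0; 1; 0];
  [:: 0; -1; 0; 0; 0; 0]; [:: 1; 0; 0; 0; 0; 0]; [:: 0; 0; 0; 0; 0; 1]]);
  (1, [:: [:: 0; 1; 0; 0; 0; 0]; [:: 0; 0; 1; 0; 0; 0]; [:: 1; 0; 0; 0; 0; 0];
  [:: 0; 0; 0; -1; 0; 0]; [:: 0; 0; 0; 0; -1; 0]; [:: 0; 0; 0; 0; 0; -1]])]
 [:: ((Key [:: 0; 0; 0; 0; 3; 1] 6 [::]), None); ((Key [:: 3; 3; 3; -3; 3; 1] 12 [::]), None);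
  ((Key [:: 0; 0; 0; 0; 0; 1] 3 [::]), None);
  ((Key [:: 3; 3; 3; 3; 3; -1] 12 [::]), Some ([:: 0; 0; 0; 0; -1; -1], [:: [:: 2; 2; 0; 0; 0; 0];
  [:: 2; 0; 2; 0; 0; 0]; [:: 2; 0; 0; 2; 0; 0]; [:: 0; 2; 2; 0; 0; 0]]))]
 [:: [:: (Key [:: 0; 0; 0; 0; 3; 1] 6 [::])]; [:: (Key [:: 3; 3; 3; -3; 3; 1] 12 [::]);
  (Key [:: 0; 0; 0; 0; 3; 1] 6 [::])]; [:: (Key [:: 0; 0; 0; 0; 0; 1] 3 [::]);
  (Key [:: 0; 0; 0; 0; 3; 1] 6 [::])]; [:: (Key [:: 3; 3; 3; 3; 3; -1] 12 [::]);
  (Key [:: 0; 0; 0; 0; 3; 1] 6 [::])]; [:: (Key [:: 3; 0; 0; 0; 0; 1] 6 [::]);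
  (Key [:: 0; 0; 0; 0; 3; 1] 6 [::])]; [:: (Key [:: 0; 0; 0; 0; -3; -1] 6 [::]);
  (Key [:: 0; 0; 0; 0; -3; 1] 6 [::]); (Key [:: 3; 0; 0; 0; 0; 1] 6 [::]);
  (Key [:: 0; 0; 0; 0; 3; 1] 6 [::])]]
 [:: ([:: 2; 2; 0; 0; 0; 0], [:: Kill [:: 10; 15]%N 1 [:: (1, 0%N)]]);
  ([:: 1; 1; 1; 1; 1; 1], [::])])%Z.

Lemma data_C6_72b_ok : cfg_ok false data_C6_72b.
Proof. by vm_cast_no_check (erefl true). Qed.

(** In the first kill both sides have weight 8, so its five points of V would be tight too; an
    exposed pair among them excludes this. *)
Definition data_C6_72c : cfg := (Cfg (cdim C6_72c) (zweight C6_72c) (2 * (zscale C6_72c * zscale C6_72c)) (zpoints C6_72c)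
 [:: (1, [:: [:: 1; 0; 0; 0; 0; 0]; [:: 0; 0; 0; 1; 0; 0]; [:: 0; 0; 1; 0; 0; 0];
  [:: 0; 1; 0; 0; 0; 0]; [:: 0; 0; 0; 0; 1; 0]; [:: 0; 0; 0; 0; 0; -1]]);
  (2, [:: [:: 1; 1; 1; 1; 0; 0]; [:: -1; 1; 1; -1; 0; 0]; [:: 1; 1; -1; -1; 0; 0];
  [:: -1; 1; -1; 1; 0; 0]; [:: 0; 0; 0; 0; 1; 1]; [:: 0; 0; 0; 0; 3; -1]])]
 [:: ((Key [:: 3; 3; 3; -3; 3; 1] 12 [::]), None); ((Key [:: 0; 0; 0; 0; 3; 1] 6 [::]), None);
  ((Key [:: 3; 3; 3; 3; 3; -1] 12 [::]), Some ([:: 0; 0; 0; 0; -1; -1], [:: [:: 2; 2; 0; 0; 0; 0];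
  [:: 2; 0; 2; 0; 0; 0]; [:: 2; 0; 0; 2; 0; 0]; [:: 0; 2; 2; 0; 0; 0]]))]
 [:: [:: (Key [:: 3; 3; 3; -3; 3; 1] 12 [::])]; [:: (Key [:: 0; 0; 0; 0; 3; 1] 6 [::]);
  (Key [:: 3; 3; 3; -3; 3; 1] 12 [::])]; [:: (Key [:: 3; 3; 3; 3; 3; -1] 12 [::]);
  (Key [:: 3; 3; 3; -3; 3; 1] 12 [::])]; [:: (Key [:: 3; -3; 3; 3; 3; -1] 12 [::]);
  (Key [:: 3; -3; 3; 3; 3; 1] 12 [::]); (Key [:: 3; 3; 3; -3; 3; 1] 12 [::])];
  [:: (Key [:: 3; 3; 3; -3; 3; 1] 12 [::])]]
 [:: ([:: 2; 2; 0; 0; 0; 0], [:: Kill [:: 7; 8]%N 4 [:: (1, 0%N); (1, 2%N); (2, 26%N); (2, 42%N);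
  (2, 58%N)]]); ([:: 2; 0; 0; 0; 2; 0], [:: Kill [:: 6; 11]%N 1 [:: (1, 24%N)]])])%Z.

Lemma data_C6_72c_ok : cfg_ok false data_C6_72c.
Proof. by vm_cast_no_check (erefl true). Qed.

Definition data_C6_72d : cfg := (Cfg (cdim C6_72d) (zweight C6_72d) (2 * (zscale C6_72d * zscale C6_72d)) (zpoints C6_72d)
 [:: (2, [:: [:: 0; 2; 0; 0; 0; 0]; [:: 0; 0; 0; 2; 0; 0]; [:: 2; 0; 0; 0; 0; 0];
  [:: 0; 0; 2; 0; 0; 0]; [:: 0; 0; 0; 0; -1; -1]; [:: 0; 0; 0; 0; -3; 1]]);
  (1, [:: [:: -1; 0; 0; 0; 0; 0]; [:: 0; 0; 0; 1; 0; 0]; [:: 0; 1; 0; 0; 0; 0];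
  [:: 0; 0; -1; 0; 0; 0]; [:: 0; 0; 0; 0; 1; 0]; [:: 0; 0; 0; 0; 0; 1]])]
 [:: ((Key [:: 0; 0; 0; 0; 3; 1] 6 [::]), None); ((Key [:: -3; 3; 3; 3; 0; 2] 12 [::]), None);
  ((Key [:: 0; 0; 0; 0; 0; 2] 6 [::]), None); ((Key [:: 3; 3; 3; -3; 3; 1] 12 [::]), None);
  ((Key [:: 3; 3; 3; 3; 3; -1] 12 [::]), None); ((Key [:: 0; 0; 0; 0; 3; -1] 6 [::]), None);
  ((Key [:: 6; 0; 0; 0; 0; 2] 12 [::]), Some ([:: 0; 0; 0; 0; -1; 0], [:: [:: 2; 2; 0; 0; 0; 0];
  [:: 2; -2; 0; 0; 0; 0]; [:: 2; 0; 2; 0; 0; 0]; [:: 2; 0; 0; 2; 0; 0]]));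
  ((Key [:: 6; 0; 0; 0; 0; -2] 12 [::]), Some ([:: 0; 0; 0; 0; -1; 0], [:: [:: 2; 2; 0; 0; 0; 0];
  [:: 2; -2; 0; 0; 0; 0]; [:: 2; 0; 2; 0; 0; 0]; [:: 2; 0; 0; 2; 0; 0]]));
  ((Key [:: -6; 0; 0; 0; 3; 1] 12 [::]), Some ([:: 0; 0; 0; 0; 1; -1], [:: [:: -2; 2; 0; 0; 0; 0];
  [:: -2; -2; 0; 0; 0; 0]; [:: -2; 0; 2; 0; 0; 0]; [:: -2; 0; 0; 2; 0; 0]]));
  ((Key [:: -3; 3; 3; -3; -3; 1] 12 [::]), Some ([:: 0; 0; 0; 0; -1; -1], [:: [:: -2; 2; 0; 0; 0; 0];
  [:: -2; 0; 2; 0; 0; 0]; [:: -2; 0; 0; -2; 0; 0]; [:: 0; 2; 2; 0; 0; 0]]))]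
 [:: [:: (Key [:: 0; 0; 0; 0; 3; 1] 6 [::])]; [:: (Key [:: -3; 3; 3; 3; 0; 2] 12 [::]);
  (Key [:: 0; 0; 0; 0; 0; 2] 6 [::]); (Key [:: 0; 0; 0; 0; 3; 1] 6 [::])];
  [:: (Key [:: 0; 0; 0; 0; 0; 2] 6 [::]); (Key [:: 0; 0; 0; 0; 3; 1] 6 [::])];
  [:: (Key [:: 3; 3; 3; -3; 3; 1] 12 [::]); (Key [:: 0; 0; 0; 0; 3; 1] 6 [::])];
  [:: (Key [:: 3; 3; 3; 3; 3; -1] 12 [::]); (Key [:: 0; 0; 0; 0; 3; 1] 6 [::])];
  [:: (Key [:: 0; 0; 0; 0; 3; -1] 6 [::]); (Key [:: 0; 0; 0; 0; 3; 1] 6 [::])];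
  [:: (Key [:: 6; 0; 0; 0; 0; 2] 12 [::]); (Key [:: 0; 0; 0; 0; 3; 1] 6 [::])];
  [:: (Key [:: 6; 0; 0; 0; 0; -2] 12 [::]); (Key [:: 6; 0; 0; 0; 0; 2] 12 [::]);
  (Key [:: 0; 0; 0; 0; 3; 1] 6 [::])]; [:: (Key [:: -6; 0; 0; 0; 3; 1] 12 [::]);
  (Key [:: 0; 0; 0; 0; 0; 2] 6 [::]); (Key [:: 0; 0; 0; 0; 3; 1] 6 [::])];
  [:: (Key [:: -3; 3; 3; -3; -3; 1] 12 [::]); (Key [:: 0; 0; 0; 0; 0; 2] 6 [::]);
  (Key [:: 0; 0; 0; 0; 3; 1] 6 [::])]; [:: (Key [:: 0; 0; 0; 0; -3; -1] 6 [::]);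
  (Key [:: 0; 0; 0; 0; -3; 1] 6 [::]); (Key [:: 0; 0; 0; 0; 0; 2] 6 [::]);
  (Key [:: 0; 0; 0; 0; 3; 1] 6 [::])]; [:: (Key [:: 0; 0; 0; 0; 3; 1] 6 [::])]]
 [:: ([:: 2; 2; 0; 0; 0; 0], [:: Kill [:: 7; 8]%N 4 [:: (1, 0%N); (1, 2%N); (2, 26%N); (2, 42%N);
  (2, 58%N)]; Kill [:: 13; 20]%N 2 [:: (1, 0%N); (1, 5%N); (1, 8%N)];
  Kill [:: 14; 20]%N 2 [:: (1, 0%N); (1, 13%N); (1, 16%N)]; Kill [:: 13; 19]%N 2 [:: (1, 0%N);
  (1, 4%N); (1, 9%N)]; Kill [:: 14; 19]%N 2 [:: (1, 0%N); (1, 12%N); (1, 17%N)]]);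
  ([:: 2; 0; 0; 0; 2; 0], [::]); ([:: 1; 1; 1; 1; 1; 1], [:: Kill [:: 6; 13; 15]%N 3 [:: (2, 30%N);
  (1, 32%N); (1, 35%N); (1, 37%N); (1, 38%N); (2, 46%N)]]);
  ([:: 2; 0; 0; 0; -1; 1], [:: Kill [:: 6; 15]%N 1 [:: (1, 40%N)]]);
  ([:: 1; 1; 1; -1; 1; -1], [:: Kill [:: 6; 17; 19]%N 3 [:: (2, 31%N); (2, 63%N); (1, 64%N);
  (1, 67%N); (1, 69%N); (1, 70%N)]])])%Z.

Lemma data_C6_72d_ok : cfg_ok false data_C6_72d.
Proof. by vm_cast_no_check (erefl true). Qed.

(** The two facet types of the Gosset polytope 2_31: a 6-simplex and the polytope 2_21 with 27
    vertices. *)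
Definition data_E7 : cfg := (Cfg (cdim E7) (zweight E7) (2 * (zscale E7 * zscale E7)) (zpoints E7)
 [:: (1, [:: [:: 1; 0; 0; 0; 0; 0; 0]; [:: 0; -1; 0; 0; 0; 0; 0]; [:: 0; 0; 1; 0; 0; 0; 0];
  [:: 0; 0; 0; 0; 1; 0; 0]; [:: 0; 0; 0; 0; 0; 1; 0]; [:: 0; 0; 0; -1; 0; 0; 0];
  [:: 0; 0; 0; 0; 0; 0; 1]]); (2, [:: [:: 1; 1; 1; 0; 1; 0; 0]; [:: -1; 1; -1; 0; 1; 0; 0];
  [:: 1; -1; -1; 0; 1; 0; 0]; [:: 1; 1; -1; 0; -1; 0; 0]; [:: 0; 0; 0; 1; 0; 1; 1];
  [:: 0; 0; 0; -1; 0; -1; 1]; [:: 0; 0; 0; 2; 0; -2; 0]])]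
 [:: ((Key [:: 2; 2; 2; 0; 0; 0; 1] 8 [::]), None); ((Key [:: 2; 0; 0; 0; 0; 0; 1] 4 [::]), None)]
 [:: [:: (Key [:: 2; 2; 2; 0; 0; 0; 1] 8 [::])]; [:: (Key [:: 2; 0; 0; 0; 0; 0; 1] 4 [::]);
  (Key [:: 2; 2; 2; 0; 0; 0; 1] 8 [::])]; [:: (Key [:: 2; -2; 2; 0; 0; 0; 1] 8 [::]);
  (Key [:: 0; 0; 2; 0; 0; 0; 1] 4 [::]); (Key [:: 2; 2; 2; 0; 0; 0; 1] 8 [::])];
  [:: (Key [:: 1; 1; -1; 1; 3; -1; 0] 8 [::]); (Key [:: 1; 1; 1; 1; 1; -1; 0] 4 [::]);
  (Key [:: 2; 2; 2; 0; 0; 0; 1] 8 [::])]]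
 [:: ([:: 2; 2; 0; 0; 0; 0; 0], [::])])%Z.

Lemma data_E7_ok : cfg_ok true data_E7.
Proof. by vm_cast_no_check (erefl true). Qed.

(** The last fold is only a part of its section, so its key carries a half space. That functional is
    symmetric in the first three coordinates and in the next three, unlike the normal used for
    shallowness. *)
Definition data_C7_126b : cfg := (Cfg (cdim C7_126b) (zweight C7_126b) (2 * (zscale C7_126b * zscale C7_126b)) (zpoints C7_126b)
 [:: (1, [:: [:: 0; 0; 1; 0; 0; 0; 0]; [:: 0; 0; 0; 1; 0; 0; 0]; [:: 0; 1; 0; 0; 0; 0; 0];
  [:: 0; 0; 0; 0; 1; 0; 0]; [:: 1; 0; 0; 0; 0; 0; 0]; [:: 0; 0; 0; 0; 0; 1; 0];
  [:: 0; 0; 0; 0; 0; 0; 1]]); (1, [:: [:: 0; 0; 0; 1; 0; 0; 0]; [:: 0; 0; 1; 0; 0; 0; 0];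
  [:: 0; 1; 0; 0; 0; 0; 0]; [:: 0; 0; 0; 0; 1; 0; 0]; [:: 0; 0; 0; 0; 0; -1; 0];
  [:: 1; 0; 0; 0; 0; 0; 0]; [:: 0; 0; 0; 0; 0; 0; -1]])]
 [:: ((Key [:: 2; 2; 2; 0; 0; 0; 1] 8 [::]), None); ((Key [:: 2; 0; 0; 0; 0; 0; 1] 4 [::]), None);
  ((Key [:: 1; 1; 1; 1; 1; -1; 2] 8 [::]), None);
  ((Key [:: 1; 1; 1; -1; -1; -1; 0] 4 [::]), Some ([:: 0; 0; 0; 0; 0; 0; -1], [:: [:: 2; 2; 0; 0; 0; 0; 0];
  [:: 2; 0; 2; 0; 0; 0; 0]; [:: 2; 0; 0; -2; 0; 0; 0]; [:: 2; 0; 0; 0; -2; 0; 0];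
  [:: 2; 0; 0; 0; 0; -2; 0]]));
  ((Key [:: 1; 1; 1; -1; -1; -1; 1] 4 [:: -1; -1; -1; 1; 1; 1; 3]), Some ([:: 1; -1; -1; 1; 1; 1; 2], [:: [:: 2; 2; 0; 0; 0; 0; 0];
  [:: 2; 0; 2; 0; 0; 0; 0]; [:: 2; 0; 0; -2; 0; 0; 0]; [:: 2; 0; 0; 0; -2; 0; 0];
  [:: 2; 0; 0; 0; 0; -2; 0]]))]
 [:: [:: (Key [:: 2; 2; 2; 0; 0; 0; 1] 8 [::])]; [:: (Key [:: 2; 0; 0; 0; 0; 0; 1] 4 [::]);
  (Key [:: 2; 2; 2; 0; 0; 0; 1] 8 [::])]; [:: (Key [:: 1; 1; 1; 1; 1; -1; 2] 8 [::]);
  (Key [:: 0; 0; 2; 0; 0; 0; 1] 4 [::]); (Key [:: 2; 2; 2; 0; 0; 0; 1] 8 [::])];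
  [:: (Key [:: 1; 1; 1; -1; -1; -1; 0] 4 [::]); (Key [:: 2; 2; 2; 0; 0; 0; 1] 8 [::])];
  [:: (Key [:: 1; 1; 1; -1; -1; -1; 1] 4 [:: -1; -1; -1; 1; 1; 1; 3]);
  (Key [:: 1; 1; 1; -1; -1; -1; 0] 4 [::]); (Key [:: 2; 2; 2; 0; 0; 0; 1] 8 [::])];
  [:: (Key [:: 0; 2; 2; 2; 0; 0; 1] 8 [::]); (Key [:: 0; 0; 2; 0; 0; 0; 1] 4 [::]);
  (Key [:: 2; 2; 2; 0; 0; 0; 1] 8 [::])]; [:: (Key [:: 0; 2; 2; 2; 0; 0; -1] 8 [::]);
  (Key [:: 0; 0; 2; 0; 0; 0; -1] 4 [::]); (Key [:: 0; 0; 2; 0; 0; 0; 1] 4 [::]);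
  (Key [:: 2; 2; 2; 0; 0; 0; 1] 8 [::])]]
 [:: ([:: 2; 2; 0; 0; 0; 0; 0], [:: Kill [:: 8; 15]%N 1 [:: (1, 0%N)]]);
  ([:: 0; 0; 0; 0; 0; 0; 2], [::]); ([:: 1; 1; 1; 1; 1; 1; 1], [::])])%Z.

Lemma data_C7_126b_ok : cfg_ok false data_C7_126b.
Proof. by vm_cast_no_check (erefl true). Qed.

Definition data_C7_126c : cfg := (Cfg (cdim C7_126c) (zweight C7_126c) (2 * (zscale C7_126c * zscale C7_126c)) (zpoints C7_126c)
 [:: (3, [:: [:: -1; 0; 0; 0; 0; 0; -2]; [:: 0; 0; 0; 0; 0; 3; 0]; [:: 0; 3; 0; 0; 0; 0; 0];
  [:: 0; 0; 0; 0; 3; 0; 0]; [:: 0; 0; 3; 0; 0; 0; 0]; [:: 0; 0; 0; 3; 0; 0; 0];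
  [:: -4; 0; 0; 0; 0; 0; 1]]); (4, [:: [:: 3; 1; -1; 1; -1; -1; 1]; [:: -1; 1; 3; 1; -1; -1; 1];
  [:: -1; -3; -1; 1; -1; -1; 1]; [:: -1; 1; -1; -3; -1; -1; 1]; [:: 1; -1; 1; -1; 1; -3; -1];
  [:: 1; -1; 1; -1; -3; 1; -1]; [:: 2; -2; 2; -2; 2; 2; 2]])]
 [:: ((Key [:: 2; 2; 2; 0; 0; 0; 1] 24 [::]), None); ((Key [:: 2; 0; 0; 0; 0; 0; 1] 12 [::]), None);
  ((Key [:: 0; 6; 6; 6; 0; 0; 3] 72 [::]), None); ((Key [:: 0; 6; 0; 0; 0; 0; 3] 36 [::]), None);
  ((Key [:: -3; 3; 3; 3; -3; -3; 0] 36 [::]), Some ([:: -3; 1; -1; -1; 1; 1; -1], [:: [:: 0; 6; 6; 0; 0; 0; 0];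
  [:: 0; 6; 0; 6; 0; 0; 0]; [:: 0; 6; 0; 0; -6; 0; 0]; [:: 0; 6; 0; 0; 0; -6; 0];
  [:: -3; 3; 3; 3; 3; -3; 3]]))]
 [:: [:: (Key [:: 2; 2; 2; 0; 0; 0; 1] 24 [::])]; [:: (Key [:: 2; 0; 0; 0; 0; 0; 1] 12 [::]);
  (Key [:: 2; 2; 2; 0; 0; 0; 1] 24 [::])]; [:: (Key [:: 0; 6; 6; 6; 0; 0; 3] 72 [::]);
  (Key [:: 0; 0; 6; 0; 0; 0; 3] 36 [::]); (Key [:: 2; 2; 2; 0; 0; 0; 1] 24 [::])];
  [:: (Key [:: 0; 6; 0; 0; 0; 0; 3] 36 [::]); (Key [:: 2; 2; 2; 0; 0; 0; 1] 24 [::])];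
  [:: (Key [:: -3; 3; 3; 3; -3; -3; 0] 36 [::]); (Key [:: 0; 0; 6; 0; 0; 0; 3] 36 [::]);
  (Key [:: 2; 2; 2; 0; 0; 0; 1] 24 [::])]; [:: (Key [:: -2; 2; 0; 0; 0; 2; -1] 24 [::]);
  (Key [:: -4; 6; 0; 0; 0; 0; 1] 36 [::]); (Key [:: 0; 6; 0; 0; 0; 0; 3] 36 [::]);
  (Key [:: 2; 2; 2; 0; 0; 0; 1] 24 [::])]; [:: (Key [:: 1; -1; 1; 1; -1; -1; 2] 24 [::]);
  (Key [:: 0; 0; 6; 0; 0; 0; 3] 36 [::]); (Key [:: 2; 2; 2; 0; 0; 0; 1] 24 [::])]]
 [:: ([:: 6; 6; 0; 0; 0; 0; 0], [::]);
  ([:: 0; 6; 6; 0; 0; 0; 0], [:: Kill [:: 22; 23]%N 1 [:: (1, 10%N)]])])%Z.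

Lemma data_C7_126c_ok : cfg_ok false data_C7_126c.
Proof. by vm_cast_no_check (erefl true). Qed.

Definition data_C7_126d : cfg := (Cfg (cdim C7_126d) (zweight C7_126d) (2 * (zscale C7_126d * zscale C7_126d)) (zpoints C7_126d)
 [:: (3, [:: [:: -1; 0; 0; 0; 0; 0; -2]; [:: 0; 0; 3; 0; 0; 0; 0]; [:: 0; 3; 0; 0; 0; 0; 0];
  [:: 0; 0; 0; 0; 3; 0; 0]; [:: 0; 0; 0; 3; 0; 0; 0]; [:: 0; 0; 0; 0; 0; 3; 0];
  [:: -4; 0; 0; 0; 0; 0; 1]]); (1, [:: [:: 1; 0; 0; 0; 0; 0; 0]; [:: 0; 0; 0; 1; 0; 0; 0];
  [:: 0; 0; 1; 0; 0; 0; 0]; [:: 0; 0; 0; 0; 0; 1; 0]; [:: 0; 0; 0; 0; -1; 0; 0];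
  [:: 0; -1; 0; 0; 0; 0; 0]; [:: 0; 0; 0; 0; 0; 0; 1]])]
 [:: ((Key [:: 2; 2; 2; 0; 0; 0; 1] 24 [::]), None); ((Key [:: 2; 0; 0; 0; 0; 0; 1] 12 [::]), None);
  ((Key [:: 1; 1; 1; 1; 1; -1; 2] 24 [::]), None); ((Key [:: 0; 6; 6; 6; 0; 0; 3] 72 [::]), None);
  ((Key [:: 0; 6; 0; 0; 0; 0; 3] 36 [::]), None); ((Key [:: -3; 3; 3; 3; 3; 3; 6] 72 [::]), None);
  ((Key [:: 6; 6; 6; 0; 0; 0; -3] 72 [::]), None); ((Key [:: 6; 0; 0; 0; 0; 0; -3] 36 [::]), None);
  ((Key [:: -3; 3; 3; 3; -3; -3; 0] 36 [::]), Some ([:: 0; 0; 0; 0; 0; 0; -1], [:: [:: 0; 6; 6; 0; 0; 0; 0];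
  [:: 0; 6; 0; 6; 0; 0; 0]; [:: 0; 6; 0; 0; -6; 0; 0]; [:: 0; 6; 0; 0; 0; -6; 0];
  [:: 0; 0; 6; 6; 0; 0; 0]]));
  ((Key [:: 0; 6; 0; 0; 0; 0; -3] 36 [::]), Some ([:: -1; 0; 0; 0; 0; 0; 0], [:: [:: 0; 6; 6; 0; 0; 0; 0];
  [:: 0; 6; -6; 0; 0; 0; 0]; [:: 0; 6; 0; 6; 0; 0; 0]; [:: 0; 6; 0; 0; 6; 0; 0];
  [:: 0; 6; 0; 0; 0; 6; 0]]));
  ((Key [:: -6; 0; 0; 0; 0; 0; 3] 36 [::]), Some ([:: -1; 1; 0; 0; 0; 0; -1], [:: [:: -3; 3; 3; 3; 3; -3; 3];
  [:: -3; 3; 3; 3; -3; 3; 3]; [:: -3; 3; 3; -3; 3; 3; 3]; [:: -3; 3; 3; -3; -3; -3; 3];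
  [:: -3; 3; -3; 3; 3; 3; 3]]));
  ((Key [:: 3; 3; 3; -3; -3; 3; 0] 36 [::]), Some ([:: 0; 0; 0; 0; 0; 0; 1], [:: [:: 6; 6; 0; 0; 0; 0; 0];
  [:: 6; 0; 6; 0; 0; 0; 0]; [:: 6; 0; 0; -6; 0; 0; 0]; [:: 6; 0; 0; 0; -6; 0; 0];
  [:: 6; 0; 0; 0; 0; 6; 0]]));
  ((Key [:: 3; 3; 3; -3; -3; -3; 0] 36 [::]), Some ([:: 0; 0; 0; 0; 0; 0; -1], [:: [:: 6; 6; 0; 0; 0; 0; 0];
  [:: 6; 0; 6; 0; 0; 0; 0]; [:: 6; 0; 0; -6; 0; 0; 0]; [:: 6; 0; 0; 0; -6; 0; 0];
  [:: 6; 0; 0; 0; 0; -6; 0]]));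
  ((Key [:: 1; 1; 1; -1; -1; 1; -1] 12 [:: -2; 0; 0; 0; 0; 0; -1]), Some ([:: -2; 0; 0; 0; 0; 0; -1], [:: [:: 0; 6; 6; 0; 0; 0; 0];
  [:: 0; 6; 0; -6; 0; 0; 0]; [:: 0; 6; 0; 0; -6; 0; 0]; [:: 0; 6; 0; 0; 0; 6; 0];
  [:: 0; 0; 6; -6; 0; 0; 0]]));
  ((Key [:: 3; 3; 3; -3; -3; -3; 3] 36 [:: 1; -1; -1; 1; 1; 1; 2]), Some ([:: 1; -1; -1; 1; 1; 1; 2], [:: [:: 6; 6; 0; 0; 0; 0; 0];
  [:: 6; 0; 6; 0; 0; 0; 0]; [:: 6; 0; 0; -6; 0; 0; 0]; [:: 6; 0; 0; 0; -6; 0; 0];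
  [:: 6; 0; 0; 0; 0; -6; 0]]))]
 [:: [:: (Key [:: 2; 2; 2; 0; 0; 0; 1] 24 [::])]; [:: (Key [:: 2; 0; 0; 0; 0; 0; 1] 12 [::]);
  (Key [:: 2; 2; 2; 0; 0; 0; 1] 24 [::])]; [:: (Key [:: 1; 1; 1; 1; 1; -1; 2] 24 [::]);
  (Key [:: 0; 0; 6; 0; 0; 0; 3] 36 [::]); (Key [:: 2; 2; 2; 0; 0; 0; 1] 24 [::])];
  [:: (Key [:: 0; 6; 6; 6; 0; 0; 3] 72 [::]); (Key [:: 0; 0; 6; 0; 0; 0; 3] 36 [::]);
  (Key [:: 2; 2; 2; 0; 0; 0; 1] 24 [::])]; [:: (Key [:: 0; 6; 0; 0; 0; 0; 3] 36 [::]);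
  (Key [:: 2; 2; 2; 0; 0; 0; 1] 24 [::])]; [:: (Key [:: -3; 3; 3; 3; 3; 3; 6] 72 [::]);
  (Key [:: 0; 0; 6; 0; 0; 0; 3] 36 [::]); (Key [:: 2; 2; 2; 0; 0; 0; 1] 24 [::])];
  [:: (Key [:: 6; 6; 6; 0; 0; 0; -3] 72 [::]); (Key [:: 0; 0; 6; 0; 0; 0; -3] 36 [::]);
  (Key [:: 0; 0; 6; 0; 0; 0; 3] 36 [::]); (Key [:: 2; 2; 2; 0; 0; 0; 1] 24 [::])];
  [:: (Key [:: 6; 0; 0; 0; 0; 0; -3] 36 [::]); (Key [:: 2; 0; 0; 0; 0; 0; 1] 12 [::]);
  (Key [:: 2; 2; 2; 0; 0; 0; 1] 24 [::])]; [:: (Key [:: -3; 3; 3; 3; -3; -3; 0] 36 [::]);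
  (Key [:: 0; 0; 6; 0; 0; 0; 3] 36 [::]); (Key [:: 2; 2; 2; 0; 0; 0; 1] 24 [::])];
  [:: (Key [:: 0; 6; 0; 0; 0; 0; -3] 36 [::]); (Key [:: 0; 6; 0; 0; 0; 0; 3] 36 [::]);
  (Key [:: 2; 2; 2; 0; 0; 0; 1] 24 [::])]; [:: (Key [:: -6; 0; 0; 0; 0; 0; 3] 36 [::]);
  (Key [:: 0; 0; 6; 0; 0; 0; 3] 36 [::]); (Key [:: 2; 2; 2; 0; 0; 0; 1] 24 [::])];
  [:: (Key [:: 3; 3; 3; -3; -3; 3; 0] 36 [::]); (Key [:: 0; 0; 6; 0; 0; 0; -3] 36 [::]);
  (Key [:: 0; 0; 6; 0; 0; 0; 3] 36 [::]); (Key [:: 2; 2; 2; 0; 0; 0; 1] 24 [::])];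
  [:: (Key [:: 3; 3; 3; -3; -3; -3; 0] 36 [::]); (Key [:: 2; 2; 2; 0; 0; 0; 1] 24 [::])];
  [:: (Key [:: 1; 1; 1; -1; -1; 1; -1] 12 [:: -2; 0; 0; 0; 0; 0; -1]);
  (Key [:: 0; 0; 6; 0; 0; 0; 3] 36 [::]); (Key [:: 2; 2; 2; 0; 0; 0; 1] 24 [::])];
  [:: (Key [:: 3; 3; 3; -3; -3; -3; 3] 36 [:: 1; -1; -1; 1; 1; 1; 2]);
  (Key [:: 3; 3; 3; -3; -3; -3; 0] 36 [::]); (Key [:: 2; 2; 2; 0; 0; 0; 1] 24 [::])];
  [:: (Key [:: -2; 2; 2; 0; 0; 0; -1] 24 [::]); (Key [:: -4; 0; 6; 0; 0; 0; 1] 36 [::]);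
  (Key [:: 0; 0; 6; 0; 0; 0; 3] 36 [::]); (Key [:: 2; 2; 2; 0; 0; 0; 1] 24 [::])];
  [:: (Key [:: 2; 0; 2; 2; 0; 0; 1] 24 [::]); (Key [:: 0; 0; 6; 0; 0; 0; 3] 36 [::]);
  (Key [:: 2; 2; 2; 0; 0; 0; 1] 24 [::])]]
 [:: ([:: 6; 6; 0; 0; 0; 0; 0], [:: Kill [:: 8; 15]%N 1 [:: (1, 0%N)]]);
  ([:: 0; 6; 6; 0; 0; 0; 0], [:: Kill [:: 8; 13]%N 1 [:: (1, 10%N)]]);
  ([:: 0; 0; 0; 0; 0; 0; 6], [::]); ([:: 3; 3; 3; 3; 3; 3; 3], [::]);
  ([:: -3; 3; 3; 3; 3; -3; 3], [:: Kill [:: 22; 23; 24]%N 6 [:: (3, 50%N); (2, 67%N); (2, 75%N);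
  (2, 76%N); (2, 77%N); (2, 79%N); (3, 109%N)]]);
  ([:: 3; 3; 3; 3; 3; -3; -3], [:: Kill [:: 15; 22; 23]%N 9 [:: (3, 59%N); (4, 83%N); (4, 91%N);
  (4, 92%N); (4, 93%N); (4, 95%N); (3, 118%N)]])])%Z.

Lemma data_C7_126d_ok : cfg_ok false data_C7_126d.
Proof. by vm_cast_no_check (erefl true). Qed.

Definition data (c : config) : cfg :=
  match c with
  | D5 => data_D5
  | L5 => data_L5
  | Q5 => data_Q5
  | R5 => data_R5
  | E6 => data_E6
  | C6_72b => data_C6_72b
  | C6_72c => data_C6_72c
  | C6_72d => data_C6_72d
  | E7 => data_E7
  | C7_126b => data_C7_126b
  | C7_126c => data_C7_126c
  | C7_126d => data_C7_126d
  end.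

Lemma data_ok (c : config) : cfg_ok (is_convex_case c) (data c).
Proof.
case: c.
- exact: data_D5_ok.
- exact: data_L5_ok.
- exact: data_Q5_ok.
- exact: data_R5_ok.
- exact: data_E6_ok.
- exact: data_C6_72b_ok.
- exact: data_C6_72c_ok.
- exact: data_C6_72d_ok.
- exact: data_E7_ok.
- exact: data_C7_126b_ok.
- exact: data_C7_126c_ok.
- exact: data_C7_126d_ok.
Qed.

Theorem theorem3 (R : realType) (c : config) (V : set 'rV[R]_(cdim c))
    (hV : isometric (points R c) V) :
  exists P : set (set 'rV[R]_(cdim c)),
    [/\ polytope P, unit_edge P & vertex_set P = V] /\
    (if is_convex_case c then P = facets (hull V)
     else ~ convex P /\ P <> facets (hull V)) /\
    creased P /\
    [set F | P F /\ exists H, external V H /\ F `<=` H] =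
      [set F | facets (hull V) F /\ unit_edge_facet F] /\
    [set F | fold P F] = [set F | P F /\ ~ facets (hull V) F].
Proof.
have [Phi aPhi ->] := isometric_adm hV.
(* Only for a concrete configuration does [c_n (data c)] reduce to [cdim c], so that the types match
   and the bound 2 < n computes. *)
case: c V hV Phi aPhi => _ _ Phi aPhi;
  lazymatch type of aPhi with adm (zweight ?c) _ _ =>
    exact: (cfg_sound (data_ok c) isT aPhi) end.
Qed.
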